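(* Let $M$ be the self-adjoint extension on $\mathcal{H}$ of the Euler operator $L_0$ (defined on polynomials). The Fantappiè transform $\mathcal{F}$ is a unitary operator from $A^2$ onto $\mathrm{Dom}(\sqrt{M})$ in $\mathcal{H}$, where $\mathrm{Dom}(\sqrt M)$ carries the norm $\|\sqrt{M}f\|_{\mathcal{H}}$. Moreover $M\mathcal{F}=I$ (that is, $M\mathcal{F}f=f$ for every $f\in A^2$ with $\mathcal{F}f\in\mathrm{Dom}(M)$), and $$\langle \mathcal{F}f,g\rangle_{\mathcal{H}}=\langle f,g\rangle_{A^2}\qquad (f\in A^2,\ g\in\mathcal{H}).$$
   Context: Let $n\ge 1$ and let $\mathbb{B}$ be the open unit ball of $\mathbb{C}^n$, with Hermitian product $\langle z,w\rangle=\sum_i z_i\overline{w_i}$. The Drury space $\mathcal{H}$ is the Hilbert space of analytic functions on $\mathbb{B}$ with reproducing kernel $\frac{1}{1-\langle z,w\rangle}$; the monomials $z^\alpha$, $\alpha\in\mathbb{N}^n$, are an orthogonal basis with $\|z^\alpha\|_{\mathcal{H}}^2=\alpha!/|\alpha|!$. The Bergman space $A^2$ is the space of analytic functions on $\mathbb{B}$ square integrable with respect to Lebesgue measure $V$, where $V$ is normalized so that $V(\mathbb{B})=1/n!$; the monomials are an orthogonal basis with $\|z^\alpha\|_{A^2}^2=\alpha!/(|\alpha|+n)!$. One has $\mathcal{H}\subseteq A^2$. The Euler operator is $L_0=\prod_{j=1}^n\left(j+\sum_{i=1}^n z_i\frac{\partial}{\partial z_i}\right)$, so $L_0z^\alpha=(|\alpha|+1)\cdots(|\alpha|+n)z^\alpha$.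 The Fantappiè transform of $f=\sum f_\alpha z^\alpha\in A^2$ is $$(\mathcal{F}f)(z)=\int_{\mathbb{B}}\frac{f(w)\,dV(w)}{1-\langle z,w\rangle}=\sum_\alpha\frac{f_\alpha}{(|\alpha|+1)\cdots(|\alpha|+n)}z^\alpha .$$ *)

(* Defs.v *)
From HB Require Import structures.
From mathcomp Require Import all_boot all_order all_algebra.
From mathcomp.multinomials Require mpoly.
Import -(notations) mpoly.
From mathcomp Require Import finmap.
From mathcomp Require Import complex.
From mathcomp Require Import all_classical all_reals all_analysis.

Set Implicit Arguments.
Unset Strict Implicit.
Unset Printing Implicit Defensive.
Import Order.TTheory GRing.Theory Num.Theory.
Import numFieldNormedType.Exports.
Import ComplexField.Normc.

Local Open Scope classical_set_scope.
Local Open Scope ring_scope.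

(* Inner products are linear in the first argument and conjugate-linear in the
   second.  An [ip_space] is a subset of an ambient space (below: the space of
   all functions on the ball) with a form that is only meaningful on that
   subset. *)
Section hilbert_spaces.
Context {R : realType} {V : lmodType R[i]}.

Record ip_space := IPSpace { carrier :> V -> Prop ; ip : V -> V -> R[i] }.

Implicit Types (H K : ip_space).

Definition is_subspace (A : set V) : Prop :=
  A 0 /\ forall (a : R[i]) f g, A f -> A g -> A (a *: f + g).

Definition is_inner_product H : Prop :=
  [/\ is_subspace H,
      forall (a : R[i]) f g h, H f -> H g -> H h ->
        ip H (a *: f + g) h = a * ip H f h + ip H g h,
      forall f g, H f -> H g -> ip H g f = (ip H f g)^* &
      forall f, H f -> f != 0 -> 0 < ip H f f].

Definition ipnorm H (f : V) : R := Num.sqrt (complex.Re (ip H f f)).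

Definition is_hilbert H : Prop :=
  is_inner_product H /\
  forall u : nat -> V, (forall k, H (u k)) ->
    (forall e : R, 0 < e -> exists N : nat, forall p q : nat,
       (N <= p)%N -> (N <= q)%N -> ipnorm H (u p - u q) < e) ->
    exists2 f, H f & (fun k => ipnorm H (u k - f)) @ \oo --> (0 : R).

Definition unitary_operator H K (U : V -> V) : Prop :=
  [/\ forall (a : R[i]) f g, H f -> H g -> U (a *: f + g) = a *: U f + U g,
      forall f g, H f -> H g -> ip K (U f) (U g) = ip H f g &
      U @` H = K].

(* The values of [op] outside [dom] are irrelevant. *)
Record operator := Operator { dom : set V ; op :> V -> V }.

Definition is_densely_defined H (T : operator) : Prop :=
  [/\ dom T `<=` H, is_subspace (dom T),
      forall f, dom T f -> H (T f),
      forall (a : R[i]) f g, dom T f -> dom T g ->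
        T (a *: f + g) = a *: T f + T g &
      forall f (e : R), H f -> 0 < e ->
        exists2 g, dom T g & ipnorm H (f - g) < e].

(* The graph of the Hilbert space adjoint of [T]. *)
Definition adjoint_graph H (T : operator) (g h : V) : Prop :=
  [/\ H g, H h & forall f, dom T f -> ip H (T f) g = ip H f h].

Definition self_adjoint H (T : operator) : Prop :=
  is_densely_defined H T /\
  forall g h, adjoint_graph H T g h <-> dom T g /\ T g = h.

Definition positive_op H (T : operator) : Prop :=
  forall f, dom T f -> 0 <= ip H (T f) f.

(* [S] is the positive self-adjoint square root of [M]: [M = S \o S], with the
   natural domain of the composition. *)
Definition is_sqrt_op H (M S : operator) : Prop :=
  [/\ self_adjoint H S, positive_op H S,
      forall f, dom M f <-> dom S f /\ dom S (S f) &
      forall f, dom M f -> S (S f) = M f].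

(* [dom T] with the inner product whose norm is [f |-> ipnorm H (T f)]. *)
Definition dom_space H (T : operator) : ip_space :=
  IPSpace (dom T) (fun f g => ip H (T f) (T g)).

End hilbert_spaces.
Arguments ip_space {R} V.
Arguments operator {R} V.

Section tuple_measure.
Context {d : measure_display} {T : measurableType d} {R : realType}.

Definition tcons n (p : T * n.-tuple T) : n.+1.-tuple T := [tuple of p.1 :: p.2].

Lemma measurable_tcons n : measurable_fun setT (@tcons n).
Proof. by apply: measurable_cons; [exact: measurable_fst|exact: measurable_snd]. Qed.

Section step.
Variables (m : {sigma_finite_measure set T -> \bar R}) (n : nat).
Variable mn : {sigma_finite_measure set (n.-tuple T) -> \bar R}.

Definition tcons_measure : set (n.+1.-tuple T) -> \bar R :=
  pushforward (m \x mn)%E (@tcons n).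

Let tcons_measure0 : tcons_measure set0 = 0%E.
Proof. by rewrite /tcons_measure /pushforward preimage_set0 measure0. Qed.

Let tcons_measure_ge0 A : (0 <= tcons_measure A)%E.
Proof. by rewrite /tcons_measure /pushforward; exact: measure_ge0. Qed.

Let tcons_measure_sigma_additive : semi_sigma_additive tcons_measure.
Proof.
move=> F mF tF mUF; rewrite /tcons_measure /pushforward preimage_bigcup.
apply: measure_semi_sigma_additive.
- by move=> k; rewrite -[X in measurable X]setTI; exact: measurable_tcons.
- apply/trivIsetP => i j _ _ ij; rewrite -preimage_setI.
  by move/trivIsetP : tF => -> //; rewrite preimage_set0.
- by rewrite -preimage_bigcup -[X in measurable X]setTI; exact: measurable_tcons.
Qed.

HB.instance Definition _ := isMeasure.Build _ _ _ tcons_measure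
  tcons_measure0 tcons_measure_ge0 tcons_measure_sigma_additive.

Let tcons_measure_sigma_finite : sigma_finite setT tcons_measure.
Proof.
have /sigma_finiteP[F [TF ndF Foo]] := sigma_finiteT m.
have /sigma_finiteP[G [TG ndG Goo]] := sigma_finiteT mn.
pose P k := [set t : n.+1.-tuple T | F k (thead t) /\ G k (behead_tuple t)].
have mP k : measurable (P k).
  have -> : P k = (fun t => tnth t ord0) @^-1` F k
                  `&` (@behead_tuple n.+1 T : _ -> n.-tuple T) @^-1` G k by [].
  apply: measurableI; rewrite -[X in measurable X]setTI.
    by apply: measurable_tnth => //; have [] := Foo k.
  by apply: measurable_behead => //; have [] := Goo k.
have PE k : @tcons n @^-1` P k = F k `*` G k.
  have bE x (t : n.-tuple T) : behead_tuple (tcons (x, t)) = t.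
    exact: val_inj.
  by rewrite predeqE => -[x t]; rewrite /P /= bE theadE.
exists P; last first.
  move=> k; split => //; rewrite /tcons_measure /pushforward PE.
  have [? ?] := Foo k; have [? ?] := Goo k.
  by rewrite product_measure1E// lte_mul_pinfty// ge0_fin_numE.
rewrite predeqE => t; split=> // _.
have : (setT : set T) (thead t) by []; rewrite TF => -[i _ Fi].
have : (setT : set (n.-tuple T)) (behead_tuple t) by []; rewrite TG => -[j _ Gj].
exists (maxn i j) => //; split.
- by move: Fi; exact/subsetPset/ndF/leq_maxl.
- by move: Gj; exact/subsetPset/ndG/leq_maxr.
Qed.

HB.instance Definition _ := Measure_isSigmaFinite.Build _ _ _ tcons_measure
  tcons_measure_sigma_finite.

End step.

Fixpoint tuple_measure (m : {sigma_finite_measure set T -> \bar R}) (n : nat) :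
    {sigma_finite_measure set (n.-tuple T) -> \bar R} :=
  match n with
  | 0%N => \d_([tuple] : 0.-tuple T)
  | k.+1 => tcons_measure m (tuple_measure m k)
  end.

End tuple_measure.

Section lebesgue2.
Variable R : realType.

Definition lebesgue2 : set (measurableTypeR R * measurableTypeR R) -> \bar R :=
  (lebesgue_measure \x lebesgue_measure)%E.

HB.instance Definition _ := Measure.on lebesgue2.

Let lebesgue2_sigma_finite : sigma_finite setT lebesgue2.
Proof.
have /sigma_finiteP[F [TF ndF Foo]] := sigma_finiteT (@lebesgue_measure R).
exists (fun k => F k `*` F k).
  rewrite -setXTT {1 2}TF predeqE => -[x y]; split.
    move=> [/= [i _ Fx] [j _ Fy]]; exists (maxn i j) => //; split.
    - by move: Fx; exact/subsetPset/ndF/leq_maxl.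
    - by move: Fy; exact/subsetPset/ndF/leq_maxr.
  by move=> [k _ []/= ? ?]; split; exists k.
move=> k; have [? ?] := Foo k; split; first exact: measurableX.
by rewrite /lebesgue2 product_measure1E// lte_mul_pinfty// ge0_fin_numE.
Qed.

HB.instance Definition _ := Measure_isSigmaFinite.Build _ _ _ lebesgue2
  lebesgue2_sigma_finite.

End lebesgue2.

Section complex_ball.
Variables (R : realType) (n : nat).
Local Notation C := R[i].

Definition cdot (z w : 'rV[C]_n) : C := \sum_i z 0 i * (w 0 i)^*.

Definition enorm (z : 'rV[C]_n) : R := Num.sqrt (complex.Re (cdot z z)).

Record uball := UBall { uball_val :> 'rV[C]_n ; _ : enorm uball_val < 1 }.
HB.instance Definition _ := [isSub for uball_val].
HB.instance Definition _ := [Choice of uball by <:].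

(* Unconditional (equivalently, absolute) summability. *)
Definition has_sum (I : choiceType) (a : I -> C) (s : C) : Prop :=
  forall e : R, 0 < e -> exists F0 : {fset I}, forall F : {fset I},
    (F0 `<=` F)%fset -> normc (s - \sum_(k <- F) a k) < e.

Definition monomial (m : multinom n) (z : 'rV[C]_n) : C :=
  \prod_(i < n) z 0 i ^+ m i.

(* Locally the sum of a convergent power series, around every point. *)
Definition analytic (f : uball -> C) : Prop :=
  forall a : uball, exists (r : R) (c : multinom n -> C), 0 < r /\
    forall z : uball, enorm (val z - val a) < r ->
      has_sum (fun m => c m * monomial m (val z - val a)) (f z).

Definition drury_kernel (w : uball) : uball -> C := fun z => (1 - cdot z w)^-1.

Definition is_drury (H : ip_space (uball -> C)) : Prop :=
  [/\ is_hilbert H,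
      forall f, H f -> analytic f,
      forall w, H (drury_kernel w) &
      forall f w, H f -> ip H f (drury_kernel w) = f w].

(* [C^n] is identified with [R^2n] to carry Lebesgue measure. *)
Definition cn_point : Type := n.-tuple (measurableTypeR R * measurableTypeR R).
HB.instance Definition _ := Measurable.on cn_point.

Definition cvec (x : cn_point) : 'rV[C]_n :=
  \row_i ((tnth x i).1 +i* (tnth x i).2)%C.

Definition cn_ball : set cn_point := [set x | enorm (cvec x) < 1].

Definition cn_lebesgue : {measure set cn_point -> \bar R} :=
  tuple_measure (@lebesgue2 R) n.

(* [vol] is Lebesgue measure normalized so that the ball has measure 1/n!. *)
Definition vol_const : R := (n`!%:R * fine (cn_lebesgue cn_ball))^-1.

Definition vol : {measure set cn_point -> \bar R} :=
  mscale (`|vol_const|%:nng) cn_lebesgue.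

(* Extension by zero, read in real coordinates. *)
Definition ext0 (T : nmodType) (f : uball -> T) (x : cn_point) : T :=
  if insub (cvec x) is Some z then f z else 0.

Definition ball_int (f : uball -> C) : C :=
  ((\int[vol]_(x in cn_ball) complex.Re (ext0 f x))%R
    +i* (\int[vol]_(x in cn_ball) complex.Im (ext0 f x))%R)%C.

Definition square_integrable (f : uball -> C) : Prop :=
  (\int[vol]_(x in cn_ball) ((normc (ext0 f x) ^+ 2)%:E) < +oo)%E.

(* A continuous function vanishing almost everywhere on the ball is zero, so no
   quotient is needed. *)
Definition bergman : ip_space (uball -> C) :=
  IPSpace (fun f => analytic f /\ square_integrable f)
    (fun f g => ball_int (fun w => f w * (g w)^*)).

Definition fantappie (f : uball -> C) : uball -> C :=
  fun z => ball_int (fun w => f w / (1 - cdot z w)).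

(* [j + \sum_i z_i d/dz_i] *)
Definition euler_factor (j : nat) (p : mpoly n C) : mpoly n C :=
  p *+ j + \sum_(i < n) mpolyX C (mnm1 i) * mderiv i p.

Definition euler (p : mpoly n C) : mpoly n C :=
  foldr euler_factor p (iota 1 n).

Definition poly_fun (p : mpoly n C) : uball -> C :=
  fun z => meval (fun i => uball_val z 0 i) p.

Definition extends_euler (T : operator (uball -> C)) : Prop :=
  forall p, dom T (poly_fun p) /\ T (poly_fun p) = poly_fun (euler p).

End complex_ball.

Arguments bergman : clear implicits.

(* Main.v *)
Require Import Defs.
From mathcomp Require Import all_boot all_order all_algebra.
From mathcomp Require Import finmap.
From mathcomp Require Import complex.
From mathcomp Require Import all_classical all_reals all_analysis.
From mathcomp Require Import measurable_realfun.
From mathcomp Require Import ring lra.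
From mathcomp.multinomials Require mpoly.
Import -(notations) mpoly.
Set Implicit Arguments.
Unset Strict Implicit.
Unset Printing Implicit Defensive.
Import Order.TTheory GRing.Theory Num.Theory.
Import numFieldNormedType.Exports.
Import ComplexField.Normc.
Local Open Scope classical_set_scope.
Local Open Scope ring_scope.

(** With [lam_k = (k+1)...(k+n)], the Euler operator is multiplication by [lam_k] on
    homogeneous polynomials of degree [k], where also [<p,q>_H = lam_k <p,q>_A], with [H] the
    Drury and [A] the Bergman space; the transform divides the component of degree [k] by
    [lam_k], so everything reduces to expansions into homogeneous components.

    An analytic function on the ball has a global such expansion: restricted to a complex
    line through 0, its Taylor series at 0 is continued along chains of discs, averages over
    roots of unity playing the role of Cauchy's formula.  In [A] distinct degrees are
    orthogonal by rotation invariance of the volume (a plane rotation is a product of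
    shears), and the monomial norms are Dirichlet integrals.  In [H] the averages of kernels
    over roots of unity tend in norm to [z |-> <z,w>^k], which forces the inner product on
    polynomials.

    If [S] is the positive square root of [M] and [p] has degree [k], then
    [u = S p - sqrt lam_k p] satisfies [S u = - sqrt lam_k u], hence [u = 0].  For
    surjectivity, given [h] in [dom S] with components [h_k], the series [sum lam_k h_k] has
    its dilates in [H], so it is analytic, and its Bergman norm is the norm of [S h]. *)

(** * Complex power series *)

(** The abstract form of the hypotheses shapes the proof. [is_drury] gives a Hilbert space with a
    kernel and says nothing of monomials: polynomials belong to [H] because [extends_euler] puts
    them into [dom M], and their norms have to be extracted from the kernel. [analytic] is local and
    does not speak of a series centred at [0] that reaches the whole ball. [sqrtM] is any positive
    square root, and its action is read off on the polynomials [epoly k w], the homogeneous parts of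
    the kernel: pairing with [epoly k w] evaluates the component of degree [k] at [w]. Membership in
    [dom sqrtM], which nothing describes explicitly, comes from self-adjointness: it suffices to
    exhibit the vector that represents the adjoint. Functions of the Bergman space may be unbounded,
    and their expansions are not known beforehand to converge in norm. They are integrated term by
    term only on rotation invariant regions where the convergence is bounded; these regions exhaust
    the ball, and norm convergence follows from Fatou's lemma. *)

Section complex_sequences.
Context {R : realType}.
Local Notation C := R[i].
Implicit Types (x y z : C) (u v : nat -> C).

Lemma normc_normr z : `|z| = (normc z)%:C%C. Proof. by []. Qed.

Lemma ncD x y : normc (x + y) <= normc x + normc y.
Proof. by rewrite -lecR rmorphD /= -!normc_normr ler_normD. Qed.

Lemma ncM x y : normc (x * y) = normc x * normc y.
Proof. exact: normcM. Qed.

Lemma nc_ge0 z : 0 <= normc z.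
Proof. by rewrite -lecR -normc_normr normr_ge0. Qed.

Lemma ncN z : normc (- z) = normc z. Proof. exact: normcN. Qed.

Lemma ncB x y : normc (x - y) = normc (y - x).
Proof. by rewrite -ncN opprB. Qed.

Lemma ncX z k : normc (z ^+ k) = normc z ^+ k.
Proof. by elim: k => [|k IH]; rewrite ?expr0 ?normc1// !exprS ncM IH. Qed.

Lemma nc_real (a : R) : normc a%:C%C = `|a|.
Proof. by rewrite /= expr0n /= addr0 sqrtr_sqr. Qed.

Lemma nc_nat k : normc (k%:R : C) = k%:R.
Proof. by rewrite -(rmorph_nat (real_complex R)) nc_real ger0_norm. Qed.

Lemma nc_conj z : normc z^* = normc z.
Proof. by case: z => a b /=; rewrite sqrrN. Qed.

Lemma nc_eq0 z : (normc z == 0) = (z == 0).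
Proof. by apply/eqP/eqP => [/eq0_normc|->]; rewrite ?normc0. Qed.

Lemma ncV z : normc z^-1 = (normc z)^-1. Proof. exact: normcV. Qed.

Lemma nc_sum I (r : seq I) (P : pred I) (F : I -> C) :
  normc (\sum_(i <- r | P i) F i) <= \sum_(i <- r | P i) normc (F i).
Proof.
elim/big_rec2: _ => [|i y1 y2 _ IH]; first by rewrite normc0.
by rewrite (le_trans (ncD _ _))// lerD2l.
Qed.

Lemma nc_triangle_sub x y : normc x - normc y <= normc (x - y).
Proof. by rewrite lerBlDr (le_trans _ (ncD _ _))// subrK. Qed.

Lemma nc_Re z : `|complex.Re z| <= normc z.
Proof. by rewrite -lecR; have := normc_ge_Re z. Qed.

Lemma nc_Im z : `|complex.Im z| <= normc z.
Proof. by case: z => a b /=; rewrite -sqrtr_sqr ler_wsqrtr// lerDr sqr_ge0. Qed.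

Lemma nc_le z : normc z <= `|complex.Re z| + `|complex.Im z|.
Proof.
case: z => a b /=; rewrite -[leRHS]ger0_norm ?addr_ge0// -sqrtr_sqr.
rewrite ler_wsqrtr// sqrrD !real_normK ?num_real//.
by have := normr_ge0 a; have := normr_ge0 b; nra.
Qed.

Lemma sqr_nc z : ((normc z ^+ 2)%:C)%C = z * z^*.
Proof. by rewrite -normCK normc_normr rmorphXn. Qed.

Lemma cReM x y : complex.Re (x * y) =
  complex.Re x * complex.Re y - complex.Im x * complex.Im y.
Proof. by case: x => a b; case: y. Qed.

Lemma cImM x y : complex.Im (x * y) =
  complex.Re x * complex.Im y + complex.Im x * complex.Re y.
Proof. by case: x => a b; case: y. Qed.

Definition ccvg u (l : C) : Prop :=
  (fun k => normc (u k - l)) @ \oo --> (0 : R).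

Lemma ccvgP u l : ccvg u l <->
  forall e : R, 0 < e -> exists N, forall k, (N <= k)%N -> normc (u k - l) < e.
Proof.
split=> [/cvgrPdist_lt ul e e0|h].
  have [N _ HN] := ul _ e0; exists N => k Nk.
  by have := HN k Nk; rewrite sub0r normrN ger0_norm// nc_ge0.
apply/cvgrPdist_lt => e e0; have [N HN] := h _ e0; exists N => // k Nk.
by rewrite sub0r normrN ger0_norm ?nc_ge0//; exact: HN.
Qed.

Lemma ccvg_squeeze u l (a : nat -> R) :
  (forall k, normc (u k - l) <= a k) -> a @ \oo --> (0 : R) -> ccvg u l.
Proof.
move=> ua a0; apply: squeeze_cvgr (@cvg_cst _ (0 : R) _ _ _) a0.
by near=> k; rewrite nc_ge0 ua.
Unshelve. all: by end_near. Qed.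

Lemma ccvg_cst l : ccvg (fun=> l) l.
Proof. by rewrite /ccvg subrr normc0; exact: cvg_cst. Qed.

Lemma ccvg_unique u l l' : ccvg u l -> ccvg u l' -> l = l'.
Proof.
move=> ul ul'; apply/eqP; rewrite -subr_eq0 -nc_eq0 eq_le nc_ge0 andbT.
apply/ler_addgt0Pl => e e0; rewrite addr0.
have e2 : 0 < e / 2 by rewrite divr_gt0.
have [N HN] := (ccvgP _ _).1 ul _ e2; have [N' HN'] := (ccvgP _ _).1 ul' _ e2.
pose k := maxn N N'.
have -> : l - l' = (u k - l') - (u k - l) by ring.
rewrite (le_trans (ncD _ _))// ncN (splitr e) lerD// ltW//.
  by apply: HN'; rewrite leq_maxr.
by apply: HN; rewrite leq_maxl.
Qed.

Lemma ccvg_eventually u v l N :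
  (forall k, (N <= k)%N -> u k = v k) -> ccvg u l -> ccvg v l.
Proof.
move=> uv /ccvgP ul; apply/ccvgP => e e0; have [N' HN'] := ul _ e0.
exists (maxn N N') => k; rewrite geq_max => /andP[Nk N'k].
by rewrite -uv// HN'.
Qed.

Lemma ccvg_sub u l (s : nat -> nat) : (forall k, (k <= s k)%N) ->
  ccvg u l -> ccvg (u \o s) l.
Proof.
move=> sk /ccvgP ul; apply/ccvgP => e e0; have [N HN] := ul _ e0.
by exists N => k Nk; apply: HN; exact: leq_trans (sk k).
Qed.

Lemma ccvgD u v l m : ccvg u l -> ccvg v m -> ccvg (fun k => u k + v k) (l + m).
Proof.
move=> ul vm; apply: (@ccvg_squeeze _ _ (fun k => normc (u k - l) + normc (v k - m))).
  move=> k; rewrite (le_trans _ (ncD _ _))//.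
  by rewrite (_ : u k + v k - (l + m) = u k - l + (v k - m))//; ring.
by rewrite -[X in _ --> X]addr0; exact: cvgD.
Qed.

Lemma ccvgM u v l m : ccvg u l -> ccvg v m -> ccvg (fun k => u k * v k) (l * m).
Proof.
move=> ul vm; apply: (@ccvg_squeeze _ _ (fun k => normc (u k - l) * normc (v k - m)
   + normc (u k - l) * normc m + normc l * normc (v k - m))).
  move=> k; rewrite -!ncM; apply: le_trans (le_trans (ncD _ _) _); last first.
    by apply: lerD (ncD _ _) (lexx _).
  by rewrite (_ : (u k - l) * (v k - m) + _ + _ = u k * v k - l * m)//; ring.
rewrite -[X in _ --> X](_ : 0 * 0 + 0 * normc m + normc l * 0 = 0 :> R); last first.
  by rewrite !mul0r mulr0 !addr0.
apply: cvgD; last by apply: cvgM => //; exact: cvg_cst.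
by apply: cvgD; apply: cvgM => //; exact: cvg_cst.
Qed.

Lemma ccvgZ c u l : ccvg u l -> ccvg (fun k => c * u k) (c * l).
Proof. by move=> ul; apply: ccvgM => //; exact: ccvg_cst. Qed.

Lemma ccvgN u l : ccvg u l -> ccvg (fun k => - u k) (- l).
Proof.
move=> /(@ccvgZ (-1)); rewrite mulN1r; apply: (@ccvg_eventually _ _ _ 0) => k _.
by rewrite mulN1r.
Qed.

Lemma ccvgB u v l m : ccvg u l -> ccvg v m -> ccvg (fun k => u k - v k) (l - m).
Proof. by move=> ul vm; apply: ccvgD => //; exact: ccvgN. Qed.

Lemma ccvg_conj u l : ccvg u l -> ccvg (fun k => (u k)^*) l^*.
Proof.
by move=> ul; apply: ccvg_squeeze ul => k; rewrite -rmorphB nc_conj.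
Qed.

Lemma ccvg_sum I (r : seq I) (P : pred I) (F : I -> nat -> C) (l : I -> C) :
  (forall i, ccvg (F i) (l i)) ->
  ccvg (fun k => \sum_(i <- r | P i) F i k) (\sum_(i <- r | P i) l i).
Proof.
move=> Fl; elim: r => [|i r IH].
  by rewrite big_nil; under eq_fun do rewrite big_nil; exact: ccvg_cst.
rewrite big_cons; under eq_fun do rewrite big_cons.
by case: (P i) => //; exact: ccvgD.
Qed.

Lemma ccvg_le u l (c : R) N :
  (forall k, (N <= k)%N -> normc (u k) <= c) -> ccvg u l -> normc l <= c.
Proof.
move=> uc /ccvgP ul; apply/ler_addgt0Pl => e e0; have [N' HN] := ul _ e0.
pose k := maxn N N'; have := HN k (leq_maxr _ _) => /ltW ke.
have -> : l = u k - (u k - l) by ring.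
by rewrite (le_trans (ncD _ _))// ncN addrC lerD// uc// leq_maxl.
Qed.

Lemma ccvg_normc u l : ccvg u l -> (fun k => normc (u k)) @ \oo --> normc l.
Proof.
move=> ul; apply/cvgrPdist_lt => e e0; have [N HN] := (ccvgP _ _).1 ul _ e0.
exists N => // k /HN; apply: le_lt_trans; rewrite ler_norml.
rewrite (ncB (u k)) nc_triangle_sub andbT.
by have := nc_triangle_sub (u k) l; rewrite ncB; lra.
Qed.

Lemma ccvg_Re u l : ccvg u l -> (fun k => complex.Re (u k)) @ \oo --> complex.Re l.
Proof.
move=> ul; apply/cvgrPdist_lt => e e0; have [N HN] := (ccvgP _ _).1 ul _ e0.
exists N => // k /HN; apply: le_lt_trans.
by rewrite ncB -raddfB /= nc_Re.
Qed.

Lemma ccvg_Im u l : ccvg u l -> (fun k => complex.Im (u k)) @ \oo --> complex.Im l.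
Proof.
move=> ul; apply/cvgrPdist_lt => e e0; have [N HN] := (ccvgP _ _).1 ul _ e0.
exists N => // k /HN; apply: le_lt_trans.
by rewrite ncB -raddfB /= nc_Im.
Qed.

Lemma ccvg_ReIm u l : (fun k => complex.Re (u k)) @ \oo --> complex.Re l ->
  (fun k => complex.Im (u k)) @ \oo --> complex.Im l -> ccvg u l.
Proof.
move=> /cvgrPdist_lt re /cvgrPdist_lt im; apply/ccvgP => e e0.
have e2 : 0 < e / 2 by rewrite divr_gt0.
have [N _ HN] := re _ e2; have [N' _ HN'] := im _ e2.
exists (maxn N N') => k; rewrite geq_max => /andP[Nk N'k].
rewrite ncB (le_lt_trans (nc_le _))// (splitr e) !raddfB /=.
by apply: ltrD; [exact: HN|exact: HN'].
Qed.

Definition csum (a : nat -> C) (s : C) : Prop :=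
  ccvg (fun K => \sum_(k < K) a k) s.

Definition bounded_sums (a : nat -> R) (M : R) : Prop :=
  forall K, \sum_(k < K) a k <= M.

Lemma bounded_sums_cvg (a : nat -> R) M : (forall k, 0 <= a k) ->
  bounded_sums a M -> exists2 l, (fun K => \sum_(k < K) a k) @ \oo --> l &
    forall K, \sum_(k < K) a k <= l.
Proof.
move=> a0 aM.
have nd : nondecreasing_seq (fun K => \sum_(k < K) a k).
  move=> p q pq; rewrite -(subnK pq) addnC big_split_ord /= lerDl.
  exact: sumr_ge0.
have ub : has_ubound (range (fun K => \sum_(k < K) a k)).
  by exists M => _ [K _ <-]; exact: aM.
have cv := nondecreasing_is_cvgn nd ub; exists (limn (fun K => \sum_(k < K) a k)) => //.
exact: nondecreasing_cvgn_le.
Qed.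

Lemma bounded_sums_tail (a : nat -> R) M : (forall k, 0 <= a k) ->
  bounded_sums a M -> forall e, 0 < e ->
  exists J, forall K, \sum_(J <= k < K) a k <= e.
Proof.
move=> a0 aM e e0; have [l al la] := bounded_sums_cvg a0 aM.
move/cvgrPdist_lt : al => /(_ _ e0)[J _ HJ]; exists J => K.
have [JK|/ltnW KJ] := leqP J K; last by rewrite big_geq// ltW.
have := HJ J (leqnn J) => /ltW; rewrite ger0_norm ?subr_ge0//.
rewrite lerBlDr; have := la K; rewrite -!(big_mkord xpredT a).
by rewrite (big_cat_nat (leq0n J) JK)//=; lra.
Qed.

Lemma sum_tailE (V : zmodType) (a : nat -> V) J K : (J <= K)%N ->
  \sum_(J <= k < K) a k = \sum_(k < K) a k - \sum_(k < J) a k.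
Proof.
move=> JK; rewrite -!(big_mkord xpredT a) (big_cat_nat (leq0n J) JK)//=.
by rewrite addrAC subrr add0r.
Qed.

Lemma abs_csum (a : nat -> C) M : bounded_sums (fun k => normc (a k)) M ->
  exists s, csum a s.
Proof.
move=> aM.
have part (f : {additive C -> R}) : (forall z, `|f z| <= normc z) ->
    exists l : R, (fun K => \sum_(k < K) f (a k)) @ \oo --> l.
  (* Adding [normc (a k)] makes the terms nonnegative, so that monotone convergence applies; the sum
     of the added terms is subtracted at the end. *)
  move=> fle; pose b k := f (a k) + normc (a k).
  have b0 k : 0 <= b k by rewrite /b; have := fle (a k); rewrite ler_norml; lra.
  have bM : bounded_sums b (M + M).
    move=> K; rewrite big_split /=; apply: lerD (aM K); apply: le_trans (aM K).
    by apply: ler_sum => i _; rewrite (le_trans (ler_norm _)).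
  have [l bl _] := bounded_sums_cvg b0 bM.
  have [m am _] := bounded_sums_cvg (fun k => nc_ge0 (a k)) aM.
  exists (l - m); rewrite (_ : (fun K => _) =
    (fun K => \sum_(k < K) b k) - (fun K => \sum_(k < K) normc (a k))).
    exact: cvgB.
  apply/funext => K /=; rewrite /GRing.opp /= /GRing.add /= -sumrB.
  by apply: eq_bigr => i _; rewrite /b addrK.
have [l1 h1] := part (@complex.Re R) nc_Re.
have [l2 h2] := part (@complex.Im R) nc_Im.
exists (l1 +i* l2)%C; apply: ccvg_ReIm => /=.
  by under eq_fun do rewrite raddf_sum.
by under eq_fun do rewrite raddf_sum.
Qed.

Lemma csum_unique a s t : csum a s -> csum a t -> s = t.
Proof. exact: ccvg_unique. Qed.

Lemma csumZ c a s : csum a s -> csum (fun k => c * a k) (c * s).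
Proof. by move=> /(ccvgZ c) h; rewrite /csum; under eq_fun do rewrite -mulr_sumr. Qed.

Lemma csum_term a s : csum a s -> ccvg a 0.
Proof.
move=> h; have h1 := ccvg_sub (s := S) (fun k => leqnSn k) h.
have := ccvgB h1 h; rewrite subrr; apply: (@ccvg_eventually _ _ _ 0) => k _ /=.
by rewrite big_ord_recr /= addrAC subrr add0r.
Qed.

End complex_sequences.

(** * Cauchy estimates and re-expansion of power series *)

Section power_series.
Context {R : realType}.
Local Notation C := R[i].
Implicit Types (a b c d : nat -> C) (D : nat -> C).

Lemma real_cvg_le (x : nat -> R) (l M : R) :
  x @ \oo --> l -> (forall k, x k <= M) -> l <= M.
Proof.
move=> /cvgrPdist_lt xl xM; apply/ler_addgt0Pl => e e0; have [N _ HN] := xl _ e0.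
by have := HN N (leqnn N); rewrite ltr_norml; have := xM N; lra.
Qed.

Lemma rcvg_sum I (r : seq I) (F : I -> nat -> R) (l : I -> R) :
  (forall i, F i @ \oo --> l i) ->
  (fun k => \sum_(i <- r) F i k) @ \oo --> \sum_(i <- r) l i.
Proof.
move=> Fl; elim: r => [|i r IH].
  by rewrite big_nil; under eq_fun do rewrite big_nil; exact: cvg_cst.
by rewrite big_cons; under eq_fun do rewrite big_cons; exact: cvgD.
Qed.

(** Over the closed field [C] the separable polynomial [X^N - 1] has [N] distinct roots, and [N]
    distinct [N]-th roots of unity include a primitive one. *)
Lemma prim_root_ex N : (0 < N)%N -> exists w : C, N.-primitive_root w.
Proof.
pose p : {poly C} := 'X^N - 1; have [r Dp] := closed_field_poly_normal p.
move=> n_gt0; rewrite (monicP _) ?monicXnsubC // scale1r in Dp.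
have rn1 : all N.-unity_root r by apply/allP=> z; rewrite -root_prod_XsubC -Dp.
have sz_r : (N < (size r).+1)%N.
  by rewrite -(size_prod_XsubC r id) -Dp size_XnsubC.
have [|z] := hasP (cyclic.has_prim_root n_gt0 rn1 _ sz_r); last by exists z.
by rewrite -separable.separable_prod_XsubC -Dp cyclotomic.separable_Xn_sub_1 // pnatr_eq0 -lt0n.
Qed.

Lemma nc_prim_root (w : C) N : N.-primitive_root w -> normc w = 1.
Proof.
move=> pw; have N0 := prim_order_gt0 pw.
have : normc w ^+ N = 1 by rewrite -ncX (prim_expr_order pw) normc1.
by move/eqP; rewrite pexpr_eq1 ?nc_ge0 ?lt0n// => [/eqP|]; rewrite -?lt0n.
Qed.

Lemma root_sum (w : C) N j : N.-primitive_root w ->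
  \sum_(i < N) w ^+ (i * j) = if (N %| j)%N then N%:R else 0.
Proof.
move=> pw; have -> : \sum_(i < N) w ^+ (i * j) = \sum_(i < N) (w ^+ j) ^+ i.
  by apply: eq_bigr => i _; rewrite mulnC exprM.
case: ifPn => [|ndv].
  rewrite (prim_order_dvd pw) => /eqP ->.
  by under eq_bigr do rewrite expr1n; rewrite sumr_const card_ord.
have x1 : w ^+ j - 1 != 0 by rewrite subr_eq0; rewrite (prim_order_dvd pw) in ndv.
apply: (mulfI x1); rewrite -subrX1 mulr0 -exprM mulnC exprM.
by rewrite (prim_expr_order pw) expr1n subrr.
Qed.

(** The exponent [N - j] stands for [-j]: averaging against this character isolates the exponents
    congruent to [j] modulo [N]. *)
Lemma root_avg (w : C) N j m : N.-primitive_root w -> (j < N)%N ->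
  \sum_(i < N) w ^+ (i * (N - j)) * w ^+ (i * m) = N%:R * ((m %% N)%N == j)%:R.
Proof.
move=> pw jN; under eq_bigr do rewrite -exprD -mulnDr.
rewrite root_sum// -[in RHS](modn_small jN).
have -> : (N %| N - j + m)%N = (m == j %[mod N])%N.
  apply/idP/idP => [dv|/eqP e]; last first.
    by rewrite /dvdn -modnDmr e modnDmr subnK ?modnn// ltnW.
  rewrite -(eqn_modDl (N - j)) subnK ?modnn; last exact: ltnW.
  by move: dv; rewrite /dvdn => /eqP ->.
by case: eqP => _; rewrite ?mulr1 ?mulr0.
Qed.

(** Cauchy's inequality without integrals. The weighted average of the values at [N] equidistant
    points of the circle is the sum of the terms whose index is congruent to [j] modulo [N]. Apart
    from the [j]-th these have index at least [N], so they lie in a tail that a large [N] makes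
    small. *)
Lemma cauchy_est a (r M B : R) j : 0 <= r ->
  bounded_sums (fun k => normc (a k) * r ^+ k) M ->
  (forall (x s : C), normc x = r -> csum (fun k => a k * x ^+ k) s -> normc s <= B) ->
  normc (a j) * r ^+ j <= B.
Proof.
move=> r0 aM aB; apply/ler_addgt0Pl => e e0.
have t0 k : 0 <= normc (a k) * r ^+ k by rewrite mulr_ge0 ?nc_ge0 ?exprn_ge0.
have [J HJ] := bounded_sums_tail t0 aM e0.
pose N := (maxn J j).+1; have jN : (j < N)%N by rewrite ltnS leq_maxr.
have JN : (J <= N)%N by rewrite leqW// leq_maxl.
have [w pw] := prim_root_ex (ltn0Sn (maxn J j)); rewrite -/N in pw.
have w1 := nc_prim_root pw.
have xr i : normc (r%:C%C * w ^+ i) = r.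
  by rewrite ncM ncX w1 expr1n mulr1 nc_real ger0_norm.
have /choice[s Hs] i : exists s, csum (fun k => a k * (r%:C%C * w ^+ i) ^+ k) s.
  apply: (@abs_csum _ _ M) => K; apply: le_trans (aM K).
  by apply: ler_sum => k _; rewrite ncM ncX xr.
pose S := N%:R^-1 * \sum_(i < N) w ^+ (i * (N - j)) * s i.
have N0 : (N%:R : R) != 0 by rewrite pnatr_eq0.
have N0' : (N%:R : C) != 0 by rewrite pnatr_eq0.
have SB : normc S <= B.
  rewrite ncM ncV nc_nat ler_pdivrMl ?ltr0n//; apply: le_trans (nc_sum _ _ _) _.
  rewrite -[X in X%:R * _](card_ord N) mulr_natl -sumr_const; apply: ler_sum => i _.
  by rewrite ncM ncX w1 expr1n mul1r (aB _ _ (xr i) (Hs i)).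
pose b k := a k * r%:C%C ^+ k * ((k %% N)%N == j)%:R.
have bS : csum b S.
  have := ccvg_sum (index_enum 'I_N) xpredT
            (fun i : 'I_N => csumZ (N%:R^-1 * w ^+ (i * (N - j))) (Hs i)).
  rewrite /S mulr_sumr; under [X in ccvg _ X -> _]eq_bigr do rewrite -mulrA.
  rewrite /csum; apply: (@ccvg_eventually _ _ _ _ 0) => K _.
  rewrite exchange_big /=; apply: eq_bigr => k _.
  rewrite (eq_bigr (fun i : 'I_N => (N%:R^-1 * (a k * r%:C%C ^+ k)) *
      (w ^+ (i * (N - j)) * w ^+ (i * k)))); last first.
    by move=> i _; rewrite exprMn -exprM; ring.
  by rewrite -mulr_sumr root_avg// /b; field.
have key : normc (S - a j * r%:C%C ^+ j) <= e.
  have h := ccvgB bS (ccvg_cst (a j * r%:C%C ^+ j)).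
  apply: (ccvg_le (N := N)) h => K NK /=.
  have -> : \sum_(k < K) b k - a j * r%:C%C ^+ j = \sum_(N <= k < K) b k.
    rewrite sum_tailE//; congr (_ - _).
    rewrite (bigD1 (Ordinal jN))//= /b modn_small// eqxx mulr1 big1 ?addr0//.
    move=> i /eqP ij; rewrite modn_small//; case: eqP => [e'|]; last by rewrite mulr0.
    by case: ij; exact: val_inj.
  apply: le_trans (nc_sum _ _ _) _; apply: le_trans (HJ K).
  rewrite (big_cat_nat JN NK) /= -[leLHS]add0r; apply: lerD.
    exact: sumr_ge0.
  apply: ler_sum => k _; rewrite /b !ncM ncX nc_real (ger0_norm r0) -[leRHS]mulr1.
  by apply: ler_wpM2l => //; case: eqP => _; rewrite ?normc0 ?normc1.
have -> : normc (a j) * r ^+ j = normc (S - (S - a j * r%:C%C ^+ j)).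
  by rewrite opprB addrC subrK ncM ncX nc_real (ger0_norm r0).
by rewrite addrC (le_trans (ncD _ _))// ncN lerD.
Qed.

(** Cauchy's inequality with the bound [0], applied to the difference. *)
Lemma ps_unique a b (r M M' : R) : 0 < r ->
  bounded_sums (fun k => normc (a k) * r ^+ k) M ->
  bounded_sums (fun k => normc (b k) * r ^+ k) M' ->
  (forall (x : C), normc x = r -> exists2 s, csum (fun k => a k * x ^+ k) s &
     csum (fun k => b k * x ^+ k) s) ->
  forall k, a k = b k.
Proof.
move=> r0 aM bM ab k; pose d k := a k - b k.
suff : normc (d k) * r ^+ k <= 0.
  rewrite pmulr_lle0 ?exprn_gt0// => d0; apply/eqP; rewrite -subr_eq0 -nc_eq0.
  by rewrite eq_le d0 nc_ge0.
apply: (@cauchy_est d r (M + M') 0 k (ltW r0)).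
  move=> K; apply: le_trans (lerD (aM K) (bM K)); rewrite -big_split /=.
  apply: ler_sum => i _; rewrite -mulrDl ler_wpM2r ?exprn_ge0 ?(ltW r0)//.
  by rewrite /d (le_trans (ncD _ _))// ncN.
move=> x s xr ds; have [t as_ bs] := ab x xr.
have h := ccvgB as_ bs; rewrite subrr in h.
suff -> : s = 0 by rewrite normc0.
apply: ccvg_unique ds _; apply: (@ccvg_eventually _ _ _ _ 0) h => K _.
by rewrite -sumrB; apply: eq_bigr => i _; rewrite /d mulrBl.
Qed.

Lemma ccvg_bounded (u : nat -> C) l : ccvg u l ->
  exists2 B, 0 <= B & forall k, normc (u k) <= B.
Proof.
move=> /ccvgP ul; have [N HN] := ul _ ltr01.
have s0 : 0 <= \sum_(k < N) normc (u k) by apply: sumr_ge0 => i _; exact: nc_ge0.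
have l0 := nc_ge0 l.
exists (1 + normc l + \sum_(k < N) normc (u k)) => [|k]; first by lra.
have [Nk|kN] := leqP N k.
  have /ltW := HN k Nk; have := nc_triangle_sub (u k) l; lra.
rewrite (bigD1 (Ordinal kN))//=.
have : 0 <= \sum_(i < N | i != Ordinal kN) normc (u i).
  by apply: sumr_ge0 => i _; exact: nc_ge0.
lra.
Qed.

Lemma geometric_sum_le (q : R) K : 0 <= q -> q < 1 ->
  \sum_(k < K) q ^+ k <= (1 - q)^-1.
Proof.
move=> q0 q1; rewrite -[leRHS]mul1r ler_pdivlMr; last by lra.
rewrite mulrC -[leLHS]opprK -mulNr opprB -subrX1 opprB.
by rewrite lerBlDr lerDl exprn_ge0.
Qed.

(** Abel's lemma: the terms at [x] tend to zero, hence are bounded, and a smaller radius gains a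
    geometric factor. *)
Lemma abel_bounded a (x t : C) : csum (fun k => a k * x ^+ k) t ->
  forall s, 0 <= s < normc x ->
  exists2 M, 0 <= M & bounded_sums (fun k => normc (a k) * s ^+ k) M.
Proof.
move=> /csum_term ax s /andP[s0 sx]; have [B B0 aB] := ccvg_bounded ax.
have x0 : 0 < normc x by exact: le_lt_trans sx.
pose q := s / normc x.
have q0 : 0 <= q by rewrite divr_ge0// ltW.
have q1 : q < 1 by rewrite ltr_pdivrMr// mul1r.
exists (B * (1 - q)^-1); first by rewrite mulr_ge0// invr_ge0; lra.
move=> K; apply: le_trans (ler_wpM2l B0 (geometric_sum_le K q0 q1)).
rewrite mulr_sumr; apply: ler_sum => k _.
rewrite /q expr_div_n mulrA ler_pdivlMr ?exprn_gt0// mulrAC.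
rewrite ler_wpM2r ?exprn_ge0//.
by have := aB k; rewrite ncM ncX.
Qed.

(** The extra binomials vanish. A range of summation independent of [j] is what allows the double
    sums below to be exchanged. *)
Lemma binom_trunc (A : comPzRingType) (x y : A) j K : (j < K)%N ->
  \sum_(k < K) 'C(j, k)%:R * (x ^+ (j - k) * y ^+ k) = (x + y) ^+ j.
Proof.
move=> jK; rewrite exprDn -(big_mkord xpredT (fun k => 'C(j, k)%:R * (x ^+ (j - k) * y ^+ k))).
rewrite (big_cat_nat (leq0n j.+1) jK) /= [X in _ + X]big_nat_cond.
rewrite [X in _ + X]big1 ?addr0; last first.
  by move=> k /andP[/andP[jk _] _]; rewrite bin_small// mul0r.
by rewrite big_mkord; apply: eq_bigr => k _; rewrite mulr_natl.
Qed.

Lemma binom_trunc_le (x y : R) j K : 0 <= x -> 0 <= y ->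
  \sum_(k < K) 'C(j, k)%:R * (x ^+ (j - k) * y ^+ k) <= (x + y) ^+ j.
Proof.
move=> x0 y0; have [jK|Kj] := ltnP j K; first by rewrite binom_trunc.
rewrite -(@binom_trunc _ x y j j.+1)// -(subnK (leqW Kj)) addnC big_split_ord /=.
by rewrite lerDl; apply: sumr_ge0 => k _; rewrite mulr_ge0 ?mulr_ge0 ?exprn_ge0.
Qed.

(** The coefficients of [\sum_j c_j (v + u)^j] as a series in [u]. The truncated subtraction is
    harmless: the binomial vanishes when [j < k]. *)
Definition taylor_coefs c (v : C) D :=
  forall k, csum (fun j => 'C(j, k)%:R * c j * v ^+ (j - k)) (D k).

Lemma taylor_coefs_ex c v (s M : R) : 0 < s ->
  bounded_sums (fun j => normc (c j) * (normc v + s) ^+ j) M ->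
  exists D, taylor_coefs c v D.
Proof.
move=> s0 cM; suff /choice[D HD] : forall k, exists Dk,
  csum (fun j => 'C(j, k)%:R * c j * v ^+ (j - k)) Dk by exists D.
move=> k; apply: (@abs_csum _ _ (M / s ^+ k)) => K.
rewrite ler_pdivlMr ?exprn_gt0//; apply: le_trans (cM K); rewrite mulr_suml.
apply: ler_sum => j _; rewrite !ncM nc_nat ncX.
have := @binom_trunc_le (normc v) s j k.+1 (nc_ge0 v) (ltW s0).
rewrite big_ord_recr /= => h.
rewrite [leLHS](_ : _ = normc (c j) * ('C(j, k)%:R * (normc v ^+ (j - k) * s ^+ k))); last by ring.
apply: ler_wpM2l; first exact: nc_ge0.
apply: le_trans h; rewrite lerDr; apply: sumr_ge0 => i _.
by rewrite mulr_ge0// mulr_ge0// exprn_ge0 ?nc_ge0// ltW.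
Qed.

(** All rearrangements are controlled by one double series of absolute values, whose sum over [k] is
    [|c_j| (|v| + s)^j] by the binomial theorem. *)
Lemma recenter c v D (s M : R) : 0 <= s ->
  bounded_sums (fun j => normc (c j) * (normc v + s) ^+ j) M ->
  taylor_coefs c v D ->
  bounded_sums (fun k => normc (D k) * s ^+ k) M /\
  forall u t, normc u <= s -> csum (fun j => c j * (v + u) ^+ j) t ->
    csum (fun k => D k * u ^+ k) t.
Proof.
move=> s0 cM cD.
pose T J0 J k := \sum_(J0 <= j < J) 'C(j, k)%:R * c j * v ^+ (j - k).
have Tle (x : R) (J0 J K : nat) : 0 <= x <= s ->
    \sum_(k < K) normc (T J0 J k) * x ^+ k <=
    \sum_(J0 <= j < J) normc (c j) * (normc v + s) ^+ j.
  move=> /andP[x0 xs].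
  apply: (@le_trans _ _ (\sum_(k < K) \sum_(J0 <= j < J)
      normc ('C(j, k)%:R * c j * v ^+ (j - k)) * x ^+ k)).
    apply: ler_sum => k _; rewrite -mulr_suml ler_wpM2r ?exprn_ge0//.
    exact: nc_sum.
  rewrite exchange_big /=; apply: ler_sum => j _.
  rewrite (eq_bigr (fun k : 'I_K => normc (c j) *
    ('C(j, k)%:R * (normc v ^+ (j - k) * x ^+ k)))); last first.
    by move=> k _; rewrite !ncM nc_nat ncX; ring.
  rewrite -mulr_sumr ler_wpM2l ?nc_ge0//.
  apply: le_trans (binom_trunc_le _ _ (nc_ge0 v) x0) _.
  by rewrite lerXn2r ?nnegrE ?addr_ge0 ?nc_ge0// lerD2l.
have TD k : ccvg (fun J => T 0%N J k) (D k).
  have := cD k; rewrite /csum; apply: (@ccvg_eventually _ _ _ _ 0) => J _.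
  by rewrite /T big_mkord.
split=> [K|u t us ct].
  apply: (@real_cvg_le (fun J => \sum_(k < K) normc (T 0%N J k) * s ^+ k)).
    apply: rcvg_sum => k; apply: cvgM; last exact: cvg_cst.
    exact: ccvg_normc.
  move=> J; apply: le_trans (cM J); rewrite -(big_mkord xpredT
    (fun j => normc (c j) * (normc v + s) ^+ j)).
  by apply: Tle; rewrite s0 lexx.
have t0 j : 0 <= normc (c j) * (normc v + s) ^+ j.
  by rewrite mulr_ge0 ?nc_ge0 ?exprn_ge0 ?addr_ge0 ?nc_ge0.
suff h : ccvg (fun K => \sum_(k < K) D k * u ^+ k -
    \sum_(j < K) c j * (v + u) ^+ j) 0.
  have := ccvgD h ct; rewrite add0r /csum.
  by apply: (@ccvg_eventually _ _ _ _ 0) => K _; rewrite subrK.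
apply/ccvgP => e e0; have e2 : 0 < e / 2 by rewrite divr_gt0.
have [J0 HJ] := bounded_sums_tail t0 cM e2; exists J0 => K JK.
rewrite subr0; apply: (@le_lt_trans _ _ (e / 2)); last by lra.
(* On the square [j, k < K] the two expansions agree exactly, so the only discrepancy is the tail
   [j >= K] in each [D k]. *)
have -> : \sum_(j < K) c j * (v + u) ^+ j = \sum_(k < K) T 0%N K k * u ^+ k.
  under [RHS]eq_bigr do rewrite /T big_mkord mulr_suml.
  rewrite exchange_big /=; apply: eq_bigr => j _.
  rewrite -(binom_trunc v u (ltn_ord j)) mulr_sumr; apply: eq_bigr => k _.
  by ring.
rewrite -sumrB.
have lim : ccvg (fun J => \sum_(k < K) (T 0%N J k * u ^+ k - T 0%N K k * u ^+ k))
    (\sum_(k < K) (D k * u ^+ k - T 0%N K k * u ^+ k)).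
  apply: ccvg_sum => k; apply: ccvgB; last exact: ccvg_cst.
  by apply: ccvgM => //; exact: ccvg_cst.
apply: (ccvg_le (N := K)) lim => J KJ.
apply: le_trans (nc_sum _ _ _) _.
apply: (@le_trans _ _ (\sum_(k < K) normc (T K J k) * normc u ^+ k)).
  apply: ler_sum => k _; rewrite -mulrBl ncM ncX.
  by rewrite /T (big_cat_nat (leq0n K) KJ) /= addrAC subrr add0r.
apply: le_trans (Tle _ _ _ _ _) _; first by rewrite nc_ge0.
apply: le_trans (HJ J); rewrite (big_cat_nat JK KJ) /= lerDr.
exact: sumr_ge0.
Qed.

End power_series.

(** * Continuation of a power series to a larger disc *)

Section continuation.
Context {R : realType}.
Local Notation C := R[i].
Implicit Types (c d : nat -> C).

(** Compactness of the square of side [2 rho] makes a radius that depends on the point uniform. The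
    local hypothesis ranges over all of [C], so the applications choose [P] vacuous outside the disc
    of interest. *)
Lemma disc_cover (P : R -> C -> Prop) (rho : R) :
  (forall a : C, exists2 dl : R, 0 < dl &
     forall a' t, normc (a' - a) < dl -> 0 < t < dl -> P t a') ->
  exists2 t : R, 0 < t & forall a, normc a <= rho -> P t a.
Proof.
move=> loc.
have cK : compact (`[- rho, rho]%classic `*` `[- rho, rho]%classic : set (R * R)).
  by apply: compact_setX; exact: segment_compact.
have [F [PF FE]] : exists F : set_system R, Filter F /\ F = 0^'+.
  by exists (0^'+); split => //; exact: at_right_proper_filter.
have /compact_near_coveringP := cK.
move=> /(_ R (0^'+) (fun t x => P t (x.1 +i* x.2)%C) (at_right_proper_filter _)).
case.
  move=> [x y] _; have [dl dl0 H] := loc (x +i* y)%C.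
  exists (ball (x, y) (dl / 2), [set t | 0 < t < dl]).
    split=> /=; first by apply: nbhsx_ballx; rewrite divr_gt0.
    near=> t; apply/andP; split=> //.
  move=> [[x' y'] t] /= [[/= bx by_] tdl]; apply: H => //.
  apply: le_lt_trans (nc_le _) _ => /=.
  move: bx by_; rewrite /ball /= (distrC x) (distrC y).
  by move=> hx hy; rewrite (splitr dl); exact: ltrD.
move=> e /= e0 He; exists (e / 2); first by rewrite divr_gt0.
move=> [x y] axy; apply: (He (e / 2) _ _ (x, y)) => /=.
- by rewrite sub0r normrN gtr0_norm ?divr_gt0// ltr_pdivrMr// ltr_pMr// ltr1n.
- by rewrite divr_gt0.
- have := le_trans (nc_Re _) axy; have := le_trans (nc_Im _) axy => /=.
  by rewrite !ler_norml !in_itv /=.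
Unshelve. all: by end_near. Qed.

(* Both power series are re-expanded around a common interior point [a1], where
   uniqueness identifies them. *)
Lemma taylor_glue (h : C -> C) d da (rho dl s0 Md Ma : R) (a a1 : C) Dd Da :
  0 < s0 ->
  (forall x, normc x < rho -> csum (fun k => d k * x ^+ k) (h x)) ->
  (forall x, normc (x - a) < dl -> csum (fun k => da k * (x - a) ^+ k) (h x)) ->
  normc a1 < rho -> normc (a1 - a) + s0 < dl ->
  bounded_sums (fun j => normc (d j) * (normc a1 + s0) ^+ j) Md ->
  bounded_sums (fun j => normc (da j) * (normc (a1 - a) + s0) ^+ j) Ma ->
  taylor_coefs d a1 Dd -> taylor_coefs da (a1 - a) Da ->
  forall k, Dd k = Da k.
Proof.
move=> s00 hd hda a1r a1d bd bda tD tDa.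
pose s1 := Num.min s0 ((rho - normc a1) / 2).
have s10 : 0 < s1 by rewrite lt_min s00 /= divr_gt0// subr_gt0.
have s1s0 : s1 <= s0 by rewrite ge_min lexx.
have s1r : s1 <= (rho - normc a1) / 2 by rewrite ge_min lexx orbT.
have bnd (f : nat -> C) (M t : R) : 0 <= t ->
    bounded_sums (fun j => normc (f j) * (t + s0) ^+ j) M ->
    bounded_sums (fun j => normc (f j) * (t + s1) ^+ j) M.
  move=> t0 fM K; apply: le_trans (fM K); apply: ler_sum => j _.
  by rewrite ler_wpM2l ?nc_ge0// lerXn2r ?nnegrE ?addr_ge0 ?(ltW s10) ?(ltW s00)// lerD2l.
have [B1 E1] := recenter (ltW s10) (bnd _ _ _ (nc_ge0 _) bd) tD.
have [B2 E2] := recenter (ltW s10) (bnd _ _ _ (nc_ge0 _) bda) tDa.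
apply: (ps_unique s10 B1 B2) => x xs; exists (h (a1 + x)).
  apply: E1; first by rewrite xs.
  by apply: hd; have := ncD a1 x; rewrite xs; move: a1r s1r; lra.
apply: E2; first by rewrite xs.
have -> : a1 - a + x = (a1 + x) - a by ring.
apply: hda; have -> : (a1 + x) - a = (a1 - a) + x by ring.
by have := ncD (a1 - a) x; rewrite xs; move: a1d s1s0; lra.
Qed.

Lemma bounded_sums_le (f : nat -> C) (M s t : R) : 0 <= s <= t ->
  bounded_sums (fun j => normc (f j) * t ^+ j) M ->
  bounded_sums (fun j => normc (f j) * s ^+ j) M.
Proof.
move=> /andP[s0 st] fM K; apply: le_trans (fM K); apply: ler_sum => j _.
by rewrite ler_wpM2l ?nc_ge0// lerXn2r ?nnegrE// (le_trans s0).
Qed.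

Lemma csum_bounded_sums (h : C -> C) c (a : C) (dl s : R) : 0 <= s < dl ->
  (forall x, normc (x - a) < dl -> csum (fun k => c k * (x - a) ^+ k) (h x)) ->
  exists2 M, 0 <= M & bounded_sums (fun j => normc (c j) * s ^+ j) M.
Proof.
move=> /andP[s0 sdl] hc; pose x := (((s + dl) / 2)%:C)%C : C.
have xE : normc x = (s + dl) / 2 by rewrite nc_real ger0_norm// divr_ge0//; lra.
have := hc (a + x); have -> : a + x - a = x by ring.
rewrite xE => /(_ ltac:(lra)) /abel_bounded; apply.
by rewrite xE s0; lra.
Qed.

Section step.
Variables (h : C -> C) (Rr : R) (d : nat -> C).
Hypothesis h_loc : forall a, normc a < Rr -> exists2 dl : R, 0 < dl &
  exists c, forall x, normc x < Rr -> normc (x - a) < dl ->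
    csum (fun k => c k * (x - a) ^+ k) (h x).

Let h_loc' a : normc a < Rr -> exists2 dl : R, 0 < dl &
  exists c, forall x, normc (x - a) < dl -> csum (fun k => c k * (x - a) ^+ k) (h x).
Proof.
move=> aR; have [dl dl0 [c Hc]] := h_loc aR.
exists (Num.min dl (Rr - normc a)); first by rewrite lt_min dl0 subr_gt0.
exists c => x; rewrite lt_min => /andP[xdl xR]; apply: Hc => //.
have := ncD (x - a) a; rewrite subrK; lra.
Qed.

(** By compactness, the Taylor coefficients at all points of the open disc obey [|D_k| t^k <= 1/t]
    with one [t]. Cauchy's inequality for the derivative of order [k] on a circle of radius [r] then
    bounds each ['C(j, k) |d_j| r^(j-k) t^k] by [1/t]. Summing over [k <= j] gives
    [|d_j| (r + t)^j <= (j + 1)/t], where [r + t] exceeds [rho]. *)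
Lemma radius_bound (rho : R) : 0 < rho < Rr ->
  (forall x, normc x < rho -> csum (fun k => d k * x ^+ k) (h x)) ->
  exists2 s, rho < s & exists2 M, 0 <= M & bounded_sums (fun k => normc (d k) * s ^+ k) M.
Proof.
move=> /andP[r0 rR] hd.
have hd0 x : normc (x - 0) < rho -> csum (fun k => d k * (x - 0) ^+ k) (h x).
  by rewrite subr0; exact: hd.
(* The single parameter [t] is a radius and, inverted, a bound, so that compactness has only one
   quantity to make uniform. *)
pose P t l := normc l < rho -> forall D, taylor_coefs d l D ->
  forall k, normc (D k) * t ^+ k <= t^-1.
have [t t0 Pt] : exists2 t : R, 0 < t & forall a, normc a <= rho -> P t a.
  apply: disc_cover => a; have [ar|ra] := leP (normc a) rho; last first.
    exists (normc a - rho); first by rewrite subr_gt0.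
    move=> a' t aa _ a'r; exfalso; have := nc_triangle_sub a a'; rewrite ncB; lra.
  have [dl dl0 [c Hc]] := h_loc' (le_lt_trans ar rR).
  have sdl : 0 <= dl / 2 < dl by apply/andP; split; lra.
  have [M M0 cM] := csum_bounded_sums sdl Hc.
  exists (Num.min (dl / 8) (M + 1)^-1).
    by rewrite lt_min invr_gt0; apply/andP; split; lra.
  move=> a' t; rewrite lt_min => /andP[ad _] /andP[t0]; rewrite lt_min => /andP[td tM].
  move=> a'r D tD k.
  have [b' b'0 bb'] : exists2 M, 0 <= M &
      bounded_sums (fun j => normc (d j) * ((normc a' + rho) / 2) ^+ j) M.
    by apply: csum_bounded_sums hd0; apply/andP; split; have := nc_ge0 a'; lra.
  pose s0 := Num.min ((rho - normc a') / 2) (dl / 8).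
  have s00 : 0 < s0 by rewrite lt_min; apply/andP; split; lra.
  have s0r : s0 <= (rho - normc a') / 2 by rewrite ge_min lexx.
  have s0d : s0 <= dl / 8 by rewrite ge_min lexx orbT.
  have bc : bounded_sums (fun j => normc (c j) * (normc (a' - a) + dl / 8) ^+ j) M.
    apply: bounded_sums_le cM; apply/andP; split; have := nc_ge0 (a' - a); lra.
  have bc0 : bounded_sums (fun j => normc (c j) * (normc (a' - a) + s0) ^+ j) M.
    apply: bounded_sums_le bc; apply/andP; split; have := nc_ge0 (a' - a); lra.
  have bd0 : bounded_sums (fun j => normc (d j) * (normc a' + s0) ^+ j) b'.
    apply: bounded_sums_le bb'; apply/andP; split; have := nc_ge0 a'; lra.
  have d80 : 0 < dl / 8 by lra.
  have [Da tDa] := taylor_coefs_ex d80 bc.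
  have DE := taylor_glue s00 hd Hc a'r ltac:(lra) bd0 bc0 tD tDa.
  have [B _] := recenter (ltW d80) bc tDa.
  rewrite DE; apply: (@le_trans _ _ (normc (Da k) * (dl / 8) ^+ k)).
    by rewrite ler_wpM2l ?nc_ge0// lerXn2r ?nnegrE ?(ltW t0) ?(ltW d80) ?(ltW td).
  apply: (@le_trans _ _ M).
    apply: le_trans (B k.+1); rewrite big_ord_recr /= lerDr.
    by apply: sumr_ge0 => i _; rewrite mulr_ge0 ?nc_ge0 ?exprn_ge0 ?ltW.
  have : M + 1 < t^-1 by rewrite -[ltLHS]invrK ltf_pV2 ?posrE ?invr_gt0//; lra.
  lra.
have dj j : normc (d j) * (rho + t / 2) ^+ j <= j.+1%:R * t^-1.
  (* Strictly inside the disc, where the series converges absolutely, while [r + t] still exceeds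
     [rho] by at least [t / 2]. *)
  pose r := Num.max (rho - t / 2) 0.
  have r00 : 0 <= r by rewrite le_max lexx orbT.
  have rr : r < rho by rewrite gt_max r0 andbT; lra.
  have rt : rho + t / 2 <= r + t.
    have : rho - t / 2 <= r by rewrite le_max lexx.
    lra.
  pose q := (r + rho) / 2.
  have [b' b'0 bb'] : exists2 M, 0 <= M & bounded_sums (fun j => normc (d j) * q ^+ j) M.
    by apply: csum_bounded_sums hd0; apply/andP; split; rewrite /q; lra.
  have qr0 : 0 < q - r by rewrite /q; lra.
  have each k : 'C(j, k)%:R * normc (d j) * r ^+ (j - k) * t ^+ k <= t^-1.
    have [jk|kj] := ltnP j k; first by rewrite bin_small// !mul0r invr_ge0 ltW.
    rewrite -ler_pdivlMr ?exprn_gt0//.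
    (* The series of the [k]-th derivative divided by [k!]; its value at [x] is the Taylor
       coefficient of order [k] at [x]. *)
    pose A i := 'C(i + k, k)%:R * d (i + k)%N.
    have := @cauchy_est R A r (b' / (q - r) ^+ k) (t^-1 / t ^+ k) (j - k)%N r00.
    rewrite /A subnK// ncM nc_nat; apply.
      move=> K; rewrite ler_pdivlMr ?exprn_gt0// mulr_suml.
      apply: (@le_trans _ _ (\sum_(i < K) normc (d (i + k)%N) * q ^+ (i + k))).
        apply: ler_sum => i _; rewrite ncM nc_nat.
        have := @binom_trunc_le R r (q - r) (i + k) k.+1 r00 (ltW qr0).
        rewrite big_ord_recr /= addnK (addrC r) subrK => h1.
        rewrite [leLHS](_ : _ = normc (d (i + k)%N) *
          ('C(i + k, k)%:R * (r ^+ i * (q - r) ^+ k))); last by ring.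
        rewrite ler_wpM2l ?nc_ge0//; apply: le_trans h1; rewrite lerDr.
        by apply: sumr_ge0 => l _; rewrite mulr_ge0// mulr_ge0// exprn_ge0// ltW.
      apply: le_trans (bb' (K + k)%N); rewrite addnC big_split_ord /=.
      rewrite [leLHS](_ : _ = \sum_(i < K) normc (d (k + i)%N) * q ^+ (k + i)); last first.
        by apply: eq_bigr => i _; rewrite addnC.
      rewrite lerDr; apply: sumr_ge0 => i _.
      by rewrite mulr_ge0 ?nc_ge0 ?exprn_ge0// /q; lra.
    move=> x s xr As.
    have xrho : normc x < rho by rewrite xr.
    have [D tD] : exists D, taylor_coefs d x D.
      by apply: (@taylor_coefs_ex _ _ _ (q - r) b') => //; rewrite xr addrC subrK.
    rewrite ler_pdivlMr ?exprn_gt0//.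
    suff -> : s = D k by apply: (Pt x (ltW xrho) xrho D tD k).
    apply: ccvg_unique As _.
    have := ccvg_sub (s := addn k) (fun i => leq_addl _ _) (tD k).
    apply: (@ccvg_eventually _ _ _ _ 0) => K _ /=.
    rewrite big_split_ord /= big1 ?add0r; last first.
      by move=> i _; rewrite bin_small// !mul0r.
    by apply: eq_bigr => i _; rewrite addKn addnC.
  apply: (@le_trans _ _ (normc (d j) * (r + t) ^+ j)).
    by rewrite ler_wpM2l ?nc_ge0// lerXn2r ?nnegrE//; lra.
  rewrite -(binom_trunc r t (ltnSn j)) mulr_sumr mulr_natl.
  rewrite -[X in t^-1 *+ X](card_ord j.+1) -sumr_const; apply: ler_sum => k _.
  by apply: le_trans (each k); rewrite [leLHS](_ : _ =
    'C(j, k)%:R * normc (d j) * r ^+ (j - k) * t ^+ k)//; ring.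
pose q := (rho + t / 4) / (rho + t / 2).
have rt0 : 0 < rho + t / 2 by lra.
have q0 : 0 <= q by rewrite divr_ge0//; lra.
have q1 : q < 1 by rewrite ltr_pdivrMr// mul1r; lra.
(* (j+1) q^j is dominated by a geometric series of ratio sqrt q *)
exists (rho + t / 4); first by lra.
pose z := Num.sqrt q; have z0 : 0 <= z by rewrite sqrtr_ge0.
have z1 : z < 1 by rewrite -sqrtr1 ltr_sqrt.
exists ((t^-1 / (1 - z)) / (1 - z)).
  by rewrite !divr_ge0 ?invr_ge0//; lra.
move=> K.
have jz j : j.+1%:R * z ^+ j <= (1 - z)^-1.
  apply: le_trans (geometric_sum_le j.+1 z0 z1).
  rewrite mulr_natl -[X in z ^+ _ *+ X](card_ord j.+1) -sumr_const.
  by apply: ler_sum => i _; apply: ler_wiXn2l; [|exact: ltW|exact: (ltn_ord i)].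
apply: le_trans (ler_wpM2l _ (geometric_sum_le K z0 z1)); last first.
  by rewrite divr_ge0 ?invr_ge0//; lra.
rewrite mulr_sumr; apply: ler_sum => j _.
have -> : rho + t / 4 = q * (rho + t / 2) by rewrite /q divfK// gt_eqF.
rewrite exprMn mulrCA; apply: (@le_trans _ _ (q ^+ j * (j.+1%:R * t^-1))).
  by rewrite ler_wpM2l ?exprn_ge0.
have -> : q = z ^+ 2 by rewrite sqr_sqrtr.
rewrite -exprM mulnC exprM expr2.
rewrite [leLHS](_ : _ = (t^-1 * z ^+ j) * (j.+1%:R * z ^+ j)); last by ring.
rewrite [leRHS](_ : _ = (t^-1 * z ^+ j) * (1 - z)^-1); last by ring.
by rewrite ler_wpM2l// mulr_ge0 ?exprn_ge0// invr_ge0 ltW.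
Qed.

(** The series already converges on a larger disc; what remains is that its sum there is [h]. Near a
    point [a] of the closed disc, the series and the local expansion of [h] at [a] have the same
    Taylor coefficients at some [a1] inside the disc, and the common expansion at [a1] reaches
    beyond [a]. *)
Lemma continuation_step (rho : R) : 0 < rho < Rr ->
  (forall x, normc x < rho -> csum (fun k => d k * x ^+ k) (h x)) ->
  exists2 rho', rho < rho' &
    forall x, normc x < rho' -> csum (fun k => d k * x ^+ k) (h x).
Proof.
move=> rR hd; have [s rs [M M0 dM]] := radius_bound rR hd.
have /andP[r0 rRr] := rR.
pose Q t l := normc l < rho + t -> csum (fun k => d k * l ^+ k) (h l).
have [t t0 Qt] : exists2 t : R, 0 < t & forall a, normc a <= s -> Q t a.
  apply: disc_cover => a; have [ar|ra] := leP (normc a) rho; last first.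
    exists ((normc a - rho) / 2); first by rewrite divr_gt0// subr_gt0.
    move=> a' t aa /andP[_ td] a'r; exfalso; have := nc_triangle_sub a a'.
    by rewrite ncB; lra.
  have [dl dl0 [c Hc]] := h_loc' (le_lt_trans ar rRr).
  have sdl : 0 <= dl / 2 < dl by apply/andP; split; lra.
  have [Mc Mc0 cM] := csum_bounded_sums sdl Hc.
  pose tau := Num.min (dl / 16) ((s - rho) / 8).
  have tau0 : 0 < tau by rewrite lt_min; apply/andP; split; lra.
  have taud : tau <= dl / 16 by rewrite ge_min lexx.
  have taus : tau <= (s - rho) / 8 by rewrite ge_min lexx orbT.
  (* Contract [a] by [1 - th], where [th] is chosen so that [th * rho < tau]. *)
  have [a1 a1r a1a] : exists2 a1, normc a1 < rho & normc (a1 - a) < tau.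
    pose th := tau / (tau + rho).
    have tr0 : 0 < tau + rho by lra.
    have th0 : 0 < th by rewrite divr_gt0.
    have th1 : th < 1 by rewrite ltr_pdivrMr// mul1r; lra.
    exists ((1 - th)%:C%C * a).
      rewrite ncM nc_real ger0_norm; last by lra.
      rewrite mulrBl mul1r; have := mulr_ge0 (ltW th0) (nc_ge0 a).
      by have [->|] := eqVneq (normc a) 0; [rewrite mulr0; lra|move=> a0;
        have : 0 < th * normc a by rewrite mulr_gt0// lt_neqAle eq_sym a0 nc_ge0]; lra.
    have -> : (1 - th)%:C%C * a - a = - (th%:C%C * a) by rewrite rmorphB /=; ring.
    rewrite ncN ncM nc_real ger0_norm ?(ltW th0)//.
    rewrite /th mulrAC ltr_pdivrMr// ltr_pM2l//; lra.
  exists tau => // a' t aa /andP[t0 tt] a'r.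
  (* Large enough to reach [a'], which is within [2 * tau] of [a1]; small enough for the disc around
     [a1] to stay within [dl / 2] of [a] and within [s] of [0]. *)
  pose s0 := 4 * tau; have s00 : 0 < s0 by rewrite /s0; lra.
  have n1 := nc_ge0 a1; have n2 := nc_ge0 (a1 - a).
  have bc : bounded_sums (fun j => normc (c j) * (normc (a1 - a) + s0) ^+ j) Mc.
    by apply: bounded_sums_le cM; apply/andP; split; rewrite /s0; lra.
  have bd : bounded_sums (fun j => normc (d j) * (normc a1 + s0) ^+ j) M.
    by apply: bounded_sums_le dM; apply/andP; split; rewrite /s0; lra.
  have [Dd tDd] := taylor_coefs_ex s00 bd.
  have [Da tDa] := taylor_coefs_ex s00 bc.
  have a1d : normc (a1 - a) + s0 < dl by rewrite /s0; lra.
  have DE := taylor_glue s00 hd Hc a1r a1d bd bc tDd tDa.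
  have [_ E1] := recenter (ltW s00) bd tDd.
  have [_ E2] := recenter (ltW s00) bc tDa.
  have us : normc (a' - a1) <= s0.
    have -> : a' - a1 = (a' - a) + (a - a1) by ring.
    by apply: le_trans (ncD _ _) _; rewrite (ncB a a1) /s0; lra.
  have [u Hu] : exists u, csum (fun k => d k * a' ^+ k) u.
    apply: (@abs_csum _ _ M) => K; apply: le_trans (dM K); apply: ler_sum => k _.
    rewrite ncM ncX ler_wpM2l ?nc_ge0// lerXn2r ?nnegrE ?nc_ge0//; lra.
  suff -> : h a' = u by [].
  have h1 : csum (fun k => Dd k * (a' - a1) ^+ k) u.
    have e1 : a1 + (a' - a1) = a' by ring.
    by apply: (E1 _ _ us); rewrite e1; exact: Hu.
  have h2 : csum (fun k => Da k * (a' - a1) ^+ k) (h a').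
    apply: E2 => //; have -> : a1 - a + (a' - a1) = a' - a by ring.
    by apply: Hc; lra.
  apply: csum_unique h2 _; rewrite (_ : (fun k => _) = (fun k => Dd k * (a' - a1) ^+ k))//.
  by apply/funext => k; rewrite DE.
exists (Num.min s (rho + t)); first by rewrite lt_min rs; lra.
move=> x; rewrite lt_min => /andP[xs xt]; apply: Qt => //; exact: ltW.
Qed.

(** A supremum below [Rr] of the admissible radii would itself be admissible, and the step would go
    beyond it. *)
Lemma continuation (r0 : R) : 0 < r0 ->
  (forall x, normc x < r0 -> csum (fun k => d k * x ^+ k) (h x)) ->
  forall x, normc x < Rr -> csum (fun k => d k * x ^+ k) (h x).
Proof.
move=> r00 hr0; pose W := [set r | 0 < r /\
  forall x, normc x < r -> csum (fun k => d k * x ^+ k) (h x)].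
apply: contrapT => /existsNP[x /not_implyP[xR nx]].
have W0 : W !=set0 by exists r0.
have ub : ubound W (normc x).
  by move=> r [rp Hr]; rewrite leNgt; apply/negP => /Hr.
have hs : has_sup W by split => //; exists (normc x).
have supx : sup W <= normc x by exact: ge_sup.
have sup0 : 0 < sup W by apply: (lt_le_trans r00); apply: ub_le_sup => //; exists (normc x).
have hsup y : normc y < sup W -> csum (fun k => d k * y ^+ k) (h y).
  move=> ys; have ys' : 0 < sup W - normc y by rewrite subr_gt0.
  have [r [rp Hr]] := sup_adherent ys' hs; rewrite opprB addrC subrK => yr.
  exact: Hr.
have sR : 0 < sup W < Rr by rewrite sup0 (le_lt_trans supx).
have [r' sr' Hr'] := continuation_step sR hsup.
have : W r' by split => //; exact: lt_trans sr'.
by move/(ub_le_sup (ex_intro _ _ ub)); rewrite leNgt sr'.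
Qed.

End step.
End continuation.

(** * Volume of the ball *)

Section measure_preserving.
Context {d : measure_display} {T : measurableType d} {R : realType}.

Definition preserves (m : set T -> \bar R) (f : T -> T) : Prop :=
  measurable_fun setT f /\ forall A, measurable A -> m (f @^-1` A) = m A.

Lemma preserves_comp m f g : preserves m f -> preserves m g -> preserves m (g \o f).
Proof.
move=> [mf fm] [mg gm]; split; first exact: measurableT_comp.
move=> A mA; rewrite comp_preimage fm ?gm// -[X in measurable X]setTI.
exact: mg.
Qed.

End measure_preserving.

Section pushforward_and_scaling.
Context {d d' : measure_display} {T : measurableType d} {T' : measurableType d'}.
Context {R : realType}.

Definition pushforward_measure (m : {measure set T -> \bar R}) (f : T -> T')
    (mf : measurable_fun setT f) : {measure set T' -> \bar R} :=
  measure_function_pushforward__canonical__measure_function_Measure m mf.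

End pushforward_and_scaling.

Section lebesgue_affine.
Context {R : realType}.
Local Notation mu := (@lebesgue_measure R).

Lemma measurable_affine (s a : R) :
  measurable_fun [set: measurableTypeR R] (fun x => s * x + a : measurableTypeR R).
Proof. by apply: measurable_funD => //; exact: mulrl_measurable. Qed.

Lemma lebesgue_affine (s a : R) (A : set (measurableTypeR R)) : 0 < s -> measurable A ->
  mu A = (s%:E * mu [set x | A (s * x + a)%R])%E.
Proof.
move=> s0 mA.
pose nu : {measure set (measurableTypeR R) -> \bar R} :=
  mscale (NngNum (ltW s0)) (pushforward_measure mu (measurable_affine s a)).
have := @lebesgue_measure_unique R nu; apply => // _ [[p q] _ <-] /=.
rewrite /nu /= /mscale /= /pushforward /=.
rewrite (_ : _ @^-1` _ = `](p - a) / s, (q - a) / s]%classic); last first.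
  apply/seteqP; split => x /=; rewrite !in_itv /= ltr_pdivrMr// ler_pdivlMr//;
    by rewrite ltrBlDr lerBrDr mulrC.
rewrite !lebesgue_measure_itv /= !lte_fin ltr_pM2r ?invr_gt0// ltrD2r.
case: ifPn => _; last by rewrite mule0.
rewrite -!EFinB -EFinM; congr (_%:E); field; exact: lt0r_neq0.
Qed.

Lemma preserves_lebesgue_shift (a : R) :
  preserves mu (fun x => x + a).
Proof.
split=> [|A mA].
  by have := measurable_affine 1 a; under eq_fun do rewrite mul1r.
rewrite (lebesgue_affine a ltr01 mA) mul1e /=.
by congr (mu _); apply/seteqP; split=> x /=; rewrite mul1r.
Qed.

Lemma ge0_integral_lebesgue_scale (s : R) (f : R -> \bar R) : 0 < s ->
  measurable_fun [set: R] f -> (forall x, 0 <= f x)%E ->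
  (\int[mu]_x f x = s%:E * \int[mu]_x f (s * x)%R)%E.
Proof.
move=> s0 mf f0.
have ms := measurable_affine s 0.
pose nu : {measure set (measurableTypeR R) -> \bar R} :=
  mscale (NngNum (ltW s0)) (pushforward_measure mu ms).
rewrite (@eq_measure_integral _ _ _ setT nu); last first.
  by move=> A mA _; exact: (lebesgue_affine 0 s0 mA).
rewrite ge0_integral_mscale//=; congr (_ * _)%E.
rewrite (ge0_integral_pushforward ms)//.
by rewrite preimage_setT; apply: eq_integral => x _ /=; rewrite addr0.
Qed.

End lebesgue_affine.

(** * Rotation invariance of Lebesgue measure on the plane *)

Section plane.
Context {R : realType}.
Local Notation mu := (@lebesgue_measure R).
Local Notation T := (measurableTypeR R).
Local Notation mu2 := (@lebesgue2 R).

Lemma preserves_swap : preserves mu2 (fun p => (p.2, p.1)).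
Proof.
have ms : measurable_fun [set: T * T] (fun p : T * T => (p.2, p.1)).
  exact: measurable_fun_pair.
split=> // A mA; apply/esym.
have := @product_measure_unique _ _ _ _ _ mu mu (pushforward_measure mu2 ms).
apply=> // X Y mX mY /=; rewrite /pushforward.
rewrite (_ : _ @^-1` _ = Y `*` X); last by apply/seteqP; split => -[x y] /= [].
by rewrite /lebesgue2 product_measure1E// muleC.
Qed.

(** Each vertical section is merely translated. *)
Lemma preserves_shear2 (s : R) : preserves mu2 (fun p => (p.1, p.2 + s * p.1)).
Proof.
have ms : measurable_fun [set: T * T] (fun p : T * T => (p.1, p.2 + s * p.1) : T * T).
  apply: measurable_fun_pair => //; apply: measurable_funD => //.
  exact: measurable_funM.
split=> // A mA; rewrite /lebesgue2 /product_measure1 /=.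
apply: eq_integral => x _ /=.
have mAx : measurable (xsection A x) by exact: measurable_xsection.
by rewrite -((preserves_lebesgue_shift (s * x)).2 _ mAx).
Qed.

Lemma preserves_shear1 (s : R) : preserves mu2 (fun p => (p.1 + s * p.2, p.2)).
Proof.
have := preserves_comp (preserves_comp preserves_swap (preserves_shear2 s)) preserves_swap.
by [].
Qed.

Definition rot (w : R[i]) (p : T * T) : T * T :=
  (complex.Re w * p.1 - complex.Im w * p.2, complex.Im w * p.1 + complex.Re w * p.2).

Lemma rot_comp w v : rot w \o rot v = rot (w * v).
Proof.
apply/funext => -[x y]; rewrite /rot /= cReM cImM.
by congr pair; ring.
Qed.

Lemma preserves_rot (w : R[i]) : normc w = 1 -> preserves mu2 (rot w).
Proof.
case: w => a b /= ab1.
have {}ab1 : a ^+ 2 + b ^+ 2 = 1.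
  by rewrite -[LHS]sqr_sqrtr ?ab1 ?expr1n// addr_ge0 ?sqr_ge0.
have gen (a' b' : R) : a' ^+ 2 + b' ^+ 2 = 1 -> b' != 0 -> preserves mu2 (rot (a' +i* b')%C).
  (* For the angle [theta] this is [- tan (theta / 2)], the slope of the two outer shears; the
     middle one has slope [sin theta]. *)
  move=> e b0; pose t := (a' - 1) / b'.
  have := preserves_comp (preserves_comp (preserves_shear1 t) (preserves_shear2 b'))
    (preserves_shear1 t).
  congr preserves; apply/funext => -[x y]; rewrite /rot /t /=.
  have e' : a' ^+ 2 = 1 - b' ^+ 2 by rewrite -e addrK.
  congr pair; last by field.
  rewrite -[RHS]add0r; apply/eqP; rewrite -subr_eq; apply/eqP.
  transitivity ((a' ^+ 2 - (1 - b' ^+ 2)) * y / b'); first by field.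
  by rewrite e' subrr !mul0r.
have [b0|] := eqVneq b 0; last exact: gen.
move: ab1; rewrite b0 expr0n /= addr0 => /eqP; rewrite sqrf_eq1 => /orP[]/eqP ->.
  rewrite (_ : rot _ = id); first by split => //; exact: measurable_id.
  by apply/funext => -[x y]; rewrite /rot /= !mul1r !mul0r subr0 add0r.
(* The formula for [t] breaks down at [-1], which is treated as the square of [i]. *)
have i1 : preserves mu2 (rot 'i%C) by apply: gen; rewrite ?oner_eq0// expr0n/= add0r expr1n.
have := preserves_comp i1 i1; rewrite rot_comp -expr2 sqr_i.
by congr preserves; congr rot; apply/eqP; rewrite eq_complex /= oppr0 !eqxx.
Qed.

End plane.

(** * Radial integration in the plane *)

Section radial.
Context {R : realType}.
Local Notation mu := (@lebesgue_measure R).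
Local Notation T := (measurableTypeR R).
Local Notation mu2 := (@lebesgue2 R).

Definition sqn (p : T * T) : R := p.1 ^+ 2 + p.2 ^+ 2.

Lemma sqn_ge0 p : 0 <= sqn p. Proof. by rewrite addr_ge0 ?sqr_ge0. Qed.

Lemma measurable_sqn : measurable_fun setT (sqn : T * T -> T).
Proof. by apply: measurable_funD; apply: measurable_funX. Qed.

(** This is pi. Only its being finite and positive is established, because it cancels against the
    normalization of the volume. *)
Definition disc_area : R := fine (mu2 [set p | sqn p < 1]).

Lemma measurable_disc t : measurable [set p | sqn p < t].
Proof.
rewrite (_ : [set p | _] = sqn @^-1` `]-oo, t[%classic); last first.
  by apply/seteqP; split => p /=; rewrite in_itv.
by rewrite -[X in measurable X]setTI; exact: measurable_sqn.
Qed.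

Lemma lebesgue2_rect (X Y : set T) : measurable X -> measurable Y ->
  mu2 (X `*` Y) = (mu X * mu Y)%E.
Proof. exact: product_measure1E. Qed.

Lemma disc_area_fin : (mu2 [set p | (sqn p < 1)%R] < +oo)%E.
Proof.
apply: (@le_lt_trans _ _ (mu2 (`[-1, 1]%classic `*` `[-1, 1]%classic))).
  apply: le_measure; rewrite ?inE; first exact: measurable_disc.
    exact: measurableX.
  move=> [x y] /=; rewrite /sqn /= !in_itv /= => h.
  by have := sqr_ge0 x; have := sqr_ge0 y; split; apply/andP; split; nra.
rewrite lebesgue2_rect// !lebesgue_measure_itv /= lte_fin.
by rewrite ifT ?ltry//; lra.
Qed.

Lemma disc_area_gt0 : 0 < disc_area.
Proof.
rewrite fine_gt0// disc_area_fin andbT.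
apply: (@lt_le_trans _ _ (mu2 (`[0, 2^-1]%classic `*` `[0, 2^-1]%classic))).
  rewrite lebesgue2_rect// !lebesgue_measure_itv /= lte_fin.
  by rewrite ifT ?invr_gt0// sube0 mule_gt0// lte_fin invr_gt0.
apply: le_measure; rewrite ?inE; [exact: measurableX|exact: measurable_disc|].
move=> [x y] /=; rewrite /sqn /= !in_itv /= => -[/andP[x0 x1] /andP[y0 y1]].
nra.
Qed.

Lemma lebesgue2_scale (s : R) A : 0 < s -> measurable A ->
  mu2 A = ((s ^+ 2)%:E * mu2 [set p | A (s * p.1, s * p.2)%R])%E.
Proof.
move=> s0 mA; have s20 : 0 <= s ^+ 2 by rewrite sqr_ge0.
have ms : measurable_fun [set: T * T] (fun p : T * T => (s * p.1, s * p.2) : T * T).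
  by apply: measurable_fun_pair; apply: measurable_funM.
pose nu : {measure set (T * T) -> \bar R} :=
  mscale (NngNum s20) (pushforward_measure mu2 ms).
have := @product_measure_unique _ _ _ _ _ mu mu nu; apply => // X Y mX mY.
have sE : (fun x : T => s * x + 0 : T) = ( *%R s) by apply/funext => x; rewrite addr0.
rewrite /nu /= /mscale /= /pushforward /=.
rewrite (_ : _ @^-1` _ = [set x | X (s * x)] `*` [set x | Y (s * x)])//.
have mpre Z : measurable Z -> measurable [set x | Z (s * x)].
  move=> mZ; rewrite -[X in measurable X]setTI.
  by have := measurable_affine s 0; rewrite sE; exact.
rewrite /lebesgue2 product_measure1E//; [|exact: mpre..].
have aff Z : measurable Z -> mu Z = (s%:E * mu [set x | Z (s * x)%R])%E.
  move=> mZ; rewrite (lebesgue_affine 0 s0 mZ); congr (_ * mu _)%E.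
  by apply/seteqP; split => x /=; rewrite addr0.
by rewrite (aff X)// (aff Y)// expr2 EFinM muleACA.
Qed.

Lemma lebesgue2_disc t :
  mu2 [set p | (sqn p < t)%R] = (disc_area * Num.max t 0)%:E.
Proof.
have [t0|t0] := leP t 0.
  rewrite mulr0 (_ : [set p | _] = set0) ?measure0//.
  by apply/seteqP; split => p //=; rewrite ltNge (le_trans t0 (sqn_ge0 p)).
pose s := Num.sqrt t; have s0 : 0 < s by rewrite sqrtr_gt0.
have s2 : s ^+ 2 = t by rewrite sqr_sqrtr// ltW.
rewrite (lebesgue2_scale s0); last exact: measurable_disc.
rewrite (_ : [set p | [set _ | _] _] = [set p | sqn p < 1]); last first.
  have sE (p : T * T) : sqn (s * p.1, s * p.2) = t * sqn p.
    by rewrite /sqn /= !exprMn s2 mulrDr.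
  have ltE (p : T * T) : (t * sqn p < t) = (sqn p < 1).
    by rewrite -[X in _ < X]mulr1 ltr_pM2l.
  by apply/seteqP; split => p /=; rewrite sE ltE.
by rewrite s2 muleC EFinM fineK// ge0_fin_numE// disc_area_fin.
Qed.

(** The image of the plane measure under [sqn] is [disc_area] times Lebesgue measure on the half
    line: the two agree on the rays []-oo, x[], which are stable under intersection and generate the
    Borel sets. *)
Lemma ge0_integral_radial (g : R -> \bar R) : measurable_fun setT g ->
  (forall t, 0 <= g t)%E ->
  (\int[mu2]_p g (sqn p) = disc_area%:E * \int[mu]_(t in `[0%R, +oo[) g t)%E.
Proof.
move=> mg g0; pose D : set T := `[0, +oo[%classic.
have mD : measurable D by exact: measurable_itv.
pose nu := pushforward_measure mu2 measurable_sqn : {measure set T -> \bar R}.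
have c0 : 0 <= disc_area by exact: ltW disc_area_gt0.
pose nu' : {measure set T -> \bar R} := mscale (NngNum c0) mu.
pose nu'' : {measure set T -> \bar R} := mscale (NngNum c0) (mrestr mu mD).
have nuE A : measurable A -> nu A = nu'' A.
  have := @measure_unique _ _ T (@RGenInftyO.G R) (fun k => `]-oo, k%:R[%classic)
    _ _ _ _ nu nu'' _ _ A; apply.
  - exact: RGenInftyO.measurableE.
  - move=> _ _ [x ->] [y ->]; exists (Num.min x y).
    by apply/seteqP; split => z /=; rewrite !in_itv /= lt_min => /andP.
  - by move=> k; exists k%:R.
  - rewrite -subTset => x _; exists (Num.truncn `|x|).+1 => //=.
    by rewrite in_itv /= (le_lt_trans (ler_norm _))// truncnS_gt.
  - move=> _ [x ->]; rewrite /nu /nu'' /= /mscale /= /pushforward /mrestr.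
    rewrite (_ : sqn @^-1` _ = [set p | sqn p < x]); last first.
      by apply/seteqP; split => p /=; rewrite in_itv.
    rewrite lebesgue2_disc EFinM; congr (_ * _)%E.
    have [x0|x0] := leP x 0.
      rewrite (_ : _ `&` _ = set0) ?measure0//.
      apply/seteqP; split => y //=; rewrite /D /= !in_itv /= andbT => -[yx y0].
      by move: (lt_le_trans yx x0); rewrite ltNge y0.
    rewrite (_ : _ `&` _ = `[0, x[%classic).
      by rewrite lebesgue_measure_itv /= lte_fin x0 sube0.
    by apply/seteqP; split => y /=; rewrite /D /= !in_itv /= andbT;
      [move=> [-> ->]|move=> /andP[-> ->]].
  - move=> k; rewrite /nu /= /pushforward.
    rewrite (_ : sqn @^-1` _ = [set p | sqn p < k%:R]); last first.
      by apply/seteqP; split => p /=; rewrite in_itv.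
    by rewrite lebesgue2_disc ltry.
transitivity (\int[nu]_(t in D) g t)%E.
  rewrite (ge0_integral_pushforward measurable_sqn)//; last exact: measurable_funTS.
  rewrite (_ : sqn @^-1` D = setT)//; apply/seteqP; split => p //= _.
  by rewrite /D /= in_itv /= andbT sqn_ge0.
rewrite (@eq_measure_integral _ _ _ D nu').
  by rewrite ge0_integral_mscale//; exact: measurable_funTS.
move=> A mA AD; rewrite nuE// /nu'' /= /mscale /= /mrestr.
by congr (_ * mu _)%E; exact/setIidPl.
Qed.

(** Scaling by [rho] reduces this to Euler's beta integral at integers. *)
Lemma integral_beta (rho : R) a b : 0 < rho ->
  (\int[mu]_(t in `[0%R, +oo[) ((t ^+ a * (rho - t) ^+ b * (t < rho)%R%:R)%:E) =
   (rho ^+ (a + b).+1 * (a`! * b`!)%:R / (a + b).+1`!%:R)%:E)%E.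
Proof.
move=> r0; pose J (r : R) (t : R) : \bar R :=
  (t ^+ a * (r - t) ^+ b * ((0 <= t) && (t < r))%R%:R)%:E.
have mJ r : measurable_fun [set: R] (J r).
  apply/measurable_EFinP; apply: measurable_funM.
    apply: measurable_funM; first exact: measurable_funX.
    by apply: measurable_funX; apply: measurable_funB.
  rewrite (_ : (fun _ => _) = \1_(`[0, r[%classic : set R)).
    by apply: measurable_indic; exact: measurable_itv.
  by apply/funext => t; rewrite indicE mem_setE in_itv.
have J0 r t : (0 <= J r t)%E.
  rewrite lee_fin; case: andP => [[t0 tr]|_]; last by rewrite mulr0.
  by rewrite mulr1 mulr_ge0// exprn_ge0// subr_ge0 ltW.
transitivity (\int[mu]_t J rho t)%E.
  rewrite integral_mkcond; apply: eq_integral => t _; rewrite patchE /J.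
  by rewrite mem_setE in_itv /= andbT; case: (0 <= t) => //=; rewrite mulr0.
rewrite (ge0_integral_lebesgue_scale r0)//.
transitivity (rho%:E * \int[mu]_t ((rho ^+ (a + b))%:E * J 1%R t))%E.
  congr (_ * _)%E; apply: eq_integral => t _; rewrite /J -EFinM; congr (_%:E).
  have -> : (0 <= rho * t) && (rho * t < rho) = (0 <= t) && (t < 1).
    by rewrite pmulr_rge0// -[X in _ < X]mulr1 ltr_pM2l.
  rewrite (_ : rho - rho * t = rho * (1 - t)); last by ring.
  by rewrite !exprMn exprD; ring.
rewrite ge0_integralZl//; [|exact: (mJ 1)|by rewrite lee_fin exprn_ge0// ltW].
transitivity (rho%:E * ((rho ^+ (a + b))%:E * (beta_fun a.+1 b.+1)%:E) : \bar R)%E.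
  congr (_ * (_ * _))%E; rewrite EFin_beta_fun.
  transitivity (\int[mu]_(t in `[0%R, 1%R[) (XMonemX a b t)%:E)%E.
    rewrite [RHS]integral_mkcond; apply: eq_integral => t _; rewrite patchE /J.
    rewrite mem_setE in_itv /=; case: ifPn => h; last by rewrite mulr0.
    by rewrite mulr1.
  rewrite integral_itv_bndo_bndc//.
    rewrite integral_mkcond; apply: eq_integral => t _.
    by rewrite !patchE /=; case: ifP.
  apply/measurable_EFinP; apply: measurable_funTS.
  by apply: measurable_funM; apply: measurable_funX => //; apply: measurable_funB.
by rewrite beta_fun_fact -!EFinM; congr (_%:E); rewrite exprS; ring.
Qed.

End radial.

Section tuple_measure_theory.
Context {d : measure_display} {T : measurableType d} {R : realType}.
Variable m : {sigma_finite_measure set T -> \bar R}.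

Definition tuple_map n (f : 'I_n -> T -> T) (t : n.-tuple T) : n.-tuple T :=
  [tuple f i (tnth t i) | i < n].

Lemma measurable_tuple_map n (f : 'I_n -> T -> T) :
  (forall i, measurable_fun setT (f i)) -> measurable_fun setT (tuple_map f).
Proof.
move=> mf; apply/measurable_fun_tnthP => i.
rewrite (_ : _ \o _ = f i \o (fun t => tnth t i)); last first.
  by apply/funext => t /=; rewrite tnth_mktuple.
by apply: measurableT_comp => //; exact: measurable_tnth.
Qed.

Lemma tnth_tcons0 n (p : T * n.-tuple T) : tnth (tcons p) ord0 = p.1.
Proof. by []. Qed.

Lemma tnth_tconsS n (p : T * n.-tuple T) i :
  tnth (tcons p) (lift ord0 i) = tnth p.2 i.
Proof. by rewrite /tcons tnthS. Qed.

Lemma preserves_tuple_map n (f : 'I_n -> T -> T) :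
  (forall i, preserves m (f i)) -> preserves (tuple_measure m n) (tuple_map f).
Proof.
elim: n f => [|n IH] f fm.
  have mf : measurable_fun setT (tuple_map f).
    by apply: measurable_tuple_map => i; case: (fm i).
  have -> : tuple_map f = id by apply/funext => t; rewrite [LHS]tuple0 [RHS]tuple0.
  by split=> //; exact: measurable_id.
have mf : measurable_fun setT (tuple_map f).
  by apply: measurable_tuple_map => i; case: (fm i).
split=> // A mA.
pose g i := f (lift ord0 i).
have [mg gm] : preserves (tuple_measure m n) (tuple_map g) by apply: IH => i; exact: fm.
have [mf0 f0m] := fm ord0.
pose F (p : T * n.-tuple T) := (f ord0 p.1, tuple_map g p.2).
have mF : measurable_fun setT F.
  by apply: measurable_fun_pair; apply: measurableT_comp.
have FE : tuple_map f \o @tcons _ T n = @tcons _ T n \o F.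
  apply/funext => p; apply: eq_from_tnth => i /=; rewrite tnth_mktuple.
  by case: (unliftP ord0 i) => [j|] ->; rewrite ?tnth_tconsS ?tnth_tcons0 /= ?tnth_mktuple.
rewrite /= /tcons_measure /pushforward -comp_preimage FE comp_preimage.
have := @product_measure_unique _ _ _ _ _ m (tuple_measure m n)
  (pushforward_measure (m \x tuple_measure m n)%E mF) _ (@tcons _ T n @^-1` A).
move=> -> //.
  move=> X Y mX mY; rewrite /= /pushforward.
  rewrite (_ : F @^-1` _ = (f ord0 @^-1` X) `*` (tuple_map g @^-1` Y))//.
  rewrite product_measure1E//; first by congr (_ * _)%E; [exact: f0m|exact: gm].
    by rewrite -[X in measurable X]setTI; exact: mf0.
  by rewrite -[X in measurable X]setTI; exact: mg.
by rewrite -[X in measurable X]setTI; exact: measurable_tcons.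
Qed.

Lemma ge0_integral_tuple_measureS n (F : n.+1.-tuple T -> \bar R) :
  measurable_fun setT F -> (forall t, 0 <= F t)%E ->
  (\int[tuple_measure m n.+1]_t F t =
   \int[m]_x \int[tuple_measure m n]_t F (tcons (x, t)))%E.
Proof.
move=> mF F0.
rewrite (@eq_measure_integral _ _ _ setT
  (pushforward_measure (m \x tuple_measure m n)%E (@measurable_tcons _ T n)))//.
rewrite (ge0_integral_pushforward (@measurable_tcons _ T n))//.
rewrite preimage_setT (fubini_tonelli1 (F \o @tcons _ T n))//.
  by apply: measurableT_comp => //; exact: measurable_tcons.
by move=> ?; exact: F0.
Qed.

Lemma ge0_integral_tuple_measure0 (F : 0.-tuple T -> \bar R) :
  measurable_fun setT F ->
  (\int[tuple_measure m 0]_t F t = F [tuple])%E.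
Proof. by move=> mF; rewrite integral_dirac// diracT mul1e. Qed.

End tuple_measure_theory.

(** * Dirichlet integrals *)

Section dirichlet.
Context {R : realType}.
Local Notation T := (measurableTypeR R * measurableTypeR R)%type.

Definition sqmono n (al : 'I_n -> nat) (t : n.-tuple T) : R :=
  \prod_(i < n) sqn (tnth t i) ^+ al i.

Definition sqtot n (t : n.-tuple T) : R := \sum_(i < n) sqn (tnth t i).

Lemma sqmono_ge0 n (al : 'I_n -> nat) t : 0 <= sqmono al t.
Proof. by apply: prodr_ge0 => i _; rewrite exprn_ge0// sqn_ge0. Qed.

Lemma sqtot_ge0 n (t : n.-tuple T) : 0 <= sqtot t.
Proof. by apply: sumr_ge0 => i _; exact: sqn_ge0. Qed.

Lemma measurable_sqn_tnth n (i : 'I_n) :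
  measurable_fun setT (fun t : n.-tuple T => sqn (tnth t i) : R).
Proof. exact: (measurableT_comp measurable_sqn (measurable_tnth i)). Qed.

Lemma measurable_sqmono n (al : 'I_n -> nat) : measurable_fun setT (sqmono al : _ -> R).
Proof.
by apply: measurable_prod => i _; apply: measurable_funX; exact: measurable_sqn_tnth.
Qed.

Lemma measurable_sqtot n : measurable_fun setT (@sqtot n).
Proof. by apply: measurable_sum => i; exact: measurable_sqn_tnth. Qed.

Lemma measurable_dirichlet n (al : 'I_n -> nat) (rho : R) :
  measurable_fun setT (fun t : n.-tuple T => (sqmono al t * (sqtot t < rho)%R%:R)%:E).
Proof.
apply/measurable_EFinP; apply: measurable_funM; first exact: measurable_sqmono.
rewrite (_ : (fun _ => _) = \1_(@sqtot n @^-1` `]-oo, rho[%classic)).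
  apply: measurable_indic; rewrite -[X in measurable X]setTI.
  exact: measurable_sqtot.
apply/funext => t; rewrite indicE; congr ((nat_of_bool _)%:R).
by apply/idP/idP; rewrite inE /= in_itv.
Qed.

(** Fixing the first variable [p] leaves the integral in the others with [rho - sqn p] in place of
    [rho], which is why [rho] is general. By induction that is a constant times a power, and radial
    integration in [p] yields a beta integral. *)
Lemma dirichlet n (al : 'I_n -> nat) (rho : R) : 0 < rho ->
  (\int[tuple_measure (@lebesgue2 R) n]_t (sqmono al t * (sqtot t < rho)%R%:R)%:E =
   (disc_area ^+ n * (\prod_(i < n) (al i)`!)%:R / (\sum_(i < n) al i + n)`!%:R
     * rho ^+ (\sum_(i < n) al i + n))%:E)%E.
Proof.
elim: n al rho => [|n IH] al rho r0.
  rewrite ge0_integral_tuple_measure0; last exact: measurable_dirichlet.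
  by rewrite /sqmono /sqtot !big_ord0 r0 !expr0 fact0 divr1 !mulr1.
rewrite ge0_integral_tuple_measureS; [|exact: measurable_dirichlet|]; last first.
  by move=> t; rewrite lee_fin mulr_ge0// sqmono_ge0.
pose al' i := al (lift ord0 i).
pose b := (\sum_(i < n) al' i + n)%N.
pose K : R := disc_area ^+ n * (\prod_(i < n) (al' i)`!)%:R / b`!%:R.
have K0 : 0 <= K by rewrite divr_ge0// mulr_ge0// exprn_ge0// ltW// disc_area_gt0.
pose g (t : R) : \bar R := (K * (t ^+ al ord0 * (rho - t) ^+ b * (t < rho)%R%:R))%:E.
have mg' : measurable_fun setT (fun t : R => t ^+ al ord0 * (rho - t) ^+ b * (t < rho)%R%:R).
  apply: measurable_funM.
    apply: measurable_funM; first exact: measurable_funX.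
    by apply: measurable_funX; apply: measurable_funB.
  rewrite (_ : (fun _ => _) = \1_(`]-oo, rho[%classic : set R)).
    by apply: measurable_indic; exact: measurable_itv.
  by apply/funext => t; rewrite indicE mem_setE in_itv.
have g'0 t : 0 <= t -> 0 <= t ^+ al ord0 * (rho - t) ^+ b * (t < rho)%R%:R.
  move=> t0; case: (ltP t rho) => tr; last by rewrite mulr0.
  by rewrite mulr1 mulr_ge0// exprn_ge0// subr_ge0 ltW.
(* [g] may be negative to the left of [0], while the radial formula asks for a nonnegative integrand
   on the whole line; the truncation does not affect values at [sqn p]. *)
transitivity (\int[@lebesgue2 R]_p g (Num.max (sqn p) 0%R))%E.
  apply: eq_integral => p _; rewrite max_l ?sqn_ge0//.
  transitivity (\int[tuple_measure (@lebesgue2 R) n]_t ((sqn p ^+ al ord0)%:E *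
      (sqmono al' t * (sqtot t < rho - sqn p)%R%:R)%:E))%E.
    apply: eq_integral => t _; rewrite -EFinM; congr (_%:E).
    rewrite /sqmono /sqtot !big_ord_recl !tnth_tcons0 /= mulrA; congr (_ * _ * _%:R).
      by apply: eq_bigr => i _; rewrite tnth_tconsS.
    by rewrite ltrBrDl; under eq_bigr do rewrite tnth_tconsS.
  rewrite ge0_integralZl//; first last.
  - by rewrite lee_fin exprn_ge0// sqn_ge0.
  - by move=> t _; rewrite lee_fin mulr_ge0// sqmono_ge0.
  - exact: measurable_dirichlet.
  rewrite /g; case: (ltP (sqn p) rho) => pr.
    rewrite IH ?subr_gt0// -EFinM; congr (_%:E).
    by rewrite -[true%:R]/1 mulr1 -/b /K; ring.
  rewrite mulr0 mulr0 (eq_integral (fun=> 0%E)) ?integral0 ?mule0// => t _.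
  rewrite (_ : (sqtot t < rho - sqn p) = false) ?mulr0//.
  by apply/negbTE; rewrite -leNgt (le_trans _ (sqtot_ge0 t))// subr_le0.
rewrite (@ge0_integral_radial R (fun t => g (Num.max t 0))); first last.
- by move=> t; rewrite lee_fin mulr_ge0// g'0// le_max lexx orbT.
- apply/measurable_EFinP; apply: measurable_funM => //.
  apply: (measurableT_comp mg'); exact: measurable_maxr.
transitivity (disc_area%:E * \int[@lebesgue_measure R]_(t in `[0%R, +oo[)
    (K%:E * (t ^+ al ord0 * (rho - t) ^+ b * (t < rho)%R%:R)%:E))%E.
  congr (_ * _)%E; apply: eq_integral => t.
  by rewrite inE /= in_itv /= andbT => t0; rewrite max_l// /g EFinM.
rewrite ge0_integralZl//; first last.
- by move=> t /=; rewrite in_itv /= andbT => t0; rewrite lee_fin g'0.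
- by apply/measurable_EFinP; exact: measurable_funTS.
rewrite integral_beta// -!EFinM; congr (_%:E).
rewrite !big_ord_recl /= -/al' -/(\sum_(i < n) al' i).
have -> : (al ord0 + \sum_(i < n) al (lift ord0 i) + n.+1)%N = (al ord0 + b).+1.
  by rewrite /b addnS addnA.
have b0 : (b`!%:R : R) != 0 by rewrite pnatr_eq0 -lt0n fact_gt0.
have ab0 : ((al ord0 + b).+1`!%:R : R) != 0 by rewrite pnatr_eq0 -lt0n fact_gt0.
move: ab0; move: ((al ord0 + b).+1`!) => F F0.
by rewrite /K !natrM !exprS /al'; field; rewrite F0 b0.
Qed.

End dirichlet.

(** * Square integrable functions *)

Section complex_integral.
Context {d : measure_display} {T : measurableType d} {R : realType}.
Local Notation C := R[i].
Implicit Types (D : set T) (F G : T -> C).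

Definition cmeas D F : Prop :=
  measurable_fun D (fun x => complex.Re (F x)) /\
  measurable_fun D (fun x => complex.Im (F x)).

Lemma cmeas_cst D (c : C) : cmeas D (fun=> c).
Proof. by split; exact: measurable_cst. Qed.

Lemma cmeasD D F G : cmeas D F -> cmeas D G -> cmeas D (fun x => F x + G x).
Proof.
move=> [f1 f2] [g1 g2]; split; under eq_fun do rewrite raddfD /=;
  exact: measurable_funD.
Qed.

Lemma cmeasM D F G : cmeas D F -> cmeas D G -> cmeas D (fun x => F x * G x).
Proof.
move=> [f1 f2] [g1 g2]; split.
  under eq_fun do rewrite cReM.
  by apply: measurable_funB; exact: measurable_funM.
under eq_fun do rewrite cImM.
by apply: measurable_funD; exact: measurable_funM.
Qed.

Lemma cRe_conj (z : C) : complex.Re z^* = complex.Re z. Proof. by case: z. Qed.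
Lemma cIm_conj (z : C) : complex.Im z^* = - complex.Im z. Proof. by case: z. Qed.

Lemma cmeas_conj D F : cmeas D F -> cmeas D (fun x => (F x)^*).
Proof.
move=> [f1 f2]; split; first by under eq_fun do rewrite cRe_conj.
by under eq_fun do rewrite cIm_conj; exact: measurableT_comp.
Qed.

Lemma cmeas_sum D I (r : seq I) (F : I -> T -> C) : (forall i, cmeas D (F i)) ->
  cmeas D (fun x => \sum_(i <- r) F i x).
Proof.
move=> mF; elim: r => [|i r IH].
  by under eq_fun do rewrite big_nil; exact: cmeas_cst.
by under eq_fun do rewrite big_cons; exact: cmeasD.
Qed.

Lemma cmeas_prod D I (r : seq I) (F : I -> T -> C) : (forall i, cmeas D (F i)) ->
  cmeas D (fun x => \prod_(i <- r) F i x).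
Proof.
move=> mF; elim: r => [|i r IH].
  by under eq_fun do rewrite big_nil; exact: cmeas_cst.
by under eq_fun do rewrite big_cons; exact: cmeasM.
Qed.

Lemma cmeasX D F k : cmeas D F -> cmeas D (fun x => F x ^+ k).
Proof.
move=> mF; elim: k => [|k IH]; first by under eq_fun do rewrite expr0; exact: cmeas_cst.
by under eq_fun do rewrite exprS; exact: cmeasM.
Qed.

Lemma sqr_nc_ReIm (z : C) : normc z ^+ 2 = complex.Re z ^+ 2 + complex.Im z ^+ 2.
Proof. by case: z => a b /=; rewrite sqr_sqrtr// addr_ge0 ?sqr_ge0. Qed.

Lemma measurable_sqr_nc D F : cmeas D F -> measurable_fun D (fun x => normc (F x) ^+ 2).
Proof.
move=> [f1 f2]; under eq_fun do rewrite sqr_nc_ReIm.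
by apply: measurable_funD; exact: measurable_funX.
Qed.

Lemma measurable_nc D F : cmeas D F -> measurable_fun D (fun x => normc (F x)).
Proof.
move=> mF; rewrite (_ : (fun _ => _) = @Num.sqrt R \o (fun x => normc (F x) ^+ 2)).
  apply: measurableT_comp; last exact: measurable_sqr_nc.
  by apply: continuous_measurable_fun; exact: sqrt_continuous.
by apply/funext => x /=; rewrite sqrtr_sqr ger0_norm// nc_ge0.
Qed.

Lemma cmeas_lim D (F : nat -> T -> C) G : measurable D -> (forall k, cmeas D (F k)) ->
  (forall x, D x -> ccvg (F ^~ x) (G x)) -> cmeas D G.
Proof.
move=> mD mF FG; split.
  apply: (measurable_fun_cvg (h := fun k x => complex.Re (F k x))) => //.
    by move=> k; case: (mF k).
  by move=> x Dx; exact: (ccvg_Re (FG x Dx)).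
apply: (measurable_fun_cvg (h := fun k x => complex.Im (F k x))) => //.
  by move=> k; case: (mF k).
by move=> x Dx; exact: (ccvg_Im (FG x Dx)).
Qed.

Variable mu : {measure set T -> \bar R}.

Definition cintegrable D F : Prop :=
  mu.-integrable D (fun x => (complex.Re (F x))%:E) /\
  mu.-integrable D (fun x => (complex.Im (F x))%:E).

Lemma integrable_eq D (f g : T -> \bar R) : measurable D ->
  mu.-integrable D f -> (forall x, D x -> f x = g x) -> mu.-integrable D g.
Proof.
by move=> mD fi fg; apply: (eq_integrable mD f) => // x; rewrite inE => /fg.
Qed.

Definition cintegral D F : C :=
  ((\int[mu]_(x in D) complex.Re (F x))%R +i* (\int[mu]_(x in D) complex.Im (F x))%R)%C.

Lemma eq_cintegral D F G : (forall x, D x -> F x = G x) -> cintegral D F = cintegral D G.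
Proof.
by move=> FG; congr (_ +i* _)%C; apply: eq_Rintegral => x; rewrite inE => /FG ->.
Qed.

Lemma cintegrable_le D F (g : T -> R) : measurable D -> cmeas D F ->
  mu.-integrable D (EFin \o g) -> (forall x, D x -> normc (F x) <= g x) ->
  cintegrable D F.
Proof.
move=> mD [f1 f2] ig Fg; split.
  apply: (le_integrable mD _ _ ig); first exact/measurable_EFinP.
  move=> x Dx /=; rewrite lee_fin (le_trans (nc_Re _))// (le_trans (Fg x Dx))//.
  exact: ler_norm.
apply: (le_integrable mD _ _ ig); first exact/measurable_EFinP.
move=> x Dx /=; rewrite lee_fin (le_trans (nc_Im _))// (le_trans (Fg x Dx))//.
exact: ler_norm.
Qed.

Lemma cintegrableD D F G : measurable D -> cintegrable D F -> cintegrable D G ->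
  cintegrable D (fun x => F x + G x).
Proof.
move=> mD [f1 f2] [g1 g2]; split.
  apply: (integrable_eq mD (integrableD mD f1 g1)) => x _.
  by rewrite raddfD.
apply: (integrable_eq mD (integrableD mD f2 g2)) => x _.
by rewrite raddfD.
Qed.

Lemma cintegrableZ D F (a : C) : measurable D -> cintegrable D F ->
  cintegrable D (fun x => a * F x).
Proof.
move=> mD [f1 f2]; split.
  apply: (integrable_eq mD (integrableB mD (integrableZl mD (complex.Re a) f1)
    (integrableZl mD (complex.Im a) f2))) => x _.
  by rewrite cReM.
apply: (integrable_eq mD (integrableD mD (integrableZl mD (complex.Re a) f2)
  (integrableZl mD (complex.Im a) f1))) => x _.
by rewrite cImM.
Qed.

Lemma cintegralD D F G : measurable D -> cintegrable D F -> cintegrable D G ->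
  cintegral D (fun x => F x + G x) = cintegral D F + cintegral D G.
Proof.
move=> mD [f1 f2] [g1 g2]; apply/eqP; rewrite eq_complex /=.
rewrite -!RintegralD//; apply/andP; split; apply/eqP; apply: eq_Rintegral => x _;
  by rewrite raddfD.
Qed.

Lemma cintegralZ D F (a : C) : measurable D -> cintegrable D F ->
  cintegral D (fun x => a * F x) = a * cintegral D F.
Proof.
move=> mD [f1 f2]; apply/eqP; rewrite eq_complex cReM cImM /=.
have z1 r := integrableZl mD r f1; have z2 r := integrableZl mD r f2.
rewrite -!RintegralZl// -RintegralB//; [|exact: z1|exact: z2].
rewrite -RintegralD//; [|exact: z2|exact: z1].
apply/andP; split; apply/eqP; apply: eq_Rintegral => x _; first by rewrite cReM.
by rewrite cImM.
Qed.

Lemma cintegral_conj D F : measurable D -> cintegrable D F ->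
  cintegral D (fun x => (F x)^*) = (cintegral D F)^*.
Proof.
move=> mD [f1 f2]; apply/eqP; rewrite eq_complex /= -mulN1r -RintegralZl//.
apply/andP; split; apply/eqP; apply: eq_Rintegral => x _; first by rewrite cRe_conj.
by rewrite cIm_conj mulN1r.
Qed.

Lemma cintegral0 D : cintegral D (fun=> 0) = 0.
Proof.
by apply/eqP; rewrite eq_complex /= /Rintegral integral0_eq//= eqxx.
Qed.

Lemma Rintegral_dct D (f : nat -> T -> R) (g b : T -> R) : measurable D ->
  (forall k, measurable_fun D (f k)) -> measurable_fun D g ->
  mu.-integrable D (EFin \o b) ->
  (forall x, D x -> f ^~ x @ \oo --> g x) ->
  (forall k x, D x -> `|f k x| <= b x) ->
  (fun k => \int[mu]_(x in D) f k x)%R @ \oo --> (\int[mu]_(x in D) g x)%R.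
Proof.
move=> mD mf mg ib fg fb.
have [] := @dominated_convergence _ _ _ mu D mD (fun k => EFin \o f k) (EFin \o g)
  (EFin \o b) _ _ _ ib.
- by move=> k; exact/measurable_EFinP.
- exact/measurable_EFinP.
- by apply: aeW => x Dx; apply: cvg_EFin; [exact: nearW|exact: fg].
- by apply: aeW => x k Dx; rewrite lee_fin fb.
move=> ig _ cv.
apply/fine_cvg; rewrite fineK//.
exact: integrable_fin_num.
Qed.

Lemma cintegral_dct D (F : nat -> T -> C) G (b : T -> R) : measurable D ->
  (forall k, cmeas D (F k)) -> mu.-integrable D (EFin \o b) ->
  (forall x, D x -> ccvg (F ^~ x) (G x)) ->
  (forall k x, D x -> normc (F k x) <= b x) ->
  ccvg (fun k => cintegral D (F k)) (cintegral D G).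
Proof.
move=> mD mF ib FG Fb; have [g1 g2] := cmeas_lim mD mF FG.
apply: ccvg_ReIm => /=; apply: (Rintegral_dct (b := b)) => //.
- by move=> k; case: (mF k).
- by move=> x Dx; exact: (ccvg_Re (FG x Dx)).
- by move=> k x Dx; exact: le_trans (nc_Re _) (Fb _ _ Dx).
- by move=> k; case: (mF k).
- by move=> x Dx; exact: (ccvg_Im (FG x Dx)).
- by move=> k x Dx; exact: le_trans (nc_Im _) (Fb _ _ Dx).
Qed.

Lemma cintegral_sum D I (r : seq I) (F : I -> T -> C) : measurable D ->
  (forall i, cintegrable D (F i)) ->
  cintegrable D (fun x => \sum_(i <- r) F i x) /\
  cintegral D (fun x => \sum_(i <- r) F i x) = \sum_(i <- r) cintegral D (F i).
Proof.
move=> mD iF; elim: r => [|i r [IH1 IH2]].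
  under eq_fun do rewrite big_nil; rewrite big_nil cintegral0; split => //.
  by split; exact: integrable0.
under eq_fun do rewrite big_cons; rewrite big_cons -IH2; split.
  exact: cintegrableD.
exact: cintegralD.
Qed.

Lemma cintegral_setI_indic D E F : measurable D -> measurable E ->
  cintegral (D `&` E) F = cintegral D (fun x => F x * (\1_E x)%:C%C).
Proof.
move=> mD mE; congr (_ +i* _)%C; rewrite Rintegral_mkcondr;
  apply: eq_Rintegral => x _; rewrite patchE indicE; case: ifP => _;
  by rewrite ?mulr1 ?mulr0.
Qed.

Definition csqint D F : Prop :=
  cmeas D F /\ (\int[mu]_(x in D) ((normc (F x) ^+ 2)%:E) < +oo)%E.

Lemma csqint_integrable D F : measurable D -> csqint D F ->
  mu.-integrable D (EFin \o (fun x => normc (F x) ^+ 2)).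
Proof.
move=> mD [mF F2]; apply/integrableP; split.
  by apply/measurable_EFinP; exact: measurable_sqr_nc.
rewrite (eq_integral (fun x => (normc (F x) ^+ 2)%:E))// => x _ /=.
by rewrite ger0_norm// exprn_ge0// nc_ge0.
Qed.

Lemma csqintP D F : measurable D -> cmeas D F ->
  mu.-integrable D (EFin \o (fun x => normc (F x) ^+ 2)) -> csqint D F.
Proof.
move=> mD mF /integrableP[_ h]; split => //.
rewrite (eq_integral (fun x => `|(normc (F x) ^+ 2)%R%:E|%E))// => x _ /=.
by rewrite ger0_norm// exprn_ge0// nc_ge0.
Qed.

(* [|F|^2 + |G|^2] dominates [|F G|]. *)
Lemma csqint_mul D F G : measurable D -> csqint D F -> csqint D G ->
  cintegrable D (fun x => F x * (G x)^*).
Proof.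
move=> mD sF sG.
apply: (@cintegrable_le _ _ (fun x => normc (F x) ^+ 2 + normc (G x) ^+ 2) mD).
- by apply: cmeasM; [case: sF|apply: cmeas_conj; case: sG].
- have h := integrableD mD (csqint_integrable mD sF) (csqint_integrable mD sG).
  by apply: (integrable_eq mD h) => x _.
- move=> x _; rewrite ncM nc_conj.
  by have := nc_ge0 (F x); have := nc_ge0 (G x); nra.
Qed.

Lemma csqintD D F G (a : C) : measurable D -> csqint D F -> csqint D G ->
  csqint D (fun x => a * F x + G x).
Proof.
move=> mD sF sG; have [mF _] := sF; have [mG _] := sG.
have maG : cmeas D (fun x => a * F x + G x).
  by apply: cmeasD => //; apply: cmeasM => //; exact: cmeas_cst.
apply: csqintP => //.
have h := integrableD mD (integrableZl mD (2 * normc a ^+ 2) (csqint_integrable mD sF))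
  (integrableZl mD 2 (csqint_integrable mD sG)).
apply: (le_integrable mD _ _ h); first by apply/measurable_EFinP; exact: measurable_sqr_nc.
move=> x _ /=; rewrite lee_fin ger0_norm ?exprn_ge0 ?nc_ge0// ger0_norm; last first.
  by rewrite addr_ge0// !mulr_ge0// ?exprn_ge0 ?nc_ge0.
apply: (@le_trans _ _ ((normc a * normc (F x) + normc (G x)) ^+ 2)).
  rewrite lerXn2r ?nnegrE ?nc_ge0 ?addr_ge0 ?mulr_ge0 ?nc_ge0//.
  by rewrite -ncM ncD.
by have := sqr_ge0 (normc a * normc (F x) - normc (G x)); nra.
Qed.

Lemma cintegral_sqr D F : measurable D -> csqint D F ->
  cintegral D (fun x => F x * (F x)^*) =
  ((fine (\int[mu]_(x in D) (normc (F x) ^+ 2)%:E))%:C)%C.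
Proof.
move=> mD sF; apply/eqP; rewrite eq_complex /=; apply/andP; split; apply/eqP.
  by apply: eq_Rintegral => x _; rewrite -sqr_nc.
rewrite (@eq_Rintegral _ _ _ _ _ (fun=> 0)); last by move=> x _; rewrite -sqr_nc.
by rewrite /Rintegral integral0_eq.
Qed.

Lemma cintegral_preserves D F (f : T -> T) : measurable D -> measurable_fun setT f ->
  (forall A, measurable A -> mu (f @^-1` A) = mu A) -> f @^-1` D = D ->
  cmeas setT F -> cintegrable D (F \o f) ->
  cintegral D F = cintegral D (F \o f).
Proof.
move=> mD mf fm fD [m1 m2] [i1 i2].
pose nu : {measure set T -> \bar R} :=
  measure_function_pushforward__canonical__measure_function_Measure mu mf.
have part (g : T -> R) : measurable_fun setT g -> mu.-integrable D (fun x => (g (f x))%:E) ->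
    (\int[mu]_(x in D) g x)%R = (\int[mu]_(x in D) g (f x))%R.
  move=> mg ig; rewrite /Rintegral; congr fine.
  rewrite (@eq_measure_integral _ _ _ D nu); last by move=> A mA _; rewrite /nu /= /pushforward fm.
  rewrite (integral_pushforward mf)//; last by rewrite fD.
    by rewrite fD.
  exact/measurable_EFinP.
by congr (_ +i* _)%C; apply: part.
Qed.

End complex_integral.

Section complex_conjugation.
Context {R : realType}.
Local Notation C := R[i].

Lemma cconjD (x y : C) : (x + y)^* = x^* + y^*. Proof. exact: rmorphD. Qed.
Lemma cconjB (x y : C) : (x - y)^* = x^* - y^*. Proof. exact: rmorphB. Qed.
Lemma cconjM (x y : C) : (x * y)^* = x^* * y^*. Proof. exact: rmorphM. Qed.
Lemma cconj_sum I (r : seq I) (F : I -> C) :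
  (\sum_(i <- r) F i)^* = \sum_(i <- r) (F i)^*.
Proof. exact: rmorph_sum. Qed.
Lemma cconj_real (t : R) : (t%:C%C : C)^* = t%:C%C.
Proof. by apply/eqP; rewrite eq_complex /= oppr0 !eqxx. Qed.

End complex_conjugation.

(** * Hilbert spaces *)

Section semi_inner_product.
Context {R : realType} {V : lmodType R[i]}.
Local Notation C := R[i].

(** Without definiteness one theory covers [H], the Hermitian product of [C^n], and the measurable
    square integrable functions on the ball, among which a nonzero function can have norm zero. *)
Definition semi_ip (S : set V) (phi : V -> V -> C) : Prop :=
  [/\ is_subspace S,
      forall (a : C) f g h, S f -> S g -> S h ->
        phi (a *: f + g) h = a * phi f h + phi g h,
      forall f g, S f -> S g -> phi g f = (phi f g)^* &
      forall f, S f -> 0 <= phi f f].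

Variables (S : set V) (phi : V -> V -> C).
Hypothesis sip : semi_ip S phi.
Implicit Types (f g h : V).

Definition sn2 f : R := complex.Re (phi f f).

Lemma sip0 : S 0. Proof. by case: sip => -[]. Qed.

Lemma sip_lin (a : C) f g : S f -> S g -> S (a *: f + g).
Proof. by case: sip => -[_ L] _ _ _ Sf Sg; exact: L. Qed.

Lemma sip_add f g : S f -> S g -> S (f + g).
Proof. by move=> Sf Sg; rewrite -[f]scale1r; exact: sip_lin. Qed.

Lemma sip_scale a f : S f -> S (a *: f).
Proof. by move=> Sf; rewrite -[_ *: _]addr0; apply: sip_lin => //; exact: sip0. Qed.

Lemma sip_sub f g : S f -> S g -> S (f - g).
Proof. by move=> Sf Sg; rewrite addrC -scaleN1r; exact: sip_lin. Qed.

Lemma sip_sum I (r : seq I) (F : I -> V) : (forall i, S (F i)) ->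
  S (\sum_(i <- r) F i).
Proof.
move=> SF; elim: r => [|i r IH]; first by rewrite big_nil; exact: sip0.
by rewrite big_cons; exact: sip_add.
Qed.

Lemma sipDl f g h : S f -> S g -> S h -> phi (f + g) h = phi f h + phi g h.
Proof.
by case: sip => _ L _ _ Sf Sg Sh; rewrite -[f]scale1r L// scale1r mul1r.
Qed.

Lemma sip0l h : S h -> phi 0 h = 0.
Proof.
move=> Sh; have := sipDl sip0 sip0 Sh; rewrite addr0 => /eqP.
by rewrite -subr_eq0 opprD addrA subrr add0r oppr_eq0 => /eqP.
Qed.

Lemma sipZl a f h : S f -> S h -> phi (a *: f) h = a * phi f h.
Proof.
case: sip => _ L _ _ Sf Sh; rewrite -[a *: f]addr0 L//; last exact: sip0.
by rewrite sip0l// addr0.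
Qed.

Lemma sipBl f g h : S f -> S g -> S h -> phi (f - g) h = phi f h - phi g h.
Proof.
move=> Sf Sg Sh; rewrite -scaleN1r sipDl//; last exact: sip_scale.
by rewrite sipZl// mulN1r.
Qed.

Lemma sipC f g : S f -> S g -> phi g f = (phi f g)^*.
Proof. by case: sip => _ _ h _; exact: h. Qed.

Lemma sipDr f g h : S f -> S g -> S h -> phi h (f + g) = phi h f + phi h g.
Proof.
move=> Sf Sg Sh; rewrite sipC//; last exact: sip_add.
by rewrite sipDl// cconjD -!sipC.
Qed.

Lemma sipZr a f h : S f -> S h -> phi h (a *: f) = a^* * phi h f.
Proof.
move=> Sf Sh; rewrite sipC//; last exact: sip_scale.
by rewrite sipZl// cconjM -sipC.
Qed.

Lemma sipBr f g h : S f -> S g -> S h -> phi h (f - g) = phi h f - phi h g.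
Proof.
move=> Sf Sg Sh; rewrite sipC//; last exact: sip_sub.
by rewrite sipBl// cconjB -!sipC.
Qed.

Lemma sip_suml I (r : seq I) (F : I -> V) h : (forall i, S (F i)) -> S h ->
  phi (\sum_(i <- r) F i) h = \sum_(i <- r) phi (F i) h.
Proof.
move=> SF Sh; elim: r => [|i r IH]; first by rewrite !big_nil sip0l.
by rewrite !big_cons sipDl ?IH//; exact: sip_sum.
Qed.

Lemma sip_sumr I (r : seq I) (F : I -> V) h : (forall i, S (F i)) -> S h ->
  phi h (\sum_(i <- r) F i) = \sum_(i <- r) phi h (F i).
Proof.
move=> SF Sh; rewrite sipC//; last exact: sip_sum.
by rewrite sip_suml// cconj_sum; apply: eq_bigr => i _; rewrite -sipC.
Qed.

Lemma sn2E f : S f -> phi f f = (sn2 f)%:C%C.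
Proof.
case: sip => _ _ _ p Sf; have := p _ Sf; rewrite /sn2.
by case: (phi f f) => a b; rewrite lecE /= => /andP[/eqP -> _].
Qed.

Lemma sn2_ge0 f : S f -> 0 <= sn2 f.
Proof. by move=> Sf; case: sip => _ _ _ /(_ f Sf); rewrite sn2E// lecR. Qed.

Lemma sn2Z a f : S f -> sn2 (a *: f) = normc a ^+ 2 * sn2 f.
Proof.
move=> Sf; rewrite {1}/sn2 sipZl ?sipZr//; last exact: sip_scale.
by rewrite mulrA -sqr_nc sn2E// -rmorphM.
Qed.

Lemma sn2N f : S f -> sn2 (- f) = sn2 f.
Proof. by move=> Sf; rewrite -scaleN1r sn2Z// ncN normc1 expr1n mul1r. Qed.

(** The factor [phi f g] makes the cross terms real, so that a quadratic in the real variable [t]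
    with real coefficients results. *)
Lemma sn2B_expand f g (t : R) : S f -> S g ->
  sn2 (f - (t%:C%C * phi f g) *: g) =
  sn2 f - 2 * t * normc (phi f g) ^+ 2 + t ^+ 2 * normc (phi f g) ^+ 2 * sn2 g.
Proof.
move=> Sf Sg; set a := phi f g.
have Sag : S ((t%:C%C * a) *: g) by exact: sip_scale.
rewrite {1}/sn2 sipBl//; last exact: sip_sub.
rewrite !sipBr// sipZr// !sipZl// sipZr// (sipC Sf Sg) -/a !sn2E// rmorphM /=.
rewrite cconj_real.
rewrite [X in complex.Re X](_ : _ = ((sn2 f)%:C%C - t%:C%C * (a * a^*)
  - (t%:C%C * (a * a^*) - t%:C%C * t%:C%C * (a * a^*) * (sn2 g)%:C%C))); last by ring.
by rewrite -sqr_nc -!rmorphM -!rmorphB /=; ring.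
Qed.

Lemma cauchy_schwarz f g : S f -> S g ->
  normc (phi f g) ^+ 2 <= sn2 f * sn2 g.
Proof.
move=> Sf Sg; pose A := normc (phi f g) ^+ 2.
have key t : 0 <= sn2 f - 2 * t * A + t ^+ 2 * A * sn2 g.
  by rewrite -sn2B_expand// sn2_ge0//; apply: sip_sub => //; exact: sip_scale.
have f0 := sn2_ge0 Sf; have g0 := sn2_ge0 Sg.
have A0 : 0 <= A by rewrite exprn_ge0// nc_ge0.
rewrite -/A; have [gz|gnz] := eqVneq (sn2 g) 0.
  rewrite gz mulr0; rewrite leNgt; apply/negP => Ap.
  (* For a null vector [g] the expression is affine in [t], and this [t] would give it the value
     [-1]. *)
  have := key ((sn2 f + 1) / (2 * A)); rewrite gz mulr0 addr0.
  have -> : 2 * ((sn2 f + 1) / (2 * A)) * A = sn2 f + 1.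
    by field; rewrite gt_eqF.
  lra.
have gp : 0 < sn2 g by rewrite lt_neqAle eq_sym gnz.
have := key (sn2 g)^-1.
have -> : sn2 f - 2 * (sn2 g)^-1 * A + (sn2 g)^-1 ^+ 2 * A * sn2 g
   = (sn2 f * sn2 g - A) / sn2 g by field.
by rewrite pmulr_lge0 ?invr_gt0// subr_ge0.
Qed.

Lemma sip_ccvgl (u : nat -> V) f g : (forall k, S (u k)) -> S f -> S g ->
  (fun k => sn2 (f - u k)) @ \oo --> (0 : R) -> ccvg (fun k => phi (u k) g) (phi f g).
Proof.
move=> Su Sf Sg uf; apply/ccvgP => e e0.
pose B := sn2 g + 1; have g0 := sn2_ge0 Sg; have B0 : 0 < B by rewrite /B; lra.
have [|N _ HN] := (cvgrPdist_lt _ _).1 uf (e ^+ 2 / B); first by rewrite divr_gt0 ?exprn_gt0.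
exists N => k Nk; have := HN k Nk; rewrite sub0r normrN ger0_norm; last first.
  by apply: sn2_ge0; exact: sip_sub.
rewrite ltr_pdivlMr// => h; rewrite ncB -sipBl//.
rewrite -(ltr_pXn2r (n := 2))// ?nnegrE ?nc_ge0 ?(ltW e0)//.
apply: le_lt_trans h; apply: le_trans (cauchy_schwarz _ _) _ => //.
  exact: sip_sub.
by rewrite ler_wpM2l ?sn2_ge0//; [exact: sip_sub|rewrite /B; lra].
Qed.

Section orthogonal_sequences.
Variable h : nat -> V.
Hypothesis Sh : forall k, S (h k).
Hypothesis h_orth : forall j k, j != k -> phi (h j) (h k) = 0.

Lemma sn2_sum (r : seq nat) : uniq r ->
  sn2 (\sum_(k <- r) h k) = \sum_(k <- r) sn2 (h k).
Proof.
move=> ur; rewrite {1}/sn2 sip_suml//; last exact: sip_sum.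
rewrite raddf_sum big_seq [RHS]big_seq; apply: eq_bigr => k kr.
rewrite sip_sumr// (bigD1_seq k)//= big1 ?addr0// => j jk.
by rewrite h_orth// eq_sym.
Qed.

(** The hypothesis makes the partial sum an orthogonal projection of [f], so Pythagoras gives an
    equality rather than Bessel's inequality. *)
Lemma bessel f K : S f -> (forall k, phi f (h k) = phi (h k) (h k)) ->
  sn2 (f - \sum_(k < K) h k) = sn2 f - \sum_(k < K) sn2 (h k).
Proof.
move=> Sf fh; rewrite -!(big_mkord xpredT); set s := \sum_(0 <= k < K) h k.
have Ss : S s by exact: sip_sum.
have ss : phi s s = (\sum_(0 <= k < K) sn2 (h k))%:C%C.
  by rewrite sn2E// sn2_sum// iota_uniq.
have fs : phi f s = phi s s.
  rewrite ss sip_sumr// rmorph_sum; apply: eq_bigr => k _.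
  by rewrite fh sn2E.
have sf : phi s f = phi s s by rewrite (sipC Sf Ss) fs ss cconj_real.
rewrite {1}/sn2 sipBl//; last exact: sip_sub.
rewrite !sipBr// sf fs subrr subr0 ss sn2E//.
by rewrite raddfB /= big_mkord.
Qed.

End orthogonal_sequences.

End semi_inner_product.

Section hilbert_theory.
Context {R : realType} {V : lmodType R[i]}.
Variable H : ip_space V.

Lemma inner_product_semi : is_inner_product H -> semi_ip H (ip H).
Proof.
move=> [S L C P]; split => // f Hf; have [->|f0] := eqVneq f 0; last first.
  by rewrite ltW// P.
case: S => S0 _; have := L 1 0 0 0 S0 S0 S0.
rewrite scale1r addr0 mul1r => /eqP.
by rewrite -subr_eq0 opprD addrA subrr add0r oppr_eq0 => /eqP ->.
Qed.

Lemma hilbert_orth_series (hH : is_hilbert H) (h : nat -> V) (M : R) :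
  (forall k, H (h k)) -> (forall j k, j != k -> ip H (h j) (h k) = 0) ->
  bounded_sums (fun k => sn2 (ip H) (h k)) M ->
  exists2 f, H f & (fun K => sn2 (ip H) (f - \sum_(k < K) h k)) @ \oo --> (0 : R).
Proof.
move=> Hh ho hM; have [iH comp] := hH; have sip := inner_product_semi iH.
pose u K := \sum_(0 <= k < K) h k.
have Hu K : H (u K) by apply: (sip_sum sip).
have nn k : 0 <= sn2 (ip H) (h k) by exact: (sn2_ge0 sip).
have [f Hf uf] : exists2 f, H f & (fun k => ipnorm H (u k - f)) @ \oo --> (0 : R).
  apply: comp => // e e0.
  have e2 : 0 < (e / 2) ^+ 2 by rewrite exprn_gt0// divr_gt0.
  have [N HN] := bounded_sums_tail nn hM e2; exists N => p q.
  have main a b : (N <= a)%N -> (a <= b)%N -> ipnorm H (u b - u a) < e.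
    move=> Na ab; rewrite /ipnorm -/(sn2 (ip H) _).
    have -> : u b - u a = \sum_(a <= k < b) h k.
      by rewrite /u (big_cat_nat (leq0n a) ab) /= addrAC subrr add0r.
    rewrite (sn2_sum sip)// ?iota_uniq//.
    apply: (@le_lt_trans _ _ (e / 2)); last by lra.
    rewrite -[leRHS]ger0_norm ?divr_ge0 ?(ltW e0)// -sqrtr_sqr ler_wsqrtr//.
    apply: le_trans (HN b); rewrite (big_cat_nat Na ab) /= lerDr.
    exact: sumr_ge0.
  have [pq|/ltnW qp] := leqP q p; first by move=> _ Nq; exact: main.
  move=> Np _; rewrite /ipnorm -/(sn2 (ip H) _) -opprB (sn2N sip).
    exact: main.
  by apply: (sip_sub sip).
exists f => //.
have {}uf : (fun k => ipnorm H (u k - f) * ipnorm H (u k - f)) @ \oo --> (0 : R).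
  by rewrite -[X in _ --> X](mulr0 0); exact: cvgM.
rewrite (_ : (fun K => _) = (fun k => ipnorm H (u k - f) * ipnorm H (u k - f)))//.
apply/funext => K; rewrite -expr2 /ipnorm -/(sn2 (ip H) _).
have Hs : H (u K - f) by apply: (sip_sub sip).
rewrite sqr_sqrtr; last exact: (sn2_ge0 sip).
by rewrite -(sn2N sip Hs) opprB /u big_mkord.
Qed.

End hilbert_theory.

(** * Homogeneous polynomials *)

Section homogeneous_polynomials.
Context {R : realType} {n : nat}.
Local Notation C := R[i].
Local Notation poly := (mpoly n C).
Local Notation rV := 'rV[C]_n.
Implicit Types (p q : poly) (m : multinom n) (z w : rV).

Definition pev p z : C := meval (fun i => z 0 i) p.

Definition homog k p : Prop := forall m, m \in msupp p -> mdeg m = k.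

Lemma pevE p z : pev p z = \sum_(m <- msupp p) mcoeff m p * monomial m z.
Proof. exact: mevalE. Qed.

Lemma pevX m z : pev (mpolyX C m) z = monomial m z.
Proof. exact: mevalX. Qed.

Lemma monomialZ m (a : C) z : monomial m (a *: z) = a ^+ mdeg m * monomial m z.
Proof.
rewrite /monomial mdegE -prodrXr -big_split /=; apply: eq_bigr => i _.
by rewrite mxE exprMn.
Qed.

Lemma pev_homogZ k p (a : C) z : homog k p -> pev p (a *: z) = a ^+ k * pev p z.
Proof.
move=> hp; rewrite !pevE mulr_sumr big_seq [RHS]big_seq; apply: eq_bigr => m mp.
by rewrite monomialZ (hp _ mp) mulrCA.
Qed.

Lemma homogZ k (a : C) p : homog k p -> homog k (a *: p).
Proof.
move=> hp m; rewrite mcoeff_msupp mcoeffZ mulf_eq0 negb_or => /andP[_].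
by rewrite -mcoeff_msupp; exact: hp.
Qed.

Lemma homogD k p q : homog k p -> homog k q -> homog k (p + q).
Proof.
move=> hp hq m; rewrite mcoeff_msupp mcoeffD => h.
have [mp|mp] := boolP (m \in msupp p); first exact: hp.
by apply: hq; move: h; rewrite (memN_msupp_eq0 mp) add0r mcoeff_msupp.
Qed.

Lemma homog0 k : homog k 0. Proof. by move=> m; rewrite msupp0. Qed.

Lemma homog_monomial m : homog (mdeg m) (mpolyX C m).
Proof. by move=> m'; rewrite msuppX inE => /eqP ->. Qed.

Lemma homog_coef0 k p m : homog k p -> mdeg m != k -> mcoeff m p = 0.
Proof.
move=> hp mk; apply: memN_msupp_eq0; apply/negP => /hp mk'.
by rewrite mk' eqxx in mk.
Qed.

Definition degs k : seq (multinom n) :=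
  undup [seq m <- map (@bmnm n k.+1) (enum {: bmultinom n k.+1}) | mdeg m == k].

Lemma mem_degs k m : (m \in degs k) = (mdeg m == k).
Proof.
rewrite mem_undup mem_filter; case: eqP => //= mk.
have mk1 : (mdeg m < k.+1)%N by rewrite mk.
by apply/mapP; exists (BMultinom mk1) => //; rewrite mem_enum.
Qed.

Lemma uniq_degs k : uniq (degs k). Proof. exact: undup_uniq. Qed.

Lemma sum_msupp_degs k p (F : multinom n -> C) : homog k p ->
  \sum_(m <- msupp p) mcoeff m p * F m = \sum_(m <- degs k) mcoeff m p * F m.
Proof.
move=> hp; rewrite [RHS](bigID (fun m => m \in msupp p)) /= [X in _ = _ + X]big1 ?addr0; last first.
  by move=> m /memN_msupp_eq0 ->; rewrite mul0r.
rewrite -[RHS]big_filter; apply: perm_big; apply: uniq_perm.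
- exact: msupp_uniq.
- by rewrite filter_uniq// uniq_degs.
move=> m; rewrite mem_filter mem_degs; case: (boolP (m \in msupp p)) => //= mp.
by rewrite (hp _ mp) eqxx.
Qed.

Definition hpart k (c : multinom n -> C) : poly :=
  \sum_(m <- degs k) c m *: mpolyX C m.

Lemma homog_hpart k c : homog k (hpart k c).
Proof.
rewrite /hpart big_seq; elim/big_ind: _ => [|p q|m]; [exact: homog0|exact: homogD|].
by rewrite mem_degs => /eqP <-; apply: homogZ; exact: homog_monomial.
Qed.

Lemma pevZ a p z : pev (a *: p) z = a * pev p z. Proof. exact: mevalZ. Qed.
Lemma pev_sum I (r : seq I) (F : I -> poly) z :
  pev (\sum_(i <- r) F i) z = \sum_(i <- r) pev (F i) z.
Proof. exact: raddf_sum. Qed.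
Lemma pev_exp p k z : pev (p ^+ k) z = pev p z ^+ k.
Proof. exact: rmorphXn. Qed.

Lemma pev_hpart k c z : pev (hpart k c) z = \sum_(m <- degs k) c m * monomial m z.
Proof. by rewrite pev_sum; apply: eq_bigr => m _; rewrite pevZ pevX. Qed.

Lemma coef_hpart k c m : mdeg m = k -> mcoeff m (hpart k c) = c m.
Proof.
move=> mk; rewrite raddf_sum /= (bigD1_seq m) ?uniq_degs ?mem_degs ?mk//=.
rewrite mcoeffZ mcoeffX eqxx mulr1 big1 ?addr0// => m' m'm.
by rewrite mcoeffZ mcoeffX (negPf m'm) mulr0.
Qed.

Definition mfact m : nat := \prod_(i < n) (m i)`!.

Lemma mfact_gt0 m : (0 < mfact m)%N.
Proof. by apply: prodn_gt0 => i; exact: fact_gt0. Qed.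

Lemma mfact_neq0 m : (mfact m)%:R != 0 :> C.
Proof. by rewrite pnatr_eq0 -lt0n mfact_gt0. Qed.

(* The homogeneous components of the reproducing kernel at [w]. *)
Definition linform w : poly := \sum_(i < n) (w 0 i)^* *: mpolyX C (mnm1 i).

Definition epoly k w : poly := linform w ^+ k.

Lemma pev_epoly k w z : pev (epoly k w) z = cdot z w ^+ k.
Proof.
rewrite pev_exp; congr (_ ^+ _); rewrite pev_sum; apply: eq_bigr => i _.
by rewrite pevZ mulrC; congr (_ * _); exact: mevalXU.
Qed.

Lemma linform_homog w : linform w \is @ishomog1 n C 1 mdeg.
Proof.
by apply: rpred_sum => i _; apply: rpredZ; rewrite dhomogX /= mdeg1.
Qed.

Lemma homog_epoly k w : homog k (epoly k w).
Proof.
have /dhomogP h := dhomogMn k (linform_homog w).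
by move=> m /h; rewrite mul1n.
Qed.

Lemma mderiv_linform i w : mderiv i (linform w) = mpolyC n (w 0 i)^*.
Proof.
rewrite raddf_sum /= (bigD1 i)//= big1 ?addr0 => [|j ji].
  rewrite mderivZ mderivX mnm1E eqxx scale1r.
  have -> : mnm_sub (mnm1 i) (mnm1 i) = mnm0 :> multinom n.
    by apply/mnmP => j; rewrite mnmBE subnn mnm0E.
  by rewrite mpolyX0 -mul_mpolyC mulr1.
by rewrite mderivZ mderivX mnm1E (negPf ji) scale0r scaler0.
Qed.

Lemma mderiv_epoly i k w :
  mderiv i (epoly k.+1 w) = (k.+1%:R * (w 0 i)^*) *: epoly k w.
Proof.
elim: k => [|k IH].
  by rewrite /epoly expr1 mderiv_linform expr0 mul1r -mul_mpolyC mulr1.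
rewrite {1}/epoly exprS mderivM mderiv_linform -/(epoly _ _) IH mul_mpolyC.
rewrite -scalerAr -exprS -scalerDl; congr (_ *: _).
by rewrite -[k.+2%:R]natr1 mulrDl mul1r addrC.
Qed.

(** The multinomial theorem, by differentiation: a partial derivative of [epoly k.+1 w] is a
    multiple of [epoly k w], and it lowers [m] in a variable that occurs in it. *)
Lemma coef_epoly k w m : mdeg m = k ->
  mcoeff m (epoly k w) * (mfact m)%:R = k`!%:R * (monomial m w)^*.
Proof.
elim: k m => [|k IH] m mk.
  have -> : m = mnm0 by apply/eqP; rewrite -mdeg_eq0 mk.
  rewrite /epoly expr0 mcoeff1 eqxx /mfact /monomial !big1 ?rmorph1//.
    by move=> i _; rewrite mnm0E.
  by move=> i _; rewrite mnm0E.
have [i mi] : exists i, (0 < m i)%N.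
  apply: contrapT => /forallNP h; suff : mdeg m = 0%N by rewrite mk.
  by rewrite mdegE big1// => i _; apply/eqP; rewrite -leqn0 leqNgt; apply/negP/h.
pose m' := mnm_sub m (mnm1 i).
have mE : mnm_add m' (mnm1 i) = m.
  apply/mnmP => j; rewrite mnmDE mnmBE mnm1E subnK//.
  by case: eqP => // <-.
have m'k : mdeg m' = k by move: mk; rewrite -mE mdegD mdeg1 addn1 => -[].
have m'i j : m j = (m' j + (i == j))%N by rewrite -[in LHS]mE mnmDE mnm1E.
have fE : mfact m = (mfact m' * (m' i).+1)%N.
  rewrite /mfact (bigD1 i)//= [in RHS](bigD1 i)//= (m'i i) eqxx addn1 factS.
  rewrite -mulnA mulnC; congr (_ * _ * _)%N.
  by apply: eq_bigr => j ji; rewrite m'i eq_sym (negPf ji) addn0.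
have wE : monomial m w = monomial m' w * w 0 i.
  rewrite /monomial (bigD1 i)//= [in RHS](bigD1 i)//= (m'i i) eqxx addn1 exprS.
  rewrite -mulrA mulrC; congr (_ * _ * _).
  by apply: eq_bigr => j ji; rewrite m'i eq_sym (negPf ji) addn0.
have := mcoeff_deriv i m' (epoly k.+1 w).
rewrite mE mderiv_epoly mcoeffZ -[RHS]mulr_natr => h.
rewrite fE natrM (mulrC (mfact m')%:R) mulrA -h.
rewrite [LHS](_ : _ = k.+1%:R * (w 0 i)^* * (mcoeff m' (epoly k w) * (mfact m')%:R)); last by ring.
rewrite IH// wE cconjM factS natrM; ring.
Qed.

(** The Fischer inner product. In degree [k] both spaces carry it up to a factor: [1 / (k + n)!] for
    the Bergman space and [1 / k!] for the Drury space. *)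
Definition fischer p q : C :=
  \sum_(m <- msupp p) mcoeff m p * ((mcoeff m q)^* * (mfact m)%:R).

End homogeneous_polynomials.

Section ball_geometry.
Context {R : realType} {n : nat}.
Local Notation C := R[i].
Implicit Types (z w : 'rV[C]_n).

Lemma cdotDl (a : C) z z' w : cdot (a *: z + z') w = a * cdot z w + cdot z' w.
Proof.
rewrite /cdot mulr_sumr -big_split; apply: eq_bigr => i _ /=.
by rewrite !mxE mulrDl mulrA.
Qed.

Lemma cdotC z w : cdot w z = (cdot z w)^*.
Proof.
by rewrite /cdot cconj_sum; apply: eq_bigr => i _; rewrite cconjM conjCK mulrC.
Qed.

Lemma cdotE z : cdot z z = ((\sum_(i < n) normc (z 0 i) ^+ 2)%:C)%C.
Proof. by rewrite /cdot rmorph_sum; apply: eq_bigr => i _; rewrite -sqr_nc. Qed.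

Lemma sqr_enorm z : enorm z ^+ 2 = \sum_(i < n) normc (z 0 i) ^+ 2.
Proof.
rewrite /enorm cdotE /= sqr_sqrtr//; apply: sumr_ge0 => i _.
by rewrite exprn_ge0// nc_ge0.
Qed.

Lemma enorm_ge0 z : 0 <= enorm z. Proof. exact: sqrtr_ge0. Qed.

Lemma enorm_lt1 z : (enorm z < 1) = (\sum_(i < n) normc (z 0 i) ^+ 2 < 1).
Proof.
by rewrite -sqr_enorm expr_lt1// enorm_ge0.
Qed.

Lemma enormZ (a : C) z : enorm (a *: z) = normc a * enorm z.
Proof.
apply/eqP; rewrite -(eqrXn2 (n := 2))// ?enorm_ge0 ?mulr_ge0 ?nc_ge0 ?enorm_ge0//.
rewrite exprMn !sqr_enorm mulr_sumr; apply/eqP; apply: eq_bigr => i _.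
by rewrite mxE ncM exprMn.
Qed.

Lemma enorm0 : enorm (0 : 'rV[C]_n) = 0.
Proof. by rewrite -(scale0r 0) enormZ normc0 mul0r. Qed.

Lemma cdot_semi_ip : semi_ip setT (@cdot R n).
Proof.
split=> //; [by move=> *; exact: cdotDl|by move=> *; exact: cdotC|].
move=> z _; rewrite cdotE lecR; apply: sumr_ge0 => i _.
by rewrite exprn_ge0// nc_ge0.
Qed.

Lemma nc_cdot z w : normc (cdot z w) <= enorm z * enorm w.
Proof.
have := cauchy_schwarz cdot_semi_ip (I : setT z) (I : setT w).
rewrite /sn2 !cdotE /= -!sqr_enorm -exprMn.
by rewrite ler_pXn2r// nnegrE ?nc_ge0// mulr_ge0 ?enorm_ge0.
Qed.

Lemma nc_coord z i : normc (z 0 i) <= enorm z.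
Proof.
rewrite -(ler_pXn2r (n := 2))// ?nnegrE ?nc_ge0 ?enorm_ge0// sqr_enorm.
by rewrite (bigD1 i)//= lerDl; apply: sumr_ge0 => j _; rewrite exprn_ge0// nc_ge0.
Qed.

Lemma uball_lt1 (z : uball R n) : enorm (uball_val z) < 1.
Proof. by case: z. Qed.

Lemma nc_cdot_lt1 (z w : uball R n) : normc (cdot (uball_val z) (uball_val w)) < 1.
Proof.
apply: le_lt_trans (nc_cdot _ _) _.
have := uball_lt1 z; have := uball_lt1 w.
have := enorm_ge0 (uball_val z); have := enorm_ge0 (uball_val w); nra.
Qed.

Lemma pev_bounded (p : mpoly n C) : exists2 M, 0 <= M &
  forall z, enorm z < 1 -> normc (pev p z) <= M.
Proof.
exists (\sum_(m <- msupp p) normc (mcoeff m p)).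
  by apply: sumr_ge0 => m _; exact: nc_ge0.
move=> z z1; rewrite pevE; apply: le_trans (nc_sum _ _ _) _.
apply: ler_sum => m _; rewrite ncM -[leRHS]mulr1 ler_wpM2l ?nc_ge0//.
rewrite /monomial; elim/big_ind: _ => [|x y hx hy|i _]; first by rewrite normc1.
  by rewrite ncM -[leRHS]mulr1 ler_pM ?nc_ge0.
by rewrite ncX exprn_ile1 ?nc_ge0// (le_trans (nc_coord _ _))// ltW.
Qed.

End ball_geometry.

(** * Volume of the ball and integrals of monomials *)

Section ball_measure.
Context {R : realType} {n : nat}.
Local Notation C := R[i].
Local Notation B := (uball R n).
Local Notation pt := (cn_point R n).
Local Notation ball := (@cn_ball R n).
Local Notation vol := (@vol R n).
Local Notation T := (measurableTypeR R * measurableTypeR R)%type.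

Lemma cvecE (x : pt) i : cvec x 0 i = ((tnth x i).1 +i* (tnth x i).2)%C.
Proof. by rewrite mxE. Qed.

Lemma sqn_nc (p : T) : sqn p = normc (p.1 +i* p.2)%C ^+ 2.
Proof. by rewrite sqr_nc_ReIm. Qed.

Lemma cn_ballE : ball = [set x | sqtot x < 1].
Proof.
have E (x : pt) : \sum_(i < n) normc (cvec x 0 i) ^+ 2 = sqtot x.
  by apply: eq_bigr => i _; rewrite cvecE sqn_nc.
by apply/seteqP; split => x; rewrite /cn_ball /= enorm_lt1 E.
Qed.

Lemma measurable_ball : measurable ball.
Proof.
rewrite cn_ballE (_ : [set x | _] = @sqtot R n @^-1` `]-oo, 1[%classic); last first.
  by apply/seteqP; split => x /=; rewrite in_itv.
by rewrite -[X in measurable X]setTI; exact: measurable_sqtot.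
Qed.

Lemma ext0E (f : B -> C) x (bx : enorm (cvec x) < 1) : ext0 f x = f (UBall bx).
Proof. by rewrite /ext0 (insubT (fun z => enorm z < 1) bx). Qed.

Lemma ball_ind (P : pt -> Prop) :
  (forall x (bx : enorm (cvec x) < 1), P x) -> forall x, ball x -> P x.
Proof. by move=> h x bx; exact: h. Qed.

Lemma disc_area_neq0 : disc_area != 0 :> R.
Proof. by rewrite gt_eqF// disc_area_gt0. Qed.

Lemma fact_neq0 k : k`!%:R != 0 :> R.
Proof. by rewrite pnatr_eq0 -lt0n fact_gt0. Qed.

Lemma dirichlet_ball (al : 'I_n -> nat) :
  (\int[@cn_lebesgue R n]_(x in ball) (sqmono al x)%:E =
   (disc_area ^+ n * (\prod_(i < n) (al i)`!)%:R / (\sum_(i < n) al i + n)`!%:R)%:E)%E.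
Proof.
rewrite integral_mkcond -[X in X%:E](mulr1) -[X in _ * X](expr1n _ (\sum_(i < n) al i + n)).
rewrite -dirichlet//; apply: eq_integral => x _; rewrite patchE.
rewrite (_ : (x \in ball) = (sqtot x < 1)); last first.
  by rewrite cn_ballE; apply/idP/idP; rewrite inE.
by case: ifP => _; rewrite ?mulr1 ?mulr0.
Qed.

Lemma cn_lebesgue_ball : @cn_lebesgue R n ball = (disc_area ^+ n / n`!%:R)%:E.
Proof.
have := dirichlet_ball (fun=> 0%N).
rewrite big1// big1// add0n mulr1 => <-.
rewrite (eq_integral (fun=> 1%E)); last first.
  by move=> x _; rewrite /sqmono big1// => i _; rewrite expr0.
by rewrite integral_cst ?mul1e//; exact: measurable_ball.
Qed.

Lemma vol_constE : vol_const R n = (disc_area ^+ n)^-1.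
Proof.
rewrite /vol_const cn_lebesgue_ball /=; congr (_^-1).
by rewrite mulrC divfK// fact_neq0.
Qed.

Lemma ge0_integral_vol (f : pt -> \bar R) :
  measurable_fun ball f -> (forall x, ball x -> (0 <= f x)%E) ->
  (\int[vol]_(x in ball) f x =
   ((disc_area ^+ n)^-1)%:E * \int[@cn_lebesgue R n]_(x in ball) f x)%E.
Proof.
move=> mf f0; rewrite /Defs.vol ge0_integral_mscale//; last exact: measurable_ball.
congr (_%:E * _)%E => /=; rewrite vol_constE ger0_norm// invr_ge0 exprn_ge0//.
exact: ltW disc_area_gt0.
Qed.

Lemma vol_ball_fin : (vol ball < +oo)%E.
Proof.
have -> : vol ball = (`|vol_const R n|%:E * @cn_lebesgue R n ball)%E by [].
by rewrite cn_lebesgue_ball -EFinM ltry.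
Qed.

Lemma cmeas_coord (D : set pt) i : cmeas D (fun x : pt => cvec x 0 i).
Proof.
have mi : measurable_fun setT (fun x : pt => tnth x i) by exact: measurable_tnth.
split; under eq_fun do rewrite cvecE /=; apply: measurable_funTS.
  by apply: (measurableT_comp _ mi); exact: measurable_fst.
by apply: (measurableT_comp _ mi); exact: measurable_snd.
Qed.

Lemma cmeas_monomial (D : set pt) m : cmeas D (fun x : pt => monomial m (cvec x)).
Proof. by apply: cmeas_prod => i; apply: cmeasX; exact: cmeas_coord. Qed.

Lemma cmeas_pev (D : set pt) p : cmeas D (fun x : pt => pev p (cvec x)).
Proof.
under eq_fun do rewrite pevE; apply: cmeas_sum => m; apply: cmeasM.
  exact: cmeas_cst.
exact: cmeas_monomial.
Qed.

Lemma integrable_cst_ball (D : set pt) (c : R) : measurable D -> D `<=` ball ->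
  vol.-integrable D (EFin \o (fun=> c)).
Proof.
move=> mD Db; apply/integrableP; split.
  by apply/measurable_EFinP; exact: measurable_cst.
rewrite [X in (X < _)%E](_ : _ = `|c|%:E * vol D)%E; last by rewrite -integral_cst.
apply: lte_mul_pinfty => //; apply: le_lt_trans vol_ball_fin.
by apply: le_measure; rewrite ?inE//; exact: measurable_ball.
Qed.

Lemma cintegrable_bounded (D : set pt) F (M : R) : measurable D -> D `<=` ball ->
  cmeas D F -> (forall x, D x -> normc (F x) <= M) -> cintegrable vol D F.
Proof.
move=> mD Db mF FM; apply: (cintegrable_le mD mF (integrable_cst_ball M mD Db)) => x Dx.
exact: FM.
Qed.

Lemma csqint_bounded (D : set pt) F (M : R) : measurable D -> D `<=` ball ->
  cmeas D F -> (forall x, D x -> normc (F x) <= M) -> csqint vol D F.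
Proof.
move=> mD Db mF FM; apply: csqintP => //.
apply: (le_integrable mD _ _ (integrable_cst_ball (M ^+ 2) mD Db)).
  by apply/measurable_EFinP; exact: measurable_sqr_nc.
move=> x Dx /=; rewrite lee_fin !ger0_norm ?exprn_ge0 ?nc_ge0//.
  by rewrite lerXn2r ?nnegrE ?nc_ge0 ?FM// (le_trans (nc_ge0 (F x)))// FM.
by rewrite (le_trans (nc_ge0 (F x)))// FM.
Qed.

Lemma csqint_pev p : csqint vol ball (fun x : pt => pev p (cvec x)).
Proof.
have [M _ HM] := pev_bounded p.
apply: (@csqint_bounded _ _ M) => //; [exact: measurable_ball|exact: cmeas_pev|].
by move=> x bx; exact: HM.
Qed.

Definition rotv (u : 'I_n -> C) : pt -> pt := tuple_map (fun i => rot (u i)).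

Lemma cvec_rotv u (x : pt) i : cvec (rotv u x) 0 i = u i * cvec x 0 i.
Proof.
rewrite !cvecE tnth_mktuple /rot /=; apply/eqP.
by rewrite eq_complex cReM cImM /= eqxx/= addrC.
Qed.

Lemma preserves_rotv u : (forall i, normc (u i) = 1) -> preserves vol (rotv u).
Proof.
move=> u1; have [m1 m2] : preserves (@cn_lebesgue R n) (rotv u).
  by apply: preserves_tuple_map => i; exact: preserves_rot.
by split=> // A mA; rewrite /Defs.vol /mscale /=; congr (_ * _)%E; exact: m2.
Qed.

Lemma rotv_ball u : (forall i, normc (u i) = 1) -> rotv u @^-1` ball = ball.
Proof.
move=> u1; have E x : \sum_(i < n) normc (cvec (rotv u x) 0 i) ^+ 2 =
    \sum_(i < n) normc (cvec x 0 i) ^+ 2.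
  by apply: eq_bigr => i _; rewrite cvec_rotv ncM u1 mul1r.
by apply/seteqP; split => x; rewrite /cn_ball /= !enorm_lt1 E.
Qed.

(** Invariance under the rotation turns the integral into [c] times itself. *)
Lemma cintegral_rotv0 (D : set pt) u F (c : C) : measurable D ->
  (forall i, normc (u i) = 1) -> rotv u @^-1` D = D -> cmeas setT F ->
  cintegrable vol D F -> (forall x, F (rotv u x) = c * F x) -> c != 1 ->
  cintegral vol D F = 0.
Proof.
move=> mD u1 uD mF iF Fu c1; have [mu pu] := preserves_rotv u1.
have FuE : F \o rotv u = (fun x => c * F x) by apply/funext => x /=.
have := cintegral_preserves mD mu pu uD mF.
rewrite FuE cintegralZ// => /(_ (cintegrableZ c mD iF)) e.
have : (1 - c) * cintegral vol D F = 0 by rewrite mulrBl mul1r -e subrr.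
by move/eqP; rewrite mulf_eq0 subr_eq0 eq_sym (negPf c1) => /eqP.
Qed.

(** A primitive root of unity of order larger than both exponents separates them. *)
Lemma prim_root_sep j k : j != k -> exists2 w : C, normc w = 1 &
  w ^+ j * (w ^+ k)^* != 1.
Proof.
move=> jk; have [w pw] := @prim_root_ex R (maxn j k).+1 (ltn0Sn _).
have w1 := nc_prim_root pw; exists w => //; apply/negP => /eqP e.
have wk : w ^+ k * (w ^+ k)^* = 1 by rewrite -sqr_nc ncX w1 !expr1n.
have wk0 : (w ^+ k)^* != 0.
  by apply/eqP => z; move: wk; rewrite z mulr0 => /eqP; rewrite eq_sym oner_eq0.
have : w ^+ j = w ^+ k by apply: (mulIf wk0); rewrite e wk.
move/eqP; rewrite (eq_prim_root_expr pw) !modn_small ?ltnS ?leq_maxl ?leq_maxr//.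
by rewrite (negPf jk).
Qed.

(** A general invariant [D] is allowed because the lemma serves the ball as well as the subregions
    on which an expansion is bounded. *)
Lemma cintegral_homog0 (D : set pt) p q j k : measurable D -> D `<=` ball ->
  (forall w, normc w = 1 -> rotv (fun=> w) @^-1` D = D) ->
  homog j p -> homog k q -> j != k ->
  cintegral vol D (fun x => pev p (cvec x) * (pev q (cvec x))^*) = 0.
Proof.
move=> mD Db Dinv hp hq jk; have [w w1 wjk] := prim_root_sep jk.
have mpq : cmeas setT (fun x : pt => pev p (cvec x) * (pev q (cvec x))^*).
  by apply: cmeasM; [|apply: cmeas_conj]; exact: cmeas_pev.
apply: (cintegral_rotv0 mD (fun=> w1) (Dinv _ w1) mpq _ _ wjk).
  have [M M0 HM] := pev_bounded p; have [M' M'0 HM'] := pev_bounded q.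
  apply: (@cintegrable_bounded _ _ (M * M') mD Db).
    by case: mpq => h1 h2; split; exact: measurable_funTS.
  by move=> x /Db bx; rewrite ncM nc_conj ler_pM ?nc_ge0// ?HM ?HM'.
move=> x; have -> : cvec (rotv (fun=> w) x) = w *: cvec x.
  by apply/rowP => i; rewrite cvec_rotv [RHS]mxE.
by rewrite (pev_homogZ _ _ hp) (pev_homogZ _ _ hq) cconjM; ring.
Qed.

Lemma monomial_rotv u (x : pt) m :
  monomial m (cvec (rotv u x)) = (\prod_(i < n) u i ^+ m i) * monomial m (cvec x).
Proof.
by rewrite /monomial -big_split; apply: eq_bigr => i _; rewrite cvec_rotv exprMn.
Qed.

Lemma cintegral_monomial m m' :
  cintegral vol ball (fun x => monomial m (cvec x) * (monomial m' (cvec x))^*) =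
  if m == m' then ((mfact m)%:R / (mdeg m + n)`!%:R) else 0.
Proof.
case: eqP => [<-|/eqP mm'].
  have sm : csqint vol ball (fun x : pt => monomial m (cvec x)).
    by have := csqint_pev (mpolyX C m); under eq_fun do rewrite pevX.
  rewrite (cintegral_sqr measurable_ball sm).
  rewrite ge0_integral_vol; first last.
  - by move=> x _; rewrite lee_fin exprn_ge0// nc_ge0.
  - by apply/measurable_EFinP; apply: measurable_sqr_nc; case: sm.
  rewrite (eq_integral (fun x => (sqmono m x)%:E)); last first.
    move=> x _; congr (_%:E); rewrite /monomial /sqmono.
    rewrite (big_morph _ ncM (normc1 _)) -prodrXl; apply: eq_bigr => i _.
    by rewrite cvecE ncX sqn_nc -!exprM mulnC.
  rewrite dirichlet_ball -EFinM /= -mdegE mulrA mulrA mulVf ?mul1r; last first.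
    by rewrite expf_neq0// disc_area_neq0.
  by rewrite rmorphM fmorphV !rmorph_nat.
have [i mi] : exists i, m i != m' i.
  apply: contrapT => /forallNP h; move/eqP: mm'; apply.
  by apply/mnmP => i; apply/eqP; apply/negPn/negP/h.
have [w w1 wmi] := prim_root_sep mi.
(* Degrees may coincide here, so only a coordinate in which the exponents differ is rotated. *)
pose u j := if j == i then w else 1.
have u1 j : normc (u j) = 1 by rewrite /u; case: ifP; rewrite ?normc1.
have uE (k : multinom n) : \prod_(j < n) u j ^+ k j = w ^+ k i.
  rewrite (bigD1 i)//= /u eqxx big1 ?mulr1// => j /negPf ->.
  by rewrite expr1n.
have mpq : cmeas setT (fun x : pt => monomial m (cvec x) * (monomial m' (cvec x))^*).
  by apply: cmeasM; [|apply: cmeas_conj]; exact: cmeas_monomial.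
apply: (cintegral_rotv0 measurable_ball u1 (rotv_ball u1) mpq _ _ wmi).
  have s k : csqint vol ball (fun x : pt => monomial k (cvec x)).
    by have := csqint_pev (mpolyX C k); under eq_fun do rewrite pevX.
  exact: (csqint_mul measurable_ball (s m) (s m')).
by move=> x; rewrite !monomial_rotv !uE cconjM; ring.
Qed.

End ball_measure.

(** * The Bergman space *)

Section bergman_space.
Context {R : realType} {n : nat}.
Local Notation C := R[i].
Local Notation B := (uball R n).
Local Notation pt := (cn_point R n).
Local Notation ball := (@cn_ball R n).
Local Notation vol := (@vol R n).
Local Notation ipA := (ip (bergman R n)).
Implicit Types (f g : B -> C) (p q : mpoly n C).

Lemma poly_funE p (z : B) : poly_fun p z = pev p (uball_val z).
Proof. by []. Qed.

Lemma ext0_lin (a : C) f g x : ball x ->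
  ext0 (a *: f + g) x = a * ext0 f x + ext0 g x.
Proof. by move: x; apply: ball_ind => x bx; rewrite !ext0E. Qed.

Lemma ext0_poly p x : ball x -> ext0 (poly_fun p) x = pev p (cvec x).
Proof. by move: x; apply: ball_ind => x bx; rewrite !ext0E. Qed.

Lemma ip_bergmanE f g :
  ipA f g = cintegral vol ball (fun x => ext0 f x * (ext0 g x)^*).
Proof.
rewrite /= /ball_int; apply: (@eq_cintegral _ _ _ vol ball).
by apply: ball_ind => x bx; rewrite !ext0E.
Qed.

(** Measurability replaces analyticity: it survives pointwise limits, and the Bergman form is a
    semi-inner product already on this larger class. *)
Definition L2B f : Prop := csqint vol ball (ext0 f).

Lemma eq_cmeas (D : set pt) (F G : pt -> C) : measurable D ->
  (forall x, D x -> F x = G x) -> cmeas D F -> cmeas D G.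
Proof.
move=> mD FG [h1 h2]; split.
  by apply: eq_measurable_fun h1 => x; rewrite inE => /FG ->.
by apply: eq_measurable_fun h2 => x; rewrite inE => /FG ->.
Qed.

Lemma eq_csqint (F G : pt -> C) : (forall x, ball x -> F x = G x) ->
  csqint vol ball F -> csqint vol ball G.
Proof.
move=> FG [mF F2]; split; first exact: (eq_cmeas measurable_ball FG).
rewrite (eq_integral (fun x => (normc (F x) ^+ 2)%:E))// => x.
by rewrite inE => /FG ->.
Qed.

Lemma bergman_semi_ip : semi_ip L2B ipA.
Proof.
have mb := @measurable_ball R n.
have lin (a : C) f g : L2B f -> L2B g -> L2B (a *: f + g).
  move=> lf lg; apply: (eq_csqint _ (csqintD a mb lf lg)) => x bx.
  by rewrite ext0_lin.
have L0 : L2B 0.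
  apply: (@csqint_bounded _ _ _ _ 0 mb) => //.
    by apply: (eq_cmeas mb _ (cmeas_cst _ 0)); apply: ball_ind => x bx; rewrite ext0E.
  by apply: ball_ind => x bx; rewrite ext0E normc0.
split=> //.
- move=> a f g h lf lg lh; rewrite !ip_bergmanE.
  rewrite (@eq_cintegral _ _ _ vol ball _ (fun x => a * (ext0 f x * (ext0 h x)^*) +
    ext0 g x * (ext0 h x)^*)); last by move=> x bx; rewrite ext0_lin// mulrDl mulrA.
  have i1 := csqint_mul mb lf lh; have i2 := csqint_mul mb lg lh.
  by rewrite cintegralD ?cintegralZ//; exact: cintegrableZ.
- move=> f g lf lg; rewrite !ip_bergmanE -cintegral_conj//; last exact: csqint_mul.
  by apply: eq_cintegral => x _; rewrite cconjM conjCK mulrC.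
- move=> f lf; rewrite ip_bergmanE cintegral_sqr// lecR fine_ge0//.
  by apply: integral_ge0 => x _; rewrite lee_fin exprn_ge0// nc_ge0.
Qed.

Local Notation sip := bergman_semi_ip.

Lemma L2B_poly p : L2B (poly_fun p).
Proof.
by apply: (eq_csqint _ (csqint_pev p)) => x bx; rewrite ext0_poly.
Qed.

Lemma poly_fun_sum I (r : seq I) (F : I -> mpoly n C) :
  poly_fun (\sum_(i <- r) F i) = \sum_(i <- r) poly_fun (F i) :> (B -> C).
Proof.
by apply/funext => z; rewrite poly_funE pev_sum fct_sumE.
Qed.

Lemma poly_funZ a p : poly_fun (a *: p) = a *: poly_fun p :> (B -> C).
Proof. by apply/funext => z; rewrite poly_funE pevZ. Qed.

Lemma ip_bergman_poly p q : ipA (poly_fun p) (poly_fun q) =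
  \sum_(m <- msupp p) mcoeff m p * ((mcoeff m q)^* *
     ((mfact m)%:R / (mdeg m + n)`!%:R)).
Proof.
rewrite {1}(mpolyE p) poly_fun_sum.
rewrite (sip_suml sip); [|by move=> m; exact: L2B_poly|exact: L2B_poly].
apply: eq_bigr => m _; rewrite poly_funZ (sipZl sip); [|exact: L2B_poly..].
congr (_ * _); rewrite (mpolyE q) poly_fun_sum.
rewrite (sip_sumr sip); [|by move=> k; exact: L2B_poly|exact: L2B_poly].
rewrite (eq_bigr (fun m' => if m == m' then (mcoeff m' q)^* *
     ((mfact m)%:R / (mdeg m + n)`!%:R) else 0)); last first.
  move=> m' _; rewrite poly_funZ (sipZr sip); [|exact: L2B_poly..].
  rewrite ip_bergmanE (@eq_cintegral _ _ _ vol ball _ (fun x => monomial m (cvec x) *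
    (monomial m' (cvec x))^*)); last first.
    by move=> x bx; rewrite !ext0_poly// !pevX.
  by rewrite cintegral_monomial; case: eqP => _; rewrite ?mulr0.
rewrite -mpolyE; have [mq|mq] := boolP (m \in msupp q).
  rewrite (bigD1_seq m)//= eqxx big1 ?addr0// => m' m'm.
  by rewrite eq_sym (negPf m'm).
rewrite (memN_msupp_eq0 mq) rmorph0 mul0r big_seq big1// => m' m'q.
by case: eqP => // e; rewrite e m'q in mq.
Qed.

Lemma factC_neq0 k : (k`!%:R : C) != 0.
Proof. by rewrite pnatr_eq0 -lt0n fact_gt0. Qed.

Lemma ip_bergman_homog k p q : homog k p ->
  ipA (poly_fun p) (poly_fun q) = fischer p q / (k + n)`!%:R.
Proof.
move=> hp; rewrite ip_bergman_poly /fischer mulr_suml big_seq [RHS]big_seq.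
by apply: eq_bigr => m mp; rewrite (hp _ mp) !mulrA.
Qed.

(** The Bergman pairing with a monomial recovers its coefficient up to a nonzero factor, so a
    polynomial that vanishes on the ball has no coefficients. *)
Lemma poly_fun_inj p q : (forall z : B, pev p (uball_val z) = pev q (uball_val z)) -> p = q.
Proof.
move=> pq; apply/mpolyP => m; apply/eqP; rewrite -subr_eq0 -mcoeffB.
have r0 : poly_fun (p - q) = 0 :> (B -> C).
  apply/funext => z; rewrite /poly_fun mevalB; apply/eqP; rewrite subr_eq0.
  by apply/eqP; exact: pq.
have := sip0l sip (L2B_poly (mpolyX C m)); rewrite -r0 ip_bergman_poly.
have [mr|] := boolP (m \in msupp (p - q)); last by move/memN_msupp_eq0 ->.
rewrite (bigD1_seq m)//= big1 ?addr0 => [|m' m'm]; last first.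
  by rewrite mcoeffX eq_sym (negPf m'm) rmorph0 mul0r mulr0.
rewrite mcoeffX eqxx rmorph1 mul1r => /eqP; rewrite mulf_eq0 => /orP[//|].
by rewrite mulf_eq0 invr_eq0 (negPf (factC_neq0 _)) (negPf (mfact_neq0 _)).
Qed.

(** Only the partial sums by degree have to converge. Absolute convergence follows by homogeneity,
    since the expansion holds at a slightly dilated point too. *)
Definition expands f (p : nat -> mpoly n C) : Prop :=
  (forall k, homog k (p k)) /\
  forall z : B, csum (fun k => pev (p k) (uball_val z)) (f z).

Lemma scale_ball (z : B) : exists2 t : R, 1 < t & enorm ((t%:C)%C *: uball_val z) < 1.
Proof.
have z1 := uball_lt1 z; have z0 := enorm_ge0 (uball_val z).
exists (2 / (1 + enorm (uball_val z))); first by rewrite ltr_pdivlMr; lra.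
rewrite enormZ nc_real ger0_norm; last by rewrite divr_ge0//; lra.
by rewrite mulrAC ltr_pdivrMr; lra.
Qed.

Lemma expands_abs f (p : nat -> mpoly n C) : expands f p -> forall z : B,
  exists M : R, bounded_sums (fun k => normc (pev (p k) (uball_val z))) M.
Proof.
move=> [hp fp] z; have [t t1 tz] := scale_ball z.
have := fp (UBall tz) => /= h.
have {}h : csum (fun k => pev (p k) (uball_val z) * (t%:C)%C ^+ k) (f (UBall tz)).
  by apply: (@ccvg_eventually _ _ _ _ 0) h => K _; apply: eq_bigr => k _;
    rewrite (pev_homogZ _ _ (hp k)) mulrC.
have [|M _ HM] := abel_bounded h (s := 1).
  by rewrite ler01 nc_real gtr0_norm// (lt_trans _ t1).
by exists M => K; have := HM K; under eq_bigr do rewrite expr1n mulr1.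
Qed.

Lemma expands_cmeas f (p : nat -> mpoly n C) : expands f p -> cmeas ball (ext0 f).
Proof.
move=> [_ fp]; apply: (cmeas_lim measurable_ball
  (F := fun K x => \sum_(k < K) pev (p k) (cvec x))).
  by move=> K; apply: cmeas_sum => k; exact: cmeas_pev.
apply: ball_ind => x bx; rewrite ext0E; exact: (fp (UBall bx)).
Qed.

Definition abs_region (p : nat -> mpoly n C) (c : nat) : set pt :=
  \bigcap_K [set x : pt | \sum_(k < K) normc (pev (p k) (cvec x)) <= c%:R].

Lemma measurable_abs_region (p : nat -> mpoly n C) c : measurable (abs_region p c).
Proof.
apply: bigcapT_measurable => K.
rewrite (_ : [set x : pt | _] = (fun x : pt => \sum_(k < K) normc (pev (p k) (cvec x)))
   @^-1` `]-oo, c%:R]%classic); last first.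
  by apply/seteqP; split => x /=; rewrite in_itv.
rewrite -[X in measurable X]setTI.
suff : measurable_fun setT (fun x : pt => \sum_(k < K) normc (pev (p k) (cvec x))) by exact.
by apply: measurable_sum => k; apply: measurable_nc; exact: cmeas_pev.
Qed.

(* On [abs_region p c] the expansion is dominated by the constant [c], and that region
   is invariant under the diagonal rotations, which separate the degrees. *)
Lemma cintegral_abs_region f (p : nat -> mpoly n C) q k c : expands f p -> homog k q ->
  cintegral vol (ball `&` abs_region p c)
    (fun x => ext0 f x * (pev q (cvec x))^*) =
  cintegral vol (ball `&` abs_region p c)
    (fun x => pev (p k) (cvec x) * (pev q (cvec x))^*).
Proof.
move=> fp hq; set D := ball `&` _; have [hp fs] := fp.
have mD : measurable D.
  by apply: measurableI; [exact: measurable_ball|exact: measurable_abs_region].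
have Db : D `<=` ball by move=> x [].
have Dinv w : normc w = 1 -> rotv (fun=> w) @^-1` D = D.
  move=> w1; have bE := @rotv_ball R n (fun=> w) (fun=> w1).
  rewrite /D preimage_setI bE; congr (_ `&` _).
  have cE (x : pt) : cvec (rotv (fun=> w) x) = w *: cvec x.
    by apply/rowP => i; rewrite cvec_rotv [RHS]mxE.
  have sE (x : pt) K : \sum_(k < K) normc (pev (p k) (cvec (rotv (fun=> w) x))) =
      \sum_(k < K) normc (pev (p k) (cvec x)).
    apply: eq_bigr => j _.
    by rewrite cE (pev_homogZ _ _ (hp j)) ncM ncX w1 expr1n mul1r.
  by apply/seteqP; split => x /= h K _ /=; have := h K I; rewrite /= sE.
have [M M0 HM] := pev_bounded q.
have mq : cmeas D (fun x : pt => (pev q (cvec x))^*).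
  by apply: cmeas_conj; exact: cmeas_pev.
have lim : ccvg (fun K => cintegral vol D
    (fun x => (\sum_(j < K) pev (p j) (cvec x)) * (pev q (cvec x))^*))
    (cintegral vol D (fun x => ext0 f x * (pev q (cvec x))^*)).
  apply: (cintegral_dct (b := fun=> c%:R * M) mD).
  - by move=> K; apply: cmeasM => //; apply: cmeas_sum => j; exact: cmeas_pev.
  - exact: integrable_cst_ball.
  - move=> x [bx _]; apply: ccvgM; last exact: ccvg_cst.
    by move: x bx; apply: ball_ind => x bx; rewrite ext0E; exact: (fs (UBall bx)).
  - move=> K x [bx Ex]; rewrite ncM nc_conj ler_pM ?nc_ge0// ?HM//.
    by apply: le_trans (nc_sum _ _ _) _; exact: (Ex K I).
apply: ccvg_unique lim _.
apply: (@ccvg_eventually _ (fun=> cintegral vol D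
   (fun x => pev (p k) (cvec x) * (pev q (cvec x))^*)) _ _ k.+1); last exact: ccvg_cst.
move=> K kK; have iF j : cintegrable vol D
    (fun x : pt => pev (p j) (cvec x) * (pev q (cvec x))^*).
  have [M' M'0 HM'] := pev_bounded (p j).
  apply: (@cintegrable_bounded _ _ _ _ (M' * M)) => //.
    by apply: cmeasM => //; exact: cmeas_pev.
  by move=> x /Db bx; rewrite ncM nc_conj ler_pM ?nc_ge0// ?HM ?HM'.
have [_ sE] := cintegral_sum (index_enum 'I_K) mD (fun j : 'I_K => iF j).
under [RHS]eq_cintegral do rewrite mulr_suml.
rewrite [RHS]sE (bigD1 (Ordinal kK))//= big1 ?addr0// => j jk.
by apply: (cintegral_homog0 mD Db Dinv (hp j) hq).
Qed.

(** By absolute convergence every point of the ball lies in the region for all large [c], so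
    dominated convergence applies. *)
Lemma cintegral_abs_region_lim f (p : nat -> mpoly n C) (G : pt -> C) (b : pt -> R) : expands f p ->
  cmeas ball G -> vol.-integrable ball (EFin \o b) ->
  (forall x, ball x -> normc (G x) <= b x) ->
  ccvg (fun c => cintegral vol (ball `&` abs_region p c) G) (cintegral vol ball G).
Proof.
move=> fp mG ib Gb; have mb := @measurable_ball R n.
under [X in ccvg X]eq_fun do rewrite (cintegral_setI_indic _ _ mb (measurable_abs_region _ _)).
apply: (cintegral_dct (b := b) mb) => //.
- move=> c; apply: cmeasM => //; split => /=; last exact: measurable_cst.
  by apply: measurable_indic; exact: measurable_abs_region.
- apply: ball_ind => x bx; have [M HM] := expands_abs fp (UBall bx).
  apply: (@ccvg_eventually _ (fun=> G x) _ _ (Num.truncn `|M|).+1); last exact: ccvg_cst.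
  move=> c Mc; rewrite indicE mem_set ?mulr1// => K _ /=.
  apply: le_trans (HM K) _; apply: le_trans (ler_norm _) _.
  by apply: ltW; apply: lt_le_trans (truncnS_gt _) _; rewrite ler_nat.
- move=> c x bx; rewrite ncM nc_real -[leRHS]mulr1; apply: ler_pM => //.
  + exact: nc_ge0.
  + exact: Gb.
  + by rewrite indicE; case: (_ \in _); rewrite ?normr1 ?normr0.
Qed.

(** The two integrals agree over each region, where integration term by term is legitimate, and the
    regions exhaust the ball. *)
Lemma expands_ip f (p : nat -> mpoly n C) q k : expands f p -> L2B f -> homog k q ->
  ipA f (poly_fun q) = ipA (poly_fun (p k)) (poly_fun q).
Proof.
move=> fp lf hq; have mb := @measurable_ball R n.
have lim (F : pt -> C) : csqint vol ball F ->
    ccvg (fun c => cintegral vol (ball `&` abs_region p c)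
      (fun x => F x * (pev q (cvec x))^*))
      (cintegral vol ball (fun x => F x * (pev q (cvec x))^*)).
  move=> lF; have lq := csqint_pev q.
  apply: (cintegral_abs_region_lim (b := fun x => normc (F x) ^+ 2 +
    normc (pev q (cvec x)) ^+ 2) fp).
  - apply: cmeasM; first by case: lF.
    by apply: cmeas_conj; exact: cmeas_pev.
  - have h := integrableD mb (csqint_integrable mb lF) (csqint_integrable mb lq).
    by apply: (integrable_eq mb h) => x _.
  - move=> x _; rewrite ncM nc_conj.
    by have := nc_ge0 (F x); have := nc_ge0 (pev q (cvec x)); nra.
rewrite !ip_bergmanE.
rewrite (@eq_cintegral _ _ _ vol ball _ (fun x => ext0 f x * (pev q (cvec x))^*)); last first.
  by move=> x bx; rewrite (ext0_poly q).
rewrite [RHS](@eq_cintegral _ _ _ vol ball _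
  (fun x => pev (p k) (cvec x) * (pev q (cvec x))^*)); last first.
  by move=> x bx; rewrite !ext0_poly.
apply: ccvg_unique (lim _ lf) _.
have := lim _ (csqint_pev (p k)); apply: (@ccvg_eventually _ _ _ _ 0) => c _.
by rewrite -(cintegral_abs_region _ fp hq).
Qed.

Lemma sn2_bergmanE f : L2B f ->
  (\int[vol]_(x in ball) ((normc (ext0 f x) ^+ 2)%:E) = (sn2 ipA f)%:E)%E.
Proof.
move=> lf; have mb := @measurable_ball R n.
rewrite /sn2 ip_bergmanE cintegral_sqr//= fineK//.
by have := integrable_fin_num mb (csqint_integrable mb lf).
Qed.

(** Expansions supply pointwise limits, and Fatou's lemma converts these into norm bounds. *)
Lemma bergman_fatou (g : nat -> B -> C) f (M : R) : (forall J, L2B (g J)) ->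
  (forall z, ccvg (g ^~ z) (f z)) -> (forall J, sn2 ipA (g J) <= M) ->
  L2B f /\ sn2 ipA f <= M.
Proof.
move=> lg gf gM; have mb := @measurable_ball R n.
have gx x : ball x -> ccvg (fun J => ext0 (g J) x) (ext0 f x).
  move: x; apply: ball_ind => x bx; rewrite ext0E.
  by under eq_fun do rewrite ext0E; exact: gf.
have mf : cmeas ball (ext0 f).
  by apply: (cmeas_lim mb (F := fun J => ext0 (g J))) => // J; case: (lg J).
have le : (\int[vol]_(x in ball) ((normc (ext0 f x) ^+ 2)%:E) <= M%:E)%E.
  pose u J x := ((normc (ext0 (g J) x) ^+ 2)%:E : \bar R).
  have mu J : measurable_fun ball (u J).
    by apply/measurable_EFinP; apply: measurable_sqr_nc; case: (lg J).
  have u0 J x : ball x -> (0 <= u J x)%E.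
    by move=> _; rewrite lee_fin exprn_ge0// nc_ge0.
  apply: le_trans (le_trans (fatou vol mb mu u0) _).
    rewrite le_eqVlt; apply/orP; left; apply/eqP; apply: eq_integral => x.
    rewrite inE => bx; apply/esym; apply: (cvg_limn_einf_sup _).1.
    apply: cvg_EFin; first exact: nearW.
    have h := ccvg_normc (gx x bx); rewrite /u /=.
    by rewrite expr2; under eq_fun do rewrite expr2; exact: cvgM.
  rewrite limn_einf_lim; apply: lime_le; first exact: is_cvg_einfs.
  apply: nearW => J; apply: (@le_trans _ _ (\int[vol]_(x in ball) u J x)%E).
    by apply: ereal_inf_lbound; exists J => /=.
  by rewrite sn2_bergmanE// lee_fin.
have lf : L2B f by split => //; exact: le_lt_trans le (ltry _).
by split => //; rewrite -lee_fin -sn2_bergmanE.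
Qed.

Section expansions.
Variables (f : B -> C) (p : nat -> mpoly n C).
Hypothesis fp : expands f p.
Let h k : B -> C := poly_fun (p k).

Lemma poly_orth j k : j != k -> ipA (poly_fun (p j)) (poly_fun (p k)) = 0.
Proof.
move=> jk; have [hp _] := fp.
rewrite ip_bergmanE (@eq_cintegral _ _ _ vol ball _ (fun x => pev (p j) (cvec x) *
  (pev (p k) (cvec x))^*)); last by move=> x bx; rewrite !ext0_poly.
apply: (cintegral_homog0 measurable_ball _ _ (hp j) (hp k) jk) => // w w1.
exact: rotv_ball.
Qed.

Lemma expands_L2B (M : R) : bounded_sums (fun k => sn2 ipA (h k)) M -> L2B f.
Proof.
move=> hM; have := @bergman_fatou (fun J => \sum_(0 <= k < J) h k) f M.
case=> //.
- by move=> J; apply: (sip_sum sip) => k; exact: L2B_poly.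
- move=> z; have := fp.2 z; apply: (@ccvg_eventually _ _ _ _ 0) => K _.
  by rewrite fct_sumE big_mkord.
- move=> J; rewrite (sn2_sum sip) ?iota_uniq ?big_mkord//; first exact: hM.
    by move=> k; exact: L2B_poly.
  exact: poly_orth.
Qed.

Hypothesis lf : L2B f.

Lemma expands_bessel K : sn2 ipA (f - \sum_(k < K) h k) =
  sn2 ipA f - \sum_(k < K) sn2 ipA (h k).
Proof.
have [hp _] := fp.
apply: (bessel sip) => //; [by move=> k; exact: L2B_poly|exact: poly_orth|].
by move=> k; exact: expands_ip.
Qed.

Lemma expands_bounded : bounded_sums (fun k => sn2 ipA (h k)) (sn2 ipA f).
Proof.
move=> K; rewrite -subr_ge0 -expands_bessel; apply: (sn2_ge0 sip).
apply: (sip_sub sip) => //; rewrite -(big_mkord xpredT h).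
by apply: (sip_sum sip) => k; exact: L2B_poly.
Qed.

Lemma expands_cvg : (fun K => sn2 ipA (f - \sum_(k < K) h k)) @ \oo --> (0 : R).
Proof.
have lh k : L2B (h k) by exact: L2B_poly.
have lr K : L2B (f - \sum_(k < K) h k).
  apply: (sip_sub sip) => //; rewrite -(big_mkord xpredT h).
  exact: (sip_sum sip).
apply/cvgrPdist_lt => e e0; have e2 : 0 < e / 2 by rewrite divr_gt0.
have [K0 HK] := bounded_sums_tail (fun k => sn2_ge0 sip (lh k)) expands_bounded e2.
exists K0 => // K K0K; rewrite /= sub0r normrN ger0_norm; last exact: (sn2_ge0 sip (lr K)).
apply: (@le_lt_trans _ _ (e / 2)); last by lra.
(* The remainder is the pointwise limit of finite blocks, whose squared norms are at most [e / 2] by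
   orthogonality. *)
have := @bergman_fatou (fun J => \sum_(K <= k < J + K) h k) (f - \sum_(k < K) h k) (e / 2).
case=> // [J|z|J].
- exact: (sip_sum sip).
- have h1 := ccvg_sub (s := fun J => (J + K)%N) (fun J => leq_addr _ _) (fp.2 z).
  have := ccvgB h1 (ccvg_cst (\sum_(k < K) pev (p k) (uball_val z))).
  rewrite (_ : (f - _) z = f z - \sum_(k < K) pev (p k) (uball_val z)); last first.
    by rewrite /GRing.add /GRing.opp /= fct_sumE.
  apply: (@ccvg_eventually _ _ _ _ 0) => J _ /=.
  by rewrite fct_sumE sum_tailE// leq_addl.
- rewrite (sn2_sum sip) ?iota_uniq//; last exact: poly_orth.
  apply: le_trans (HK (J + K)%N).
  have KJ : (K <= J + K)%N by exact: leq_addl.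
  rewrite (big_cat_nat K0K KJ) /= lerDr.
  by apply: sumr_ge0 => k _; exact: (sn2_ge0 sip).
Qed.

Lemma expands_ip_csum g (q : nat -> mpoly n C) : expands g q -> L2B g ->
  csum (fun k => ipA (h k) (poly_fun (q k))) (ipA f g).
Proof.
move=> gq lg; have lh k : L2B (h k) by exact: L2B_poly.
have lS K : L2B (\sum_(k < K) h k).
  by rewrite -(big_mkord xpredT h); exact: (sip_sum sip).
have := sip_ccvgl sip lS lf lg expands_cvg.
apply: (@ccvg_eventually _ _ _ _ 0) => K _.
rewrite (sip_suml sip)//; apply: eq_bigr => k _.
rewrite (sipC sip lg (lh k)) (expands_ip gq lg (fp.1 k)).
by rewrite -(sipC sip)//; exact: L2B_poly.
Qed.

End expansions.

End bergman_space.

(** * Homogeneous expansion of analytic functions *)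

Section analytic_expansion.
Context {R : realType} {n : nat}.
Local Notation C := R[i].
Local Notation B := (uball R n).
Implicit Types (f : B -> C).

Fixpoint degs_lt K : seq (multinom n) :=
  if K is K'.+1 then degs_lt K' ++ degs K' else [::].

Lemma mem_degs_lt K m : (m \in degs_lt K) = (mdeg m < K)%N.
Proof.
elim: K => [|K IH]; first by rewrite in_nil.
by rewrite /= mem_cat IH mem_degs ltnS orbC -leq_eqVlt.
Qed.

Lemma uniq_degs_lt K : uniq (degs_lt K).
Proof.
elim: K => //= K IH; rewrite cat_uniq IH uniq_degs andbT /=.
apply/hasPn => m; rewrite mem_degs => /eqP mK; rewrite mem_degs_lt mK.
by rewrite ltnn.
Qed.

(** Every finite set of multi-indices lies in some [degs_lt K], so these sets are cofinal among the
    finite ones. *)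
Lemma has_sum_csum (a : multinom n -> C) s : has_sum a s ->
  csum (fun k => \sum_(m <- degs k) a m) s.
Proof.
move=> h; apply/ccvgP => e e0; have [F0 HF] := h e e0.
exists (\max_(m <- enum_fset F0) mdeg m).+1 => K FK; rewrite ncB.
pose F : {fset multinom n} := [fset m in degs_lt K]%fset.
have -> : \sum_(k < K) \sum_(m <- degs k) a m = \sum_(m <- F) a m.
  transitivity (\sum_(m <- degs_lt K) a m).
    elim: K {FK F} => [|K IH]; first by rewrite big_ord0 big_nil.
    by rewrite big_ord_recr /= big_cat /= IH.
  apply: perm_big; apply: uniq_perm; [exact: uniq_degs_lt|exact: fset_uniq|].
  by move=> m; rewrite in_fset.
apply: HF; apply/fsubsetP => m mF0; rewrite in_fset mem_degs_lt.
by apply: leq_ltn_trans FK; exact: (leq_bigmax_seq _ mF0).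
Qed.

Lemma uball0_proof : enorm (0 : 'rV[C]_n) < 1. Proof. by rewrite enorm0 ltr01. Qed.

Lemma has_sum_line (c : multinom n -> C) (z : 'rV[C]_n) (x a s : C) :
  has_sum (fun m => c m * monomial m (x *: z - a *: z)) s ->
  csum (fun k => (\sum_(m <- degs k) c m * monomial m z) * (x - a) ^+ k) s.
Proof.
move=> /has_sum_csum; apply: (@ccvg_eventually _ _ _ _ 0) => K _.
apply: eq_bigr => k _; rewrite mulr_suml big_seq [RHS]big_seq.
apply: eq_bigr => m; rewrite mem_degs => /eqP mk.
by rewrite -scalerBl monomialZ mk; ring.
Qed.

Lemma analytic_expands f : analytic f -> exists p, expands f p.
Proof.
move=> af; have [r [c [r0 Hc]]] := af (UBall uball0_proof).
exists (fun k => hpart k c); split; first by move=> k; exact: homog_hpart.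
move=> z; set v := uball_val z.
have v0 := enorm_ge0 v; have v1 := uball_lt1 z; rewrite -/v in v1.
(* Chosen with [1 < Rr] and [Rr * enorm v < 1]: the slice through [z] stays in the ball, and [x = 1]
   is interior to its disc. Using [1 + enorm v] as denominator covers [z = 0] as well. *)
pose Rr := 2 / (1 + enorm v).
have Rr1 : 1 < Rr by rewrite ltr_pdivlMr; lra.
have inR x : normc x < Rr -> enorm (x *: v) < 1.
  move=> xR; rewrite enormZ.
  have h1 : Rr * enorm v < 1 by rewrite mulrAC ltr_pdivrMr; lra.
  by apply: le_lt_trans h1; rewrite ler_wpM2r// ltW.
pose h x := if insub (x *: v) is Some w then f w else 0.
have hE x (xv : enorm (x *: v) < 1) : h x = f (UBall xv).
  by rewrite /h (insubT (fun z => enorm z < 1) xv).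
have small (r' : R) (x a : C) : normc (x - a) < r' / (1 + enorm v) ->
    enorm (x *: v - a *: v) < r'.
  move=> xa; rewrite -scalerBl enormZ.
  have p1 : 0 < 1 + enorm v by lra.
  move: xa; rewrite ltr_pdivlMr//; have := nc_ge0 (x - a); nra.
have loc a : normc a < Rr -> exists2 dl : R, 0 < dl & exists c, forall x,
    normc x < Rr -> normc (x - a) < dl -> csum (fun k => c k * (x - a) ^+ k) (h x).
  move=> aR; have [r' [c' [r'0 Hc']]] := af (UBall (inR a aR)).
  exists (r' / (1 + enorm v)); first by rewrite divr_gt0//; lra.
  exists (fun k => \sum_(m <- degs k) c' m * monomial m v) => x xR xa.
  apply: has_sum_line; rewrite (hE x (inR x xR)).
  by apply: (Hc' (UBall (inR x xR))) => /=; exact: small.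
pose r1 := Num.min Rr (r / (1 + enorm v)).
have r10 : 0 < r1 by rewrite lt_min !divr_gt0//; lra.
have start x : normc x < r1 ->
    csum (fun k => (\sum_(m <- degs k) c m * monomial m v) * x ^+ k) (h x).
  rewrite lt_min => /andP[xR xr]; rewrite (hE x (inR x xR)).
  have := Hc (UBall (inR x xR)); rewrite /= => /(_ _).
  rewrite -(scale0r v) => H.
  have := @has_sum_line c v x 0 _ (H (small _ _ _ _)); rewrite subr0; exact.
have := continuation loc r10 start (x := 1); rewrite normc1 => /(_ Rr1).
have v1' : enorm (1 *: v) < 1 by rewrite scale1r.
rewrite (hE 1 v1'); have -> : UBall v1' = z by apply: val_inj; rewrite /= scale1r.
apply: (@ccvg_eventually _ _ _ _ 0) => K _; apply: eq_bigr => k _.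
by rewrite expr1n mulr1 pev_hpart.
Qed.

End analytic_expansion.

Lemma nc_geom_tail {R : realType} (x : R[i]) N : normc x < 1 -> (0 < N)%N ->
  normc (x ^+ N / (1 - x ^+ N)) <= normc x ^+ N / (1 - normc x).
Proof.
move=> x1 N0; have p1 : 0 < 1 - normc x by lra.
have lb : 1 - normc x <= normc (1 - x ^+ N).
  have := nc_triangle_sub 1 (x ^+ N); rewrite normc1 ncX; apply: le_trans.
  by rewrite lerD2l lerN2 -[leRHS]expr1 ler_wiXn2l ?nc_ge0 ?(ltW x1).
rewrite ncM ncV ncX ler_wpM2l ?exprn_ge0 ?nc_ge0// lef_pV2 ?posrE//.
exact: lt_le_trans lb.
Qed.

(** * The Drury space *)

Section drury_space.
Context {R : realType} {n : nat}.
Local Notation C := R[i].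
Local Notation B := (uball R n).
Variable H : ip_space (B -> C).
Hypothesis drury_H : is_drury H.
Hypothesis H_poly : forall p, H (poly_fun p).
Local Notation ipH := (ip H).
Implicit Types (f g : B -> C) (z w : B).

Lemma drury_hilbert : is_hilbert H. Proof. by case: drury_H. Qed.

Lemma drury_semi_ip : semi_ip H ipH.
Proof. by apply: inner_product_semi; case: drury_hilbert. Qed.

Local Notation sip := drury_semi_ip.

Lemma drury_kernelH w : H (drury_kernel w). Proof. by case: drury_H. Qed.

Lemma reproducing f w : H f -> ipH f (drury_kernel w) = f w.
Proof. by case: drury_H => _ _ _; exact. Qed.

Lemma drury_eval (u : nat -> B -> C) f z : (forall k, H (u k)) -> H f ->
  (fun k => sn2 ipH (f - u k)) @ \oo --> (0 : R) -> ccvg (u ^~ z) (f z).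
Proof.
move=> Hu Hf uf; have := sip_ccvgl sip Hu Hf (drury_kernelH z) uf.
by rewrite reproducing//; apply: (@ccvg_eventually _ _ _ _ 0) => k _; rewrite reproducing.
Qed.

(** Evaluations are continuous in norm, so the limit supplied by completeness has to be the
    pointwise limit. *)
Lemma drury_cauchy (u : nat -> B -> C) f : (forall k, H (u k)) ->
  (forall e : R, 0 < e -> exists N : nat, forall p q : nat, (N <= p)%N -> (N <= q)%N ->
     sn2 ipH (u p - u q) < e) ->
  (forall z, ccvg (u ^~ z) (f z)) ->
  H f /\ (fun k => sn2 ipH (f - u k)) @ \oo --> (0 : R).
Proof.
move=> Hu cu uf; have [_ comp] := drury_hilbert.
have [|g Hg ug] := comp u Hu.
  move=> e e0; have [|N HN] := cu (e ^+ 2); first by rewrite exprn_gt0.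
  exists N => p q Np Nq; rewrite /ipnorm -/(sn2 ipH _).
  rewrite -[ltRHS](@ger0_norm _ e) ?(ltW e0)// -sqrtr_sqr ltr_sqrt ?exprn_gt0//.
  exact: HN.
have {}ug : (fun k => sn2 ipH (g - u k)) @ \oo --> (0 : R).
  have : (fun k => ipnorm H (u k - g) * ipnorm H (u k - g)) @ \oo --> (0 : R).
    by rewrite -[X in _ --> X](mulr0 0); exact: cvgM.
  rewrite (_ : (fun k => ipnorm H (u k - g) * _) = (fun k => sn2 ipH (g - u k)))//.
  apply/funext => k; rewrite -expr2 /ipnorm -/(sn2 ipH _).
  have Hs : H (u k - g) by exact: (sip_sub sip).
  by rewrite sqr_sqrtr ?(sn2_ge0 sip Hs)// -(sn2N sip Hs) opprB.
suff -> : f = g by [].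
apply/funext => z; apply: ccvg_unique (uf z) _.
exact: drury_eval.
Qed.

Lemma rotate_ball (u : C) w : normc u = 1 -> enorm (u *: uball_val w) < 1.
Proof. by move=> u1; rewrite enormZ u1 mul1r; exact: uball_lt1. Qed.

Definition rotb (u : C) (u1 : normc u = 1) w : B := UBall (rotate_ball w u1).

Section averaged_kernels.
Variables (k N : nat) (om : C) (w : B).
Hypothesis pom : N.-primitive_root om.
Hypothesis kN : (k < N)%N.

Lemma nc_root_pow (j : nat) : normc (om ^+ j) = 1.
Proof. by rewrite ncX (nc_prim_root pom) expr1n. Qed.

(* [x^k / (1 - x^N)] is the average of [w^(jk) / (1 - w^(-j) x)] over the [N]-th roots of
   unity, hence a finite combination of kernels converging to [x^k]. *)
Definition avg_kernel : B -> C :=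
  \sum_(j < N) (N%:R^-1 * om ^+ (j * k)) *: drury_kernel (rotb (nc_root_pow j) w).

Lemma avg_kernelH : H avg_kernel.
Proof.
by apply: (sip_sum sip) => j; apply: (sip_scale sip); exact: drury_kernelH.
Qed.

Let N0 : (N%:R : C) != 0.
Proof. by rewrite pnatr_eq0 -lt0n (leq_ltn_trans _ kN). Qed.

Lemma omM_conj (j : nat) : om ^+ j * (om ^+ j)^* = 1.
Proof. by rewrite -sqr_nc nc_root_pow expr1n. Qed.

Lemma cdot_rotb z j : cdot (uball_val z) (uball_val (rotb (nc_root_pow j) w)) =
  (om ^+ j)^* * cdot (uball_val z) (uball_val w).
Proof.
rewrite /= cdotC (_ : om ^+ j *: _ = om ^+ j *: uball_val w + 0) ?addr0//.
rewrite -[X in (cdot X _)^*]addr0 cdotDl /cdot [X in _ + X]big1; last first.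
  by move=> i _; rewrite mxE mul0r.
by rewrite addr0 cconjM -/(cdot _ _) -cdotC.
Qed.

(** All rotates [y] of [x] satisfy [y^N = x^N], so finite geometric sums bring the kernels to the
    common denominator [1 - x^N]; of the numerators the average keeps only [x^k]. *)
Lemma avg_kernelE z : avg_kernel z =
  cdot (uball_val z) (uball_val w) ^+ k / (1 - cdot (uball_val z) (uball_val w) ^+ N).
Proof.
set x := cdot _ _; have x1 : normc x < 1 by exact: nc_cdot_lt1.
have ne1 (y : C) : normc y < 1 -> 1 - y != 0.
  by move=> y1; rewrite subr_eq0; apply/eqP => e; rewrite -e normc1 ltxx in y1.
have xN : 1 - x ^+ N != 0.
  by apply: ne1; rewrite ncX exprn_ilt1 ?nc_ge0// -lt0n (leq_ltn_trans _ kN).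
have conjN j : ((om ^+ j)^*) ^+ N = 1.
  have : (om ^+ j) ^+ N = 1 by rewrite -exprM mulnC exprM (prim_expr_order pom) expr1n.
  move/(congr1 (fun y : C => y^*)); rewrite rmorph1 => <-.
  by rewrite -rmorphXn.
have conjE j i : (i < N)%N -> ((om ^+ j)^*) ^+ i = om ^+ (j * (N - i)).
  move=> iN; have c0 : (om ^+ j) ^+ i != 0.
    by rewrite -nc_eq0 ncX nc_root_pow expr1n oner_eq0.
  apply: (mulfI c0); rewrite -exprMn omM_conj expr1n exprM -exprD subnKC ?(ltnW iN)//.
  by rewrite -exprM mulnC exprM (prim_expr_order pom) expr1n.
rewrite /avg_kernel fct_sumE.
have termE (j : 'I_N) : ((N%:R^-1 * om ^+ (j * k)) *: drury_kernel (rotb (nc_root_pow j) w)) z =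
    \sum_(i < N) (N%:R^-1 * (1 - x ^+ N)^-1 * x ^+ i) * (om ^+ (j * (N - i)) * om ^+ (j * k)).
  rewrite /GRing.scale /= /drury_kernel cdot_rotb -/x.
  set y := (om ^+ j)^* * x.
  have y1 : normc y < 1 by rewrite ncM nc_conj nc_root_pow mul1r.
  have yN : y ^+ N = x ^+ N by rewrite exprMn conjN mul1r.
  have -> : (1 - y)^-1 = (\sum_(i < N) y ^+ i) / (1 - x ^+ N).
    apply: (mulfI (ne1 _ y1)); rewrite divff ?ne1// mulrA.
    have -> : (1 - y) * \sum_(i < N) y ^+ i = 1 - y ^+ N.
      by rewrite -opprB mulNr -subrX1 opprB.
    by rewrite yN divff.
  have scE (a b : C) : a *: (b : C^o) = a * b by [].
  rewrite scE mulr_suml mulr_sumr; apply: eq_bigr => i _.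
  rewrite /y exprMn conjE//; ring.
rewrite (eq_bigr _ (fun j _ => termE j)) exchange_big /=.
rewrite (eq_bigr (fun i : 'I_N => (N%:R^-1 * (1 - x ^+ N)^-1 * x ^+ i) *
   (N%:R * ((k %% N)%N == i)%:R))); last first.
  by move=> i _; rewrite -mulr_sumr root_avg.
rewrite (bigD1 (Ordinal kN))//= modn_small// eqxx big1 ?addr0; last first.
  move=> i ik; case: eqP => [e|_]; last by rewrite !mulr0.
  by case/eqP: ik; apply: val_inj.
by rewrite mulr1; move: (x ^+ k) (x ^+ N) xN => a b b1; field; rewrite N0 b1.
Qed.

Lemma ip_avg_kernel f : H f ->
  ipH f avg_kernel = N%:R^-1 * \sum_(j < N) (om ^+ (j * k))^* * f (rotb (nc_root_pow j) w).
Proof.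
move=> Hf; rewrite (sip_sumr sip) => [||//]; last first.
  by move=> j; apply: (sip_scale sip); exact: drury_kernelH.
rewrite mulr_sumr; apply: eq_bigr => j _.
rewrite (sipZr sip) ?reproducing//; last exact: drury_kernelH.
by rewrite cconjM mulrA; congr (_ * _ * _); rewrite rmorphV ?unitfE// rmorph_nat.
Qed.

Lemma ip_homog_avg_kernel i p : homog i p -> (i < N)%N ->
  ipH (poly_fun p) avg_kernel = (k == i)%:R * pev p (uball_val w).
Proof.
move=> hp iN; rewrite ip_avg_kernel//.
under eq_bigr do rewrite poly_funE /= (pev_homogZ _ _ hp) mulrA.
rewrite -mulr_suml mulrA; congr (_ * _).
have -> : \sum_(j < N) (om ^+ (j * k))^* * om ^+ j ^+ i =
    (\sum_(j < N) om ^+ (j * (N - i)) * om ^+ (j * k))^*.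
  rewrite cconj_sum; apply: eq_bigr => j _; rewrite cconjM mulrC; congr (_ * _).
  have c0 : (om ^+ (j * i))^* != 0.
    by rewrite -nc_eq0 nc_conj nc_root_pow oner_eq0.
  apply: (mulfI c0); rewrite -exprM mulrC omM_conj -cconjM -exprD -mulnDr.
  rewrite subnKC ?(ltnW iN)// mulnC exprM (prim_expr_order pom) expr1n.
  by rewrite rmorph1.
rewrite root_avg// cconjM !rmorph_nat modn_small// mulrA mulVf ?N0// mul1r.
by [].
Qed.

End averaged_kernels.

(** The bound is free of [N']. Hence all inner products in the expansion of [|u_p - u_q|^2] are
    close to [c^k], and the averages form a Cauchy sequence. *)
Lemma ip_avg_kernels k N (om : C) w (pom : N.-primitive_root om) N' (om' : C)
    (pom' : N'.-primitive_root om') (c := cdot (uball_val w) (uball_val w)) :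
  (k < N)%N -> (k < N')%N ->
  normc (ipH (avg_kernel k w pom) (avg_kernel k w pom') - c ^+ k) <=
    normc c ^+ N / (1 - normc c).
Proof.
move=> kN kN'; have c1 : normc c < 1 by exact: nc_cdot_lt1.
have u1 := nc_root_pow pom'.
have N'0 : (N'%:R : C) != 0 by rewrite pnatr_eq0 -lt0n (leq_ltn_trans _ kN').
rewrite ip_avg_kernel//; last exact: avg_kernelH.
have termE (j : 'I_N') : (om' ^+ (j * k))^* * avg_kernel k w pom (rotb (nc_root_pow pom' j) w) - c ^+ k =
    c ^+ k * ((om' ^+ j * c) ^+ N / (1 - (om' ^+ j * c) ^+ N)).
  rewrite avg_kernelE//=.
  have -> : cdot (om' ^+ j *: uball_val w) (uball_val w) = om' ^+ j * c.
    rewrite -[om' ^+ j *: _]addr0 cdotDl [X in _ + X](_ : _ = 0) ?addr0//.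
    by rewrite /cdot big1// => i _; rewrite mxE mul0r.
  set y := (om' ^+ j * c) ^+ N.
  have y1 : 1 - y != 0.
    rewrite subr_eq0; apply/eqP => /(congr1 (@normc R)).
    rewrite normc1 ncX ncM u1 mul1r => e.
    have : normc c ^+ N < 1 by rewrite exprn_ilt1 ?nc_ge0// -lt0n (leq_ltn_trans _ kN).
    by rewrite -e ltxx.
  rewrite exprMn -exprM !mulrA.
  have -> : (om' ^+ (j * k))^* * om' ^+ (j * k) = 1 by rewrite mulrC -sqr_nc u1 expr1n.
  by move: (c ^+ k) => ck; rewrite mul1r; field.
have -> : N'%:R^-1 * (\sum_(j < N') (om' ^+ (j * k))^* * avg_kernel k w pom (rotb (nc_root_pow pom' j) w))
    - c ^+ k =
    N'%:R^-1 * \sum_(j < N') (c ^+ k * ((om' ^+ j * c) ^+ N / (1 - (om' ^+ j * c) ^+ N))).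
  rewrite -(eq_bigr _ (fun j _ => termE j)) sumrB sumr_const card_ord mulrBr.
  by rewrite -[c ^+ k *+ N']mulr_natl mulKf.
rewrite ncM ncV nc_nat mulrC ler_pdivrMr ?ltr0n ?(leq_ltn_trans _ kN')//.
apply: le_trans (nc_sum _ _ _) _.
apply: (@le_trans _ _ (\sum_(j < N') normc c ^+ N / (1 - normc c))); last first.
  by rewrite sumr_const card_ord mulr_natr.
apply: ler_sum => j _; rewrite -[leRHS]mul1r ncM.
apply: ler_pM; rewrite ?nc_ge0//.
  by rewrite ncX exprn_ile1 ?nc_ge0 ?ltW.
have yc : normc (om' ^+ j * c) = normc c by rewrite ncM u1 mul1r.
by rewrite -yc; apply: nc_geom_tail; rewrite ?yc// (leq_ltn_trans _ kN).
Qed.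

(** Pairings with [u j] are known from the reproducing property. Norm convergence carries them over
    to [epoly k w], which pointwise convergence alone would not do. *)
Lemma epoly_approx k w : exists u : nat -> B -> C,
  [/\ forall j, H (u j), (fun j => sn2 ipH (poly_fun (epoly k w) - u j)) @ \oo --> (0 : R) &
      forall i p, homog i p -> exists J, forall j, (J <= j)%N ->
        ipH (poly_fun p) (u j) = (k == i)%:R * pev p (uball_val w)].
Proof.
pose N j := (j + k).+1; have kN j : (k < N j)%N by rewrite ltnS leq_addl.
pose pom j := svalP (cid (@prim_root_ex R (N j) (ltn0Sn _))).
pose u j := avg_kernel k w (pom j).
have Hu j : H (u j) by exact: avg_kernelH.
exists u; split=> //; last first.
  move=> i p hp; exists i => j ij; apply: ip_homog_avg_kernel => //.
  by rewrite ltnS (leq_trans ij)// leq_addr.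
set c := cdot (uball_val w) (uball_val w).
have c1 : normc c < 1 by exact: nc_cdot_lt1.
have geo (x : C) : normc x < 1 ->
    (fun j => normc x ^+ N j / (1 - normc x)) @ \oo --> (0 : R).
  move=> x1; rewrite -[X in _ --> X](mul0r (1 - normc x)^-1); apply: cvgMl.
  have := @cvg_expr R (normc x); rewrite ger0_norm ?nc_ge0// => /(_ x1).
  by rewrite -(cvg_shiftn k.+1); under eq_fun do rewrite addnS.
apply: (drury_cauchy Hu _ _).2 => [e e0|z].
  have e4 : 0 < e / 4 by rewrite divr_gt0.
  have /cvgrPdist_lt/(_ _ e4)[J _ HJ] := geo c c1.
  exists J => p q Jp Jq.
  have d i j : (J <= i)%N -> `|complex.Re (ipH (u i) (u j)) - complex.Re (c ^+ k)| < e / 4.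
    move=> Ji; rewrite -raddfB; apply: le_lt_trans (nc_Re _) _.
    apply: le_lt_trans (ip_avg_kernels w (pom i) (pom j) (kN i) (kN j)) _.
    have := HJ i Ji; rewrite /= sub0r normrN; apply: le_lt_trans; exact: ler_norm.
  rewrite /sn2 (sipBl sip)//; last exact: (sip_sub sip).
  rewrite !(sipBr sip)// !raddfB /=.
  have := d _ p Jp; have := d _ q Jp; have := d _ p Jq; have := d _ q Jq.
  rewrite !ltr_norml => /andP[? ?] /andP[? ?] /andP[? ?] /andP[? ?]; lra.
set x := cdot (uball_val z) (uball_val w).
have x1 : normc x < 1 by exact: nc_cdot_lt1.
apply: ccvg_squeeze (geo x x1) => j; rewrite /u avg_kernelE// -/x poly_funE pev_epoly -/x.
have xN : 1 - x ^+ N j != 0.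
  rewrite subr_eq0; apply/eqP => /(congr1 (@normc R)); rewrite normc1 ncX => e.
  by have := exprn_ilt1 (N j) (nc_ge0 x) x1; rewrite -e ltxx.
have -> : x ^+ k / (1 - x ^+ N j) - x ^+ k = x ^+ k * (x ^+ N j / (1 - x ^+ N j)).
  by move: xN; move: (x ^+ N j) (x ^+ k) => a b a1; field.
rewrite ncM -[leRHS]mul1r; apply: ler_pM; rewrite ?nc_ge0//; last exact: nc_geom_tail.
by rewrite ncX exprn_ile1 ?nc_ge0 ?ltW.
Qed.

Lemma ip_epoly i p k w : homog i p ->
  ipH (poly_fun p) (poly_fun (epoly k w)) = (k == i)%:R * pev p (uball_val w).
Proof.
move=> hp; have [u [Hu ul up]] := epoly_approx k w.
have [J HJ] := up _ _ hp.
have := sip_ccvgl sip Hu (H_poly (epoly k w)) (H_poly p) ul.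
rewrite (sipC sip)//; move/ccvg_conj; rewrite conjCK; move/ccvg_unique; apply.
apply: (@ccvg_eventually _ _ _ _ J) (ccvg_cst _) => j /HJ <-.
by rewrite -(sipC sip).
Qed.

(** The multinomial expansion of [epoly k w] turns the known pairing with it into an identity of
    polynomials in [w]; comparing coefficients yields the pairing with each monomial. *)
Lemma ip_drury_monomial i p m : homog i p ->
  ipH (poly_fun p) (poly_fun (mpolyX C m)) * (mdeg m)`!%:R =
    mcoeff m p * (mfact m)%:R.
Proof.
move=> hp; pose k := mdeg m.
pose a m' := ipH (poly_fun p) (poly_fun (mpolyX C m')).
suff: hpart k (fun m' => k`!%:R / (mfact m')%:R * a m') = (k == i)%:R *: p.
  move/(congr1 (mcoeff m)); rewrite coef_hpart// mcoeffZ.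
  have -> : (k == i)%:R * mcoeff m p = mcoeff m p.
    by case: eqP => [_|/eqP ki]; rewrite ?mul1r// (homog_coef0 hp ki) mulr0.
  by move=> <-; rewrite -/k -/(a m); field; exact: mfact_neq0.
apply: poly_fun_inj => w; rewrite pevZ pev_hpart -(ip_epoly _ _ hp).
rewrite (mpolyE (epoly k w)) poly_fun_sum (sip_sumr sip)//.
transitivity ((\sum_(m' <- degs k) mcoeff m' (epoly k w) * (a m')^*)^*); last first.
  rewrite -(sum_msupp_degs _ (@homog_epoly _ _ k w)) cconj_sum; apply: eq_bigr => m' _.
  by rewrite poly_funZ (sipZr sip)// cconjM conjCK.
rewrite cconj_sum big_seq [RHS]big_seq; apply: eq_bigr => m'.
rewrite mem_degs => /eqP m'k; rewrite cconjM conjCK.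
have : mcoeff m' (epoly k w) = k`!%:R * (monomial m' (uball_val w))^* / (mfact m')%:R.
  by rewrite -(coef_epoly w m'k) mulfK// mfact_neq0.
move=> ->; rewrite !cconjM conjCK rmorphV ?unitfE ?mfact_neq0// !rmorph_nat; ring.
Qed.

Lemma ip_drury_homog k p q : homog k p ->
  ipH (poly_fun p) (poly_fun q) = fischer p q / k`!%:R.
Proof.
move=> hp; apply: (mulIf (@factC_neq0 R k)); rewrite divfK ?factC_neq0//.
rewrite {1}(mpolyE q) poly_fun_sum (sip_sumr sip)// mulr_suml /fischer.
transitivity (\sum_(m <- msupp q) (mcoeff m p * (mfact m)%:R) * (mcoeff m q)^*).
  apply: eq_bigr => m _; rewrite poly_funZ (sipZr sip)// mulrAC -mulrA mulrC.
  have [mk|mk] := eqVneq (mdeg m) k.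
    by rewrite -(ip_drury_monomial m hp) mk; ring.
  have := ip_drury_monomial m hp; rewrite (homog_coef0 hp mk) !mul0r => /eqP.
  by rewrite mulf_eq0 (negPf (factC_neq0 _)) orbF => /eqP ->; rewrite !mulr0 mul0r.
pose F m := mcoeff m p * ((mcoeff m q)^* * (mfact m)%:R).
transitivity (\sum_(m <- msupp q) F m).
  by apply: eq_bigr => m _; rewrite /F; ring.
rewrite (bigID (fun m => m \in msupp p)) /= [X in _ + X]big1 ?addr0; last first.
  by move=> m mp; rewrite /F (memN_msupp_eq0 mp) mul0r.
rewrite [RHS](bigID (fun m => m \in msupp q)) /= [X in _ = _ + X]big1 ?addr0; last first.
  by move=> m mq; rewrite (memN_msupp_eq0 mq) rmorph0 mul0r mulr0.
rewrite -big_filter -[RHS]big_filter; apply: perm_big.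
apply: uniq_perm; rewrite ?filter_uniq ?msupp_uniq// => m.
by rewrite !mem_filter andbC.
Qed.

Lemma drury_orth (p : nat -> mpoly n C) j k : (forall k, homog k (p k)) -> j != k ->
  ipH (poly_fun (p j)) (poly_fun (p k)) = 0.
Proof.
move=> hp jk; rewrite (ip_drury_homog _ (hp j)) /fischer big_seq big1 ?mul0r// => m mp.
by rewrite (homog_coef0 (hp k)) ?rmorph0 ?mul0r ?mulr0// (hp j _ mp).
Qed.

(** The squared norm of the kernel is its value at [w], a full geometric sum in [s = |w|^2], and the
    equality in [bessel] leaves exactly [s^K / (1 - s)] as the error. *)
Lemma kernel_series w :
  (fun K => sn2 ipH (drury_kernel w - \sum_(k < K) poly_fun (epoly k (uball_val w)))) @ \oo
    --> (0 : R).
Proof.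
pose s := sn2 (@cdot R n) (uball_val w).
have cE : cdot (uball_val w) (uball_val w) = s%:C%C by rewrite (sn2E cdot_semi_ip).
have s0 : 0 <= s by exact: (sn2_ge0 cdot_semi_ip).
have s1 : s < 1 by have := nc_cdot_lt1 w w; rewrite cE nc_real ger0_norm.
have he k : homog k (epoly k (uball_val w)) by exact: homog_epoly.
have eE k : poly_fun (epoly k (uball_val w)) w = (s ^+ k)%:C%C.
  by rewrite poly_funE pev_epoly cE rmorphXn.
have eeE k : ipH (poly_fun (epoly k (uball_val w))) (poly_fun (epoly k (uball_val w))) =
    (s ^+ k)%:C%C by rewrite (ip_epoly _ _ (he k)) eqxx mul1r -eE.
have sK : s != 1 by rewrite lt_eqF.
have E K : sn2 ipH (drury_kernel w - \sum_(k < K) poly_fun (epoly k (uball_val w))) =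
    s ^+ K / (1 - s).
  rewrite (@bessel _ _ _ _ sip _ (fun k => H_poly (epoly k (uball_val w))))//; last 3 first.
  - by move=> j k jk; exact: (drury_orth he).
  - exact: drury_kernelH.
  - move=> k; rewrite (sipC sip)//; last exact: drury_kernelH.
    by rewrite reproducing// eE eeE cconj_real.
  rewrite (eq_bigr (fun k : 'I_K => s ^+ k)); last by move=> k _; rewrite /sn2 eeE.
  rewrite /sn2 reproducing; last exact: drury_kernelH.
  rewrite /drury_kernel cE.
  have -> : (1 - s%:C%C)^-1 = ((1 - s)^-1)%:C%C :> C.
    by rewrite -[1 : C]/((1 : R)%:C%C) -rmorphB fmorphV.
  have s10 : 1 - s != 0 by rewrite subr_eq0 eq_sym.
  apply: (mulIf s10); rewrite /= mulrBl mulVf// divfK// [_ * (1 - s)]mulrC.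
  by rewrite -[1 - s]opprB mulNr -subrX1; ring.
have -> : 0 = 0 / (1 - s) :> R by rewrite mul0r.
rewrite (eq_cvg _ _ E); apply: cvgMl.
by apply: cvg_expr; rewrite ger0_norm.
Qed.

Lemma kernel_expands w : expands (drury_kernel w) (epoly ^~ (uball_val w)).
Proof.
split=> [k|z]; first exact: homog_epoly.
have Hs K : H (\sum_(k < K) poly_fun (epoly k (uball_val w))).
  by apply: (sip_sum sip).
have := drury_eval z Hs (drury_kernelH w) (kernel_series w).
by apply: (@ccvg_eventually _ _ _ _ 0) => K _; rewrite fct_sumE.
Qed.

(** The orthogonal projection to degree [k]: the coefficients are [<f, z^m> / |z^m|^2], where
    [|z^m|^2 = m! / k!] in the Drury space. *)
Definition dcomp f k : mpoly n C :=
  hpart k (fun m => k`!%:R / (mfact m)%:R * ipH f (poly_fun (mpolyX C m))).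

Lemma homog_dcomp f k : homog k (dcomp f k). Proof. exact: homog_hpart. Qed.

Lemma ip_dcomp f k q : H f -> homog k q ->
  ipH f (poly_fun q) = ipH (poly_fun (dcomp f k)) (poly_fun q).
Proof.
move=> Hf hq; rewrite (mpolyE q) poly_fun_sum !(sip_sumr sip)//.
rewrite big_seq [RHS]big_seq; apply: eq_bigr => m mq.
rewrite poly_funZ !(sipZr sip)//; congr (_ * _); have mk := hq _ mq.
apply: (mulIf (@factC_neq0 R k)).
rewrite -[X in _ = _ * X%:R](congr1 (fun j => j`!) mk).
rewrite (ip_drury_monomial _ (@homog_dcomp f k)) coef_hpart// mulrAC divfK ?mfact_neq0//.
exact: mulrC.
Qed.

Lemma dcomp_pev f k w : H f ->
  pev (dcomp f k) (uball_val w) = ipH f (poly_fun (epoly k (uball_val w))).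
Proof.
move=> Hf; rewrite (ip_dcomp Hf (@homog_epoly _ _ k _)).
by rewrite (ip_epoly _ _ (@homog_dcomp f k)) eqxx mul1r.
Qed.

(** Pairing [f] with the norm convergent expansion of the kernel at [w] evaluates [f] at [w] degree
    by degree. *)
Lemma dcomp_expands f : H f -> expands f (dcomp f).
Proof.
move=> Hf; split=> [k|w]; first exact: homog_dcomp.
have Hs K : H (\sum_(k < K) poly_fun (epoly k (uball_val w))).
  by apply: (sip_sum sip).
have := sip_ccvgl sip Hs (drury_kernelH w) Hf (kernel_series w).
move/ccvg_conj; rewrite -(sipC sip)//; last exact: drury_kernelH.
rewrite reproducing//; apply: (@ccvg_eventually _ _ _ _ 0) => K _.
rewrite -(sipC sip)// (sip_sumr sip)//.
by apply: eq_bigr => k _; rewrite dcomp_pev.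
Qed.

Lemma dcomp_bounded f : H f ->
  bounded_sums (fun k => sn2 ipH (poly_fun (dcomp f k))) (sn2 ipH f).
Proof.
move=> Hf K; rewrite -subr_ge0.
rewrite -(@bessel _ _ _ _ sip _ (fun k => H_poly (dcomp f k)))//.
- by apply: (sn2_ge0 sip); apply: (sip_sub sip) => //; exact: (sip_sum sip).
- by move=> j k jk; apply: drury_orth => // i; exact: homog_dcomp.
- by move=> k; rewrite (ip_dcomp Hf (@homog_dcomp f k)).
Qed.

Lemma drury_series_ex (p : nat -> mpoly n C) (M : R) : (forall k, homog k (p k)) ->
  bounded_sums (fun k => sn2 ipH (poly_fun (p k))) M ->
  exists f, [/\ H f, expands f p &
    (fun K => sn2 ipH (f - \sum_(k < K) poly_fun (p k))) @ \oo --> (0 : R)].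
Proof.
move=> hp bp.
have [g Hg gp] := hilbert_orth_series drury_hilbert (fun k => H_poly (p k))
  (fun j k => drury_orth hp (k := k)) bp.
exists g; split=> //; split=> // z.
have Hs K : H (\sum_(k < K) poly_fun (p k)) by apply: (sip_sum sip).
have := drury_eval z Hs Hg gp.
by apply: (@ccvg_eventually _ _ _ _ 0) => K _; rewrite fct_sumE.
Qed.

Lemma drury_series f (p : nat -> mpoly n C) (M : R) : expands f p ->
  bounded_sums (fun k => sn2 ipH (poly_fun (p k))) M ->
  H f /\ (fun K => sn2 ipH (f - \sum_(k < K) poly_fun (p k))) @ \oo --> (0 : R).
Proof.
move=> [hp fp] bp; have [g [Hg [_ gp] gs]] := drury_series_ex hp bp.
suff -> : f = g by [].
by apply/funext => z; exact: csum_unique (fp z) (gp z).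
Qed.

Lemma drury_ip_csum f (p : nat -> mpoly n C) (M : R) g : expands f p ->
  bounded_sums (fun k => sn2 ipH (poly_fun (p k))) M -> H g ->
  csum (fun k => ipH (poly_fun (p k)) (poly_fun (dcomp g k))) (ipH f g).
Proof.
move=> fp bp Hg; have [Hf fs] := drury_series fp bp.
have Hs K : H (\sum_(k < K) poly_fun (p k)) by apply: (sip_sum sip).
have := sip_ccvgl sip Hs Hf Hg fs.
apply: (@ccvg_eventually _ _ _ _ 0) => K _; rewrite (sip_suml sip)//.
apply: eq_bigr => k _; have [hp _] := fp.
by rewrite (sipC sip)// (ip_dcomp Hg (hp k)) -(sipC sip).
Qed.

Lemma dcomp_unique f (p : nat -> mpoly n C) (M : R) : expands f p ->
  bounded_sums (fun k => sn2 ipH (poly_fun (p k))) M -> dcomp f = p.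
Proof.
move=> fp bp; have [Hf fs] := drury_series fp bp; have [hp _] := fp.
apply/funext => k; apply: poly_fun_inj => z.
rewrite dcomp_pev// -[RHS]mul1r; have := ip_epoly k z (hp k); rewrite eqxx => <-.
have Hs K : H (\sum_(k < K) poly_fun (p k)) by apply: (sip_sum sip).
apply: ccvg_unique (sip_ccvgl sip Hs Hf (H_poly _) fs) _.
apply: (@ccvg_eventually _ _ _ _ k.+1) (ccvg_cst _) => K kK; rewrite (sip_suml sip)//.
rewrite (bigD1 (Ordinal kK))//= big1 ?addr0// => i ik.
rewrite (ip_epoly _ _ (hp i)); case: eqP => [ki|_]; last by rewrite mul0r.
by case/eqP: ik; apply: val_inj.
Qed.

End drury_space.

(** * The Euler operator and the Fantappie transform *)

Section euler_eigenvalues.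
Context {R : realType} {n : nat}.
Local Notation C := R[i].
Local Notation B := (uball R n).
Local Notation poly := (mpoly n C).
Implicit Types (p q : poly).

(** The eigenvalue [lam_k]. *)
Definition eul (k : nat) : nat := \prod_(j <- iota 1 n) (j + k).

Lemma eul_gt0 k : (0 < eul k)%N.
Proof.
rewrite /eul big_seq prodn_cond_gt0// => j; rewrite mem_iota => /andP[j1 _].
by rewrite addn_gt0 j1.
Qed.

Lemma eul_fact k : (eul k * k`! = (k + n)`!)%N.
Proof.
rewrite /eul; elim: n => [|m IH]; first by rewrite big_nil mul1n addn0.
rewrite -[m.+1]addn1 iotaD big_cat/= big_seq1 addnA addn1 factS -IH.
by rewrite mulnAC [LHS]mulnC add1n addSn [(m + k)%N]addnC.
Qed.

Lemma eul_bin k : (eul k = n`! * 'C(k + n, n))%N.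
Proof.
apply/eqP; rewrite -(eqn_pmul2r (fact_gt0 k)) eul_fact.
by rewrite -(@bin_fact (k + n) n) ?leq_addl// addnK mulnCA mulnA [(n`! * _)%N]mulnC.
Qed.

Lemma eulC_neq0 k : ((eul k)%:R : C) != 0.
Proof. by rewrite pnatr_eq0 -lt0n eul_gt0. Qed.

Lemma eulR_gt0 k : 0 < (eul k)%:R :> R. Proof. by rewrite ltr0n eul_gt0. Qed.

(* One term of the binomial expansion of [(r + (1 - r)) ^+ (k + n)]. *)
Lemma eul_growth (r : R) : 0 <= r < 1 ->
  forall k, r ^+ k * (eul k)%:R <= n`!%:R / (1 - r) ^+ n.
Proof.
move=> /andP[r0 r1] k; have p1 : 0 < 1 - r by lra.
rewrite ler_pdivlMr ?exprn_gt0// eul_bin natrM.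
suff : r ^+ k * (1 - r) ^+ n * 'C(k + n, n)%:R <= 1.
  move=> h; rewrite -[leRHS]mulr1.
  rewrite (_ : _ * (1 - r) ^+ n = n`!%:R * (r ^+ k * (1 - r) ^+ n * 'C(k + n, n)%:R)); last first.
    by move: (r ^+ k) ((1 - r) ^+ n) => a b; ring.
  by rewrite ler_wpM2l.
have kn : (n < (k + n).+1)%N by rewrite ltnS leq_addl.
have := @exprDn _ r (1 - r) (k + n); rewrite [r + _]addrC subrK expr1n => e.
rewrite [leRHS]e (bigD1 (Ordinal kn))//= addnK mulr_natr lerDl sumr_ge0// => i _.
by rewrite mulrn_wge0// mulr_ge0// exprn_ge0// ltW.
Qed.

Lemma euler_field_X m : \sum_(i < n) mpolyX C (mnm1 i) * mderiv i (mpolyX C m) =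
  (mdeg m)%:R *: mpolyX C m.
Proof.
rewrite mdegE natr_sum scaler_suml; apply: eq_bigr => i _.
rewrite mderivX -scalerAr -mpolyXD.
have [->|mi] := eqVneq (m i) 0%N; first by rewrite !scale0r.
by rewrite addmC submK// lep1mP.
Qed.

Lemma euler_factor_homog j k q : homog k q -> euler_factor j q = (j + k)%:R *: q.
Proof.
move=> hq; rewrite /euler_factor natrD scalerDl scaler_nat; congr (_ + _).
rewrite {1}(mpolyE q); under eq_bigr do rewrite raddf_sum mulr_sumr.
rewrite exchange_big /= [in RHS](mpolyE q) scaler_sumr big_seq [RHS]big_seq.
apply: eq_bigr => m /hq <-.
under eq_bigr do rewrite /= mderivZ -scalerAr.
by rewrite -scaler_sumr euler_field_X !scalerA mulrC.
Qed.

Lemma euler_homog k q : homog k q -> euler q = (eul k)%:R *: q.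
Proof.
move=> hq; rewrite /euler /eul; elim: (iota 1 n) => [|j s IH] /=.
  by rewrite big_nil scale1r.
rewrite IH (euler_factor_homog _ (homogZ hq)) scalerA big_cons.
by rewrite natrM.
Qed.

End euler_eigenvalues.

Section ball_series.
Context {R : realType} {n : nat}.
Local Notation C := R[i].
Local Notation B := (uball R n).

Lemma enormD (x y : 'rV[C]_n) : enorm (x + y) <= enorm x + enorm y.
Proof.
have sE z : enorm z ^+ 2 = sn2 (@cdot R n) z.
  by rewrite /enorm sqr_sqrtr//; exact: (sn2_ge0 cdot_semi_ip).
rewrite -(ler_pXn2r (n := 2))// ?nnegrE ?addr_ge0 ?enorm_ge0// sqrrD !sE /sn2.
rewrite !(sipDl cdot_semi_ip)// !(sipDr cdot_semi_ip)// !raddfD /=.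
have := nc_cdot x y; have := nc_cdot y x.
have := nc_Re (cdot x y); have := nc_Re (cdot y x).
rewrite !ler_norml => /andP[_ ?] /andP[_ ?] ? ?; lra.
Qed.

Lemma scale_inv_ball (z : B) : exists r (zr : B), [/\ 0 < r, r < 1 :> R &
  uball_val z = (r%:C)%C *: uball_val zr].
Proof.
have [t t1 tz] := scale_ball z; have t0 : 0 < t by lra.
exists t^-1, (UBall tz); split; [by rewrite invr_gt0|by rewrite invf_lt1|].
by rewrite /= scalerA -rmorphM mulVf ?gt_eqF// scale1r.
Qed.

Lemma expandsZ f (p : nat -> mpoly n C) (r : R) (z w : B) :
  expands f (fun k => ((r ^+ k)%:C)%C *: p k) ->
  (forall k, homog k (p k)) -> uball_val z = (r%:C)%C *: uball_val w ->
  csum (fun k => pev (p k) (uball_val z)) (f w).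
Proof.
move=> [_ fp] hp ->; have := fp w.
apply: (@ccvg_eventually _ _ _ _ 0) => K _; apply: eq_bigr => k _.
by rewrite pevZ (pev_homogZ _ _ (hp k)) rmorphXn.
Qed.

(* Near [a] the sum agrees with a dilate [z |-> g (r^-1 z)] of an analytic function. *)
Lemma dilates_analytic f (p : nat -> mpoly n C) : expands f p ->
  (forall r : R, 0 < r < 1 -> exists2 g, analytic g &
     expands g (fun k => ((r ^+ k)%:C)%C *: p k)) ->
  analytic f.
Proof.
move=> [hp fp] dil a; have [r [ar [r0 r1 aE]]] := scale_inv_ball a.
have [|g ga gp] := dil r; first by rewrite r0.
have [s [c [s0 Hc]]] := ga ar.
have d0 : 0 < 1 - enorm (uball_val ar) by have := uball_lt1 ar; lra.
(* The second bound keeps the rescaled point [v] in the ball. Dividing by [r] magnifies distances,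
   whence the radius [r * d] and the factors [r^-1] in the coefficients. *)
pose d := Num.min s (1 - enorm (uball_val ar)).
have d00 : 0 < d by rewrite lt_min s0.
exists (r * d), (fun m => c m * ((r^-1)%:C)%C ^+ mdeg m); split; first exact: mulr_gt0.
move=> z za; pose v := (r^-1)%:C%C *: uball_val z.
have vE : v - uball_val ar = (r^-1)%:C%C *: (uball_val z - uball_val a).
  by rewrite scalerBr aE scalerA -rmorphM mulVf ?gt_eqF// scale1r.
have vd : enorm (v - uball_val ar) < d.
  rewrite vE enormZ nc_real gtr0_norm ?invr_gt0// mulrC ltr_pdivrMr//.
  by rewrite mulrC.
have vB : enorm v < 1.
  have -> : v = (v - uball_val ar) + uball_val ar by rewrite subrK.
  apply: le_lt_trans (enormD _ _) _; move: vd; rewrite lt_min => /andP[_]; lra.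
have zE : uball_val z = (r%:C)%C *: uball_val (UBall vB).
  by rewrite /= scalerA -rmorphM mulfV ?gt_eqF// scale1r.
have -> : f z = g (UBall vB) by exact: csum_unique (fp z) (expandsZ gp hp zE).
have := Hc (UBall vB); rewrite /= vE => /(_ _).
have vs : enorm ((r^-1)%:C%C *: (uball_val z - uball_val a)) < s.
  by rewrite -vE; move: vd; rewrite lt_min => /andP[].
move=> /(_ vs) h e e0; have [F0 HF] := h e e0; exists F0 => F /HF.
by congr (normc (_ - _) < _); apply: eq_bigr => m _; rewrite monomialZ mulrA.
Qed.

End ball_series.

Lemma cconjV {R : realType} (x : R[i]) : (x^-1)^* = (x^*)^-1.
Proof. exact: fmorphV. Qed.

Section fantappie_drury.
Context {R : realType} {n : nat}.
Local Notation C := R[i].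
Local Notation B := (uball R n).
Variable H : ip_space (B -> C).
Hypothesis drury_H : is_drury H.
Hypothesis H_poly : forall p, H (poly_fun p).
Local Notation ipH := (ip H).
Local Notation ipA := (ip (bergman R n)).
Implicit Types (f g : B -> C) (z w : B).
Local Notation sip := (drury_semi_ip drury_H).

Lemma ip_drury_bergman k p q : homog k p ->
  ipH (poly_fun p) (poly_fun q) = (eul (n := n) k)%:R * ipA (poly_fun p) (poly_fun q).
Proof.
move=> hp; rewrite (ip_drury_homog drury_H H_poly _ hp) (ip_bergman_homog _ hp).
rewrite -eul_fact natrM; field.
by rewrite eulC_neq0 factC_neq0.
Qed.

Lemma sn2_drury_bergman k p : homog k p ->
  sn2 ipH (poly_fun p) = (eul (n := n) k)%:R * sn2 ipA (poly_fun p).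
Proof.
by move=> hp; rewrite /sn2 (ip_drury_bergman _ hp) !mulr_natl raddfMn.
Qed.

(** As [1 <= eul k], every component is at most as large in the Bergman norm as in the Drury
    norm. *)
Lemma drury_L2B f : H f -> L2B f.
Proof.
move=> Hf; apply: (expands_L2B (dcomp_expands drury_H H_poly Hf) (M := sn2 ipH f)) => K.
apply: le_trans (dcomp_bounded drury_H H_poly Hf K); apply: ler_sum => k _.
rewrite (sn2_drury_bergman (@homog_dcomp _ _ H f k)) ler_peMl ?ler1n ?eul_gt0//.
by apply: (sn2_ge0 bergman_semi_ip); exact: L2B_poly.
Qed.

Lemma bergman_expands f : bergman R n f -> L2B f /\ exists p, expands f p.
Proof.
move=> [af sf]; have [p fp] := analytic_expands af.
by split; [split; [exact: expands_cmeas fp|exact: sf]|exists p].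
Qed.

Lemma fantappie_ip f z : fantappie f z = ipA f (drury_kernel z).
Proof.
congr (ball_int _); apply/funext => w; congr (_ * _).
by rewrite /drury_kernel cconjV cconjB rmorph1 -cdotC.
Qed.

Section transform.
Variables (f : B -> C) (p : nat -> mpoly n C).
Hypotheses (fp : expands f p) (lf : L2B f).

Let q k := ((eul (n := n) k)%:R)^-1 *: p k.

(** The transform at [z] is the Bergman pairing with the kernel, whose component of degree [k] is
    [epoly k z]. In [H] the pairing with [epoly k z] evaluates at [z]; in the Bergman space it is
    smaller by the factor [eul k]. *)
Lemma fantappie_expands : expands (fantappie f) q.
Proof.
have hp := fp.1; split=> [k|z]; first exact: homogZ.
rewrite fantappie_ip.
have := expands_ip_csum fp lf (kernel_expands drury_H H_poly z)
  (drury_L2B (drury_kernelH drury_H z)).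
apply: (@ccvg_eventually _ _ _ _ 0) => K _; apply: eq_bigr => k _.
rewrite pevZ -[pev _ _]mul1r; have := ip_epoly drury_H H_poly k z (hp k).
by rewrite eqxx => <-; rewrite (ip_drury_bergman _ (hp k)) mulKf// eulC_neq0.
Qed.

Lemma fantappie_bounded : bounded_sums (fun k => sn2 ipH (poly_fun (q k))) (sn2 ipA f).
Proof.
have hp := fp.1; move=> K; apply: le_trans (expands_bounded fp lf K).
apply: ler_sum => k _; rewrite /q poly_funZ (sn2Z sip)// ncV nc_nat.
have e1 : 1 <= (eul (n := n) k)%:R :> R by rewrite ler1n eul_gt0.
rewrite (sn2_drury_bergman (hp k)) mulrA ler_piMl//.
  by apply: (sn2_ge0 bergman_semi_ip); exact: L2B_poly.
by rewrite expr2 -mulrA mulVf ?mulr1 ?invf_le1 ?gt_eqF// (lt_le_trans _ e1).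
Qed.

Lemma fantappieH : H (fantappie f).
Proof. exact: (drury_series drury_H H_poly fantappie_expands fantappie_bounded).1. Qed.

Lemma dcomp_fantappie : dcomp H (fantappie f) = q.
Proof. exact: (dcomp_unique drury_H H_poly fantappie_expands fantappie_bounded). Qed.

Lemma fantappie_adjoint g : H g -> ipH (fantappie f) g = ipA f g.
Proof.
move=> Hg; apply: csum_unique (drury_ip_csum drury_H H_poly fantappie_expands fantappie_bounded Hg) _.
have := expands_ip_csum fp lf (dcomp_expands drury_H H_poly Hg) (drury_L2B Hg).
apply: (@ccvg_eventually _ _ _ _ 0) => K _; apply: eq_bigr => k _.
rewrite poly_funZ (sipZl sip)// (ip_drury_bergman _ (fp.1 k)) mulKf//.
exact: eulC_neq0.
Qed.

End transform.

End fantappie_drury.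

(** * The square root of the Euler operator and the transform *)

Section euler_square_root.
Context {R : realType} {n : nat}.
Local Notation C := R[i].
Local Notation B := (uball R n).
Variables (H : ip_space (B -> C)) (M S : operator (B -> C)).
Hypotheses (drury_H : is_drury H) (selfadj_M : self_adjoint H M)
  (euler_M : extends_euler M) (sqrt_M : is_sqrt_op H M S).
Local Notation ipH := (ip H).
Local Notation ipA := (ip (bergman R n)).
Implicit Types (f g : B -> C) (z w : B).
Local Notation sip := (drury_semi_ip drury_H).

Lemma dom_poly p : dom M (poly_fun p). Proof. by case: (euler_M p). Qed.

Lemma drury_poly p : H (poly_fun p).
Proof. by case: selfadj_M => -[domH _ _ _ _] _; apply: domH; exact: dom_poly. Qed.

Local Notation HP := drury_poly.

Lemma selfadj_sym (T : operator (B -> C)) f g : self_adjoint H T -> dom T f -> dom T g ->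
  ipH (T f) g = ipH f (T g).
Proof.
move=> [_ adj] Tf Tg; have [_ /(_ (conj Tg erefl))] := adj g (T g).
by move=> [_ _ ->].
Qed.

Lemma M_homog k p : homog k p -> M (poly_fun p) = (eul (n := n) k)%:R *: poly_fun p.
Proof.
by move=> hp; have [_ ->] := euler_M p; rewrite (euler_homog hp) poly_funZ.
Qed.

Definition seul k : C := ((Num.sqrt (eul (n := n) k)%:R : R)%:C)%C.

Lemma seul_gt0 k : 0 < Num.sqrt (eul (n := n) k)%:R :> R.
Proof. by rewrite sqrtr_gt0 eulR_gt0. Qed.

Lemma seul_neq0 k : seul k != 0.
Proof. by rewrite -nc_eq0 nc_real normr_eq0 gt_eqF// seul_gt0. Qed.

Lemma seul_conj k : (seul k)^* = seul k. Proof. exact: cconj_real. Qed.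

Lemma seul_sqr k : seul k * seul k = (eul (n := n) k)%:R.
Proof. by rewrite -rmorphM -expr2 sqr_sqrtr ?ler0n// rmorph_nat. Qed.

Lemma S_sa : self_adjoint H S. Proof. by case: sqrt_M. Qed.

Lemma domSH f : dom S f -> H f. Proof. by case: S_sa => -[+ _ _ _ _] _; exact. Qed.

Lemma SH f : dom S f -> H (S f). Proof. by case: S_sa => -[_ _ + _ _] _; exact. Qed.

(* [u = S p - mu p] satisfies [S u = - mu u], so positivity of [S] forces [u = 0]. *)
Lemma S_homog k p : homog k p -> dom S (poly_fun p) /\ S (poly_fun p) = seul k *: poly_fun p.
Proof.
move=> hp; have [_ posS domMS SSM] := sqrt_M.
have [Sp SSp] := (domMS _).1 (dom_poly p).
have [[_ [S0 Slin] _ linS _] _] := S_sa; split=> //.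
have Su : dom S (- seul k *: poly_fun p + S (poly_fun p)) by exact: Slin.
set u := - seul k *: poly_fun p + S (poly_fun p) in Su.
have SuE : S u = - seul k *: u.
  rewrite linS// (SSM _ (dom_poly p)) (M_homog hp) /u scalerDr scalerA mulrNN seul_sqr.
  by rewrite addrC.
have Hu := domSH Su.
have [[[_ _ _ pos] _] _ _ _] := drury_H.
have u0 : u = 0.
  apply/eqP/negPn/negP => un; have up := pos u Hu un; have := posS _ Su.
  have sup : 0 < seul k * ipH u u by rewrite mulr_gt0// ltcR seul_gt0.
  by rewrite SuE (sipZl sip)// mulNr oppr_ge0 => /(lt_le_trans sup); rewrite ltxx.
by apply/eqP; rewrite -subr_eq0 addrC -scaleNr -/u u0.
Qed.

(** Components are pairings with the eigenvectors [epoly k w], and the symmetric [S] can be moved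
    onto them. *)
Lemma dcomp_S f k : dom S f -> dcomp H (S f) k = seul k *: dcomp H f k.
Proof.
move=> Sf; have Hf := domSH Sf; have HSf := SH Sf; apply: poly_fun_inj => w.
rewrite pevZ !(dcomp_pev drury_H HP)//.
have [Se SeE] := S_homog (@homog_epoly _ _ k (uball_val w)).
rewrite (selfadj_sym S_sa Sf Se) SeE (sipZr sip) ?seul_conj//.
exact: HP.
Qed.

Lemma M_fantappie f : bergman R n f -> dom M (fantappie f) -> M (fantappie f) = f.
Proof.
move=> /bergman_expands[lf [p fp]] MFf.
have HM : H (M (fantappie f)) by case: selfadj_M => -[_ _ + _ _] _; exact.
have HF := fantappieH drury_H HP fp lf.
apply/funext => z; apply: csum_unique ((dcomp_expands drury_H HP HM).2 z) _.
apply: (@ccvg_eventually _ _ _ _ 0) (fp.2 z) => K _; apply: eq_bigr => k _.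
have he := @homog_epoly _ _ k (uball_val z).
rewrite (dcomp_pev drury_H HP)// (selfadj_sym selfadj_M MFf (dom_poly _)) (M_homog he).
rewrite (sipZr sip)//; last exact: HP.
rewrite rmorph_nat -(dcomp_pev drury_H HP)// (dcomp_fantappie drury_H HP fp lf) pevZ.
by rewrite mulVKf// eulC_neq0.
Qed.

Section transform.
Variables (f : B -> C) (p : nat -> mpoly n C).
Hypotheses (fp : expands f p) (lf : L2B f).

(** The candidate [v] for the value of [S] has the components [p_k] divided by [sqrt lam_k], and it
    exists in [H] because its squared norms by degree are those of [f] in the Bergman space. Since
    [S] is its own adjoint, [<S u, F f> = <u, v>] for all [u] in [dom S] gives both membership and
    value. *)
Lemma sqrt_fantappie : dom S (fantappie f) /\
  exists M', expands (S (fantappie f)) (fun k => (seul k)^-1 *: p k) /\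
   bounded_sums (fun k => sn2 ipH (poly_fun ((seul k)^-1 *: p k))) M'.
Proof.
have hp := fp.1; have hq k : homog k ((seul k)^-1 *: p k) by exact: homogZ.
have bq : bounded_sums (fun k => sn2 ipH (poly_fun ((seul k)^-1 *: p k))) (sn2 ipA f).
  move=> K; apply: le_trans (expands_bounded fp lf K).
  apply: ler_sum => k _; rewrite poly_funZ (sn2Z sip); last exact: HP.
  rewrite (sn2_drury_bergman drury_H HP (hp k)) ncV nc_real gtr0_norm ?seul_gt0//.
  by rewrite mulrA exprVn sqr_sqrtr ?ler0n// mulVf ?mul1r// gt_eqF ?eulR_gt0.
have [v [Hv vq _]] := drury_series_ex drury_H HP hq bq.
suff [SF SE] : dom S (fantappie f) /\ S (fantappie f) = v.
  by split=> //; exists (sn2 ipA f); rewrite SE.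
have [_ adj] := S_sa; apply/adj.
have HF := fantappieH drury_H HP fp lf; split=> // u Su; have Hu := domSH Su.
rewrite (sipC sip)//; last exact: SH.
rewrite [RHS](sipC sip)//; congr (_^*).
have := drury_ip_csum drury_H HP vq bq Hu; apply: csum_unique.
have := drury_ip_csum drury_H HP (fantappie_expands drury_H HP fp lf)
  (fantappie_bounded drury_H HP fp lf) (SH Su).
apply: (@ccvg_eventually _ _ _ _ 0) => K _; apply: eq_bigr => k _.
rewrite dcomp_S// !poly_funZ !(sipZl sip) ?(sipZr sip) ?seul_conj//; try exact: HP.
  rewrite -seul_sqr; have := seul_neq0 k; move: (seul k) => s s0; field.
  exact: s0.
by apply: (sip_scale sip); exact: HP.
Qed.

End transform.

Lemma fantappie_isometry f g : bergman R n f -> bergman R n g ->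
  ipH (S (fantappie f)) (S (fantappie g)) = ipA f g.
Proof.
move=> /bergman_expands[lf [p fp]] /bergman_expands[lg [q gq]].
have [_ [Mf [Sp bp]]] := sqrt_fantappie fp lf.
have [Sg [Mg [Sq bq]]] := sqrt_fantappie gq lg.
apply: csum_unique (drury_ip_csum drury_H HP Sp bp (SH Sg)) _.
rewrite (dcomp_unique drury_H HP Sq bq).
have := expands_ip_csum fp lf gq lg.
apply: (@ccvg_eventually _ _ _ _ 0) => K _; apply: eq_bigr => k _.
rewrite !poly_funZ (sipZl sip) ?(sipZr sip); try exact: HP.
  rewrite (ip_drury_bergman drury_H HP _ (fp.1 k)) -seul_sqr cconjV seul_conj.
  have := seul_neq0 k; rewrite -/(seul k); move: (seul k) => s s0; field.
  exact: s0.
by apply: (sip_scale sip); exact: HP.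
Qed.

Lemma fantappie_onto h : dom S h -> exists2 f, bergman R n f & fantappie f = h.
Proof.
(* Formally the preimage is [M h], but [h] is only in [dom S]; the components of [M h] are therefore
   summed pointwise. *)
move=> Sh; have Hh := domSH Sh; pose p k := (eul (n := n) k)%:R *: dcomp H h k.
have hp k : homog k (p k) by apply: homogZ; exact: homog_dcomp.
have dil (r : R) : 0 < r < 1 -> exists2 g, H g & expands g (fun k => ((r ^+ k)%:C)%C *: p k).
  move=> /andP[r0 r1]; have hr : 0 <= r < 1 by rewrite ltW.
  (* A bound for [r^k * eul k] uniform in [k]: the dilation by [r < 1] absorbs the polynomial growth
     of the eigenvalues, so the dilated series lies in [H]. *)
  pose c := n`!%:R / (1 - r) ^+ n.
  have hq k : homog k (((r ^+ k)%:C)%C *: p k) by exact: homogZ.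
  have bq : bounded_sums (fun k => sn2 ipH (poly_fun (((r ^+ k)%:C)%C *: p k)))
      (c ^+ 2 * sn2 ipH h).
    move=> K; apply: (@le_trans _ _ (c ^+ 2 * \sum_(k < K) sn2 ipH (poly_fun (dcomp H h k)))).
      rewrite mulr_sumr; apply: ler_sum => k _.
      rewrite scalerA poly_funZ (sn2Z sip); last exact: HP.
      apply: ler_wpM2r; first by apply: (sn2_ge0 sip); exact: HP.
      rewrite ncM nc_real nc_nat.
      rewrite ger0_norm; last by rewrite exprn_ge0// ltW.
      rewrite ler_pXn2r ?nnegrE ?mulr_ge0 ?exprn_ge0 ?(ltW r0)//.
        exact: eul_growth.
      by rewrite invr_ge0 exprn_ge0// subr_ge0 ltW.
    by rewrite ler_wpM2l ?sqr_ge0//; exact: (dcomp_bounded drury_H HP Hh).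
  by have [g [Hg gq _]] := drury_series_ex drury_H HP hq bq; exists g.
have [f fp] : exists f, expands f p.
  have /choice[f fP] : forall z : B, exists s, csum (fun k => pev (p k) (uball_val z)) s.
    move=> z; have [r [zr [r0 r1 zE]]] := scale_inv_ball z.
    have [|g _ gq] := dil r; first by rewrite r0.
    by exists (g zr); exact: expandsZ gq hp zE.
  by exists f.
have af : analytic f.
  apply: (dilates_analytic fp) => r /dil[g Hg gq]; exists g => //.
  by case: drury_H => _ + _ _; exact.
(* The norms match in each degree: [lam_k^2 |h_k|_A^2 = lam_k |h_k|_H^2], which is the squared norm
   of the component of [S h]. *)
have lf : L2B f.
  apply: (expands_L2B fp (M := sn2 ipH (S h))) => K.
  apply: le_trans (dcomp_bounded drury_H HP (SH Sh) K); apply: ler_sum => k _.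
  have hc := @homog_dcomp _ _ H h k.
  rewrite dcomp_S// !poly_funZ (sn2Z bergman_semi_ip) ?(sn2Z sip); last 2 first.
  - exact: HP.
  - exact: L2B_poly.
  rewrite (sn2_drury_bergman drury_H HP hc) mulrA nc_nat nc_real ger0_norm ?sqrtr_ge0//.
  by rewrite sqr_sqrtr ?ler0n.
exists f; first by split=> //; case: lf.
apply/funext => z; apply: csum_unique ((fantappie_expands drury_H HP fp lf).2 z) _.
apply: (@ccvg_eventually _ _ _ _ 0) ((dcomp_expands drury_H HP Hh).2 z) => K _.
by apply: eq_bigr => k _; rewrite /p scalerA mulVf ?scale1r// eulC_neq0.
Qed.

End euler_square_root.

Theorem proposition2p3 (R : realType) (n : nat) (hn : (0 < n)%N)
    (H : ip_space (uball R n -> R[i])) (drury_H : is_drury H)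
    (M : operator (uball R n -> R[i])) (selfadj_M : self_adjoint H M)
    (euler_M : extends_euler M)
    (sqrtM : operator (uball R n -> R[i])) (sqrt_M : is_sqrt_op H M sqrtM) :
  [/\ unitary_operator (bergman R n) (dom_space H sqrtM) (@fantappie R n),
      forall f, bergman R n f -> dom M (fantappie f) -> M (fantappie f) = f &
      forall f g, bergman R n f -> H g ->
        ip H (fantappie f) g = ip (bergman R n) f g].
Proof.
have HP := drury_poly selfadj_M euler_M.
split; last 2 first.
- exact: (M_fantappie drury_H selfadj_M euler_M).
- by move=> f g /bergman_expands[lf [p fp]] Hg; exact: (fantappie_adjoint drury_H HP fp).
split.
(* At each point the transform is a Bergman pairing with a fixed square integrable kernel, so it
   inherits linearity. *)
- move=> a f g /bergman_expands[lf _] /bergman_expands[lg _]; apply/funext => z.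
  have lK := drury_L2B drury_H HP (drury_kernelH drury_H z).
  have [_ lin _ _] := @bergman_semi_ip R n.
  by rewrite [LHS]fantappie_ip lin// -!fantappie_ip.
- exact: (fantappie_isometry drury_H selfadj_M euler_M sqrt_M).
- apply/seteqP; split=> [_ [f /bergman_expands[lf [p fp]] <-]|h Sh].
    by case: (sqrt_fantappie drury_H selfadj_M euler_M sqrt_M fp lf).
  have [f bf fh] := fantappie_onto drury_H selfadj_M euler_M sqrt_M Sh.
  by exists f.
Qed.
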